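(* Fix a positive integer $n$, a non-negative integer $k$ and $\alpha\in\mathbb{C}$. Let $\alpha_{k,n}(t)$ be the recurrence coefficient of the monic orthogonal polynomials with respect to the weight $w(z;t)$ on $\Gamma$ (see context), and set $$a_k(t)=a_{k,n}(t)=\alpha_{k,n}(t)-\frac{2k+1+n}{n}.$$ Then $a_k(t)$ satisfies the Painlevé III equation $$a_k''=\frac{(a_k')^2}{a_k}-\frac{a_k'}{t}+n(2k+1+n)\frac{a_k^2}{t^2}+\frac{n^2a_k^3}{t^2}+\frac{n^2}{t}-\frac{n^2}{a_k},$$ with the initial conditions $a_k(0)=0$, $a_k'(0)=1$. Moreover, the Hankel determinant satisfies $$D_k[w;t]=\mathrm{const}\cdot\tau(t)\,e^{n^2t/2}\,t^{k(k+n)/2},$$ where $\mathrm{const}$ does not depend on $t$ and $\tau(t)$ is the Jimbo–Miwa–Ueno isomonodromy $\tau$-function of this Painlevé III equation (defined, up to a multiplicative constant, in the context).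
   Context: **Weight and contour.** Let $\delta>0$ be a constant, $\Gamma=\Gamma_1\cup\Gamma_2\cup\Gamma_3$ with $\Gamma_1=(2\delta,\infty)$, $\Gamma_2=\{\delta(1+e^{i\theta}):\theta\in(0,\pi)\}$, $\Gamma_3=\{\delta(1+e^{i\theta}):\theta\in(-\pi,0)\}$; $\Gamma_2,\Gamma_3$ are oriented from $0$ to $2\delta$ and $\Gamma_1$ from $2\delta$ to $+\infty$. For $t<0$ let $V_t(z)=z-\log z+t/z$, $\arg z\in(-\pi,\pi)$, and $$w(z;t)=c_je^{-nV_t(z)},\quad z\in\Gamma_j,\qquad c_1=1,\ c_2=\alpha,\ c_3=1-\alpha .$$ **Hankel determinant.** $D_k[w;t]=\det(\mu_{i+j})_{i,j=0}^{k-1}$, $\mu_j=\int_\Gamma z^jw(z;t)\,dz$, $D_0=1$. **Orthogonal polynomials.** $\pi_{k,n}(z)$ is the monic polynomial of degree $k$ and $\gamma_{k,n}(t)$ the constant such that $\int_\Gamma \pi_{k,n}(z)z^jw(z;t)\,dz=\gamma_{k,n}^{-2}(t)\delta_{jk}$, $j=0,\dots,k$ ($\pi_{-1,n}\equiv0$, $\pi_{0,n}\equiv1$). They satisfy $$z\pi_{k,n}(z)=\pi_{k+1,n}(z)+\alpha_{k,n}(t)\pi_{k,n}(z)+\beta_{k,n}(t)\pi_{k-1,n}(z).$$ Since the orthogonality is non-Hermitian, the polynomials may fail to exist for some $t$; statements are understood for those $t$ for which the quantities involved are defined. The initial conditions at $t=0$ are understood as limits $t\to0$. **The $\tau$-function.**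 Let $$Y(z)=\begin{pmatrix}\pi_{k,n}(z)&\frac1{2\pi i}\int_\Gamma\frac{\pi_{k,n}(x)w(x;t)}{x-z}dx\\ -2\pi i\gamma_{k-1,n}^2\pi_{k-1,n}(z)&-\gamma_{k-1,n}^2\int_\Gamma\frac{\pi_{k-1,n}(x)w(x;t)}{x-z}dx\end{pmatrix}$$ (for $k=0$ the second row is $(0,1)$). Put $s=ni\sqrt{-t}$ (so $s^2=n^2t$), $\sigma_3=\mathrm{diag}(1,-1)$, and $$\Phi(\lambda,s)=\Big(\frac{ni}{s}\Big)^{(\frac n2+k)\sigma_3}Y\Big(\frac{s\lambda}{ni}\Big)e^{\frac i2(s\lambda-\frac s\lambda)\sigma_3}\Big(\frac{s\lambda}{ni}\Big)^{\frac n2\sigma_3}.$$ This function has constant jumps $\begin{pmatrix}1&c_j\\0&1\end{pmatrix}$ on $\frac1{\sqrt{-t}}\Gamma_j$ and satisfies the Lax pair of the Painlevé III equation. It has expansions $$\Phi(\lambda)=\Phi_\infty(\lambda)\lambda^{(\frac n2+k)\sigma_3}e^{\frac{is\lambda}2\sigma_3},\quad \Phi_\infty(\lambda)=I+\sum_{j\ge1}\Phi_{-j}\lambda^{-j}\quad(\lambda\to\infty),$$ $$\Phi(\lambda)=\Phi(0)\,\Phi_0(\lambda)\,\lambda^{\frac n2\sigma_3}e^{-\frac{is}{2\lambda}\sigma_3},\quad \Phi_0(\lambda)=I+\sum_{j\ge1}\Phi_j\lambda^j\quad(\lambda\to0),$$ with $\Phi(0)$ a constant (in $\lambda$) invertible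 matrix. The $\tau$-function is defined up to a multiplicative constant by $$d\log\tau=-\operatorname*{Res}_{\lambda=0}\mathrm{Tr}\Big\{\Phi_0^{-1}\frac{\partial\Phi_0}{\partial\lambda}dT_0(\lambda)\Big\}-\operatorname*{Res}_{\lambda=\infty}\mathrm{Tr}\Big\{\Phi_\infty^{-1}\frac{\partial\Phi_\infty}{\partial\lambda}dT_\infty(\lambda)\Big\},$$ where $dT_0(\lambda)=-\frac{i}{2\lambda}\sigma_3\,ds$ and $dT_\infty(\lambda)=\frac{i\lambda}2\sigma_3\,ds$; equivalently $\frac{d\log\tau}{ds}=\frac i2\mathrm{Tr}(\Phi_1\sigma_3-\Phi_{-1}\sigma_3)$. It is regarded as a function of $t$ through $s=ni\sqrt{-t}$. *)

(* Defs.v *)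
(* R[i] carries no canonical R-normed topology, so limits, derivatives and
   integrals of R[i]-valued functions are taken on real and imaginary parts. *)
From HB Require Import structures.
From mathcomp Require Import all_boot all_order all_algebra.
From mathcomp Require Import all_classical all_reals all_analysis.
From mathcomp Require Export complex.

Set Implicit Arguments.
Unset Strict Implicit.
Unset Printing Implicit Defensive.

Import Order.TTheory GRing.Theory Num.Theory.
Import numFieldNormedType.Exports.
Local Open Scope classical_set_scope.
Local Open Scope ring_scope.
Local Open Scope complex_scope.

Definition cvgC (R : realType) (T : Type) (F : set_system T) (f : T -> R[i])
    (l : R[i]) : Prop :=
  (complex.Re (f x) @[x --> F] --> complex.Re l) /\
  (complex.Im (f x) @[x --> F] --> complex.Im l).

Definition derivableC (R : realType) (f : R -> R[i]) (t : R) : Prop :=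
  derivable (fun u => complex.Re (f u)) t 1 /\
  derivable (fun u => complex.Im (f u)) t 1.

Definition deriveC (R : realType) (f : R -> R[i]) (t : R) : R[i] :=
  derive1 (fun u => complex.Re (f u)) t +i* derive1 (fun u => complex.Im (f u)) t.

Definition analyticC (R : realType) (D : set R) (f : R -> R[i]) : Prop :=
  forall t0, D t0 -> exists2 r : R, 0 < r & exists c : nat -> R[i],
    forall t, `|t - t0| < r ->
      cvgC \oo (fun N : nat => \sum_(m < N) c m * (t - t0)%:C ^+ m) (f t).

Definition intC (R : realType) (D : set R) (f : R -> R[i]) : R[i] :=
  (\int[lebesgue_measure]_(x in D) complex.Re (f x)) +i*
  (\int[lebesgue_measure]_(x in D) complex.Im (f x)).

Definition iC (R : realType) : R[i] := 0 +i* 1.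

Definition absC (R : realType) (z : R[i]) : R := complex.Re `|z|.

Definition expC (R : realType) (z : R[i]) : R[i] :=
  (expR (complex.Re z))%:C * (cos (complex.Im z) +i* sin (complex.Im z)).

(* Principal argument, with values in ]-pi, pi] for z != 0. *)
Definition argC (R : realType) (z : R[i]) : R :=
  (if complex.Im z < 0 then -1 else 1) * acos (complex.Re z / absC z).

Definition logC (R : realType) (z : R[i]) : R[i] := ln (absC z) +i* argC z.

Definition powC (R : realType) (z p : R[i]) : R[i] := expC (p * logC z).

Definition potential (R : realType) (t : R) (z : R[i]) : R[i] :=
  z - logC z + t%:C / z.

(* The weight w(z;t) on the arc Gamma_j carrying the constant c = c_j. *)
Definition weight (R : realType) (n : nat) (c : R[i]) (t : R) (z : R[i]) : R[i] :=
  c * expC (- n%:R * potential t z).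

Definition circ (R : realType) (delta theta : R) : R[i] :=
  delta%:C * (1 + expC (iC R * theta%:C)).

Definition dcirc (R : realType) (delta theta : R) : R[i] :=
  delta%:C * (iC R * expC (iC R * theta%:C)).

(* integral over Gamma of f(z) w(z;t) dz.  On Gamma_2 the orientation from 0 to
   2 delta is that of decreasing theta, hence the sign. *)
Definition intGamma (R : realType) (delta : R) (n : nat) (alpha : R[i]) (t : R)
    (f : R[i] -> R[i]) : R[i] :=
  intC `]2 * delta, +oo[ (fun x => f x%:C * weight n 1 t x%:C)
  - intC `]0, pi[ (fun theta => let z := circ delta theta in
      f z * weight n alpha t z * dcirc delta theta)
  + intC `](- pi), 0[ (fun theta => let z := circ delta theta in
      f z * weight n (1 - alpha) t z * dcirc delta theta).

Definition moment (R : realType) (delta : R) (n : nat) (alpha : R[i]) (t : R)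
    (j : nat) : R[i] :=
  intGamma delta n alpha t (fun z => z ^+ j).

Definition hankel (R : realType) (delta : R) (n : nat) (alpha : R[i])
    (t : R) (k : nat) : R[i] :=
  \det (\matrix_(i < k, j < k) moment delta n alpha t (i + j)%N).

Definition orthopoly (R : realType) (delta : R) (n : nat) (alpha : R[i]) (t : R)
    (k : nat) (p : {poly R[i]}) : Prop :=
  [/\ p \is monic, size p = k.+1 & forall j, (j < k)%N ->
    intGamma delta n alpha t (fun z => p.[z] * z ^+ j) = 0].

(* p is "the" polynomial pi_{k,n} at the parameter t: the orthogonality is
   non-Hermitian, so existence and uniqueness are part of the assertion. *)
Definition is_pi (R : realType) (delta : R) (n : nat) (alpha : R[i]) (t : R)
    (k : nat) : {poly R[i]} -> Prop :=
  unique (orthopoly delta n alpha t k).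

(* p is pi_{k-1,n}, with pi_{-1,n} = 0. *)
Definition is_pi_pred (R : realType) (delta : R) (n : nat) (alpha : R[i]) (t : R)
    (k : nat) (p : {poly R[i]}) : Prop :=
  if k is k'.+1 then is_pi delta n alpha t k' p else p = 0.

(* a is the recurrence coefficient alpha_{k,n}(t); "exists a, is_alpha t k a"
   says that alpha_{k,n} is defined at t. *)
Definition is_alpha (R : realType) (delta : R) (n : nat) (alpha : R[i]) (t : R)
    (k : nat) (a : R[i]) : Prop :=
  exists (p0 p p1 : {poly R[i]}) (b : R[i]),
    [/\ is_pi_pred delta n alpha t k p0, is_pi delta n alpha t k p,
        is_pi delta n alpha t k.+1 p1 &
        'X * p = p1 + a *: p + b *: p0].

(* gamma_{k,n}^2, from gamma_{k,n}^{-2} = \int_Gamma pi_{k,n}(z) z^k w dz. *)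
Definition gamma_sq (R : realType) (delta : R) (n : nat) (alpha : R[i]) (t : R)
    (k : nat) (p : {poly R[i]}) : R[i] :=
  (intGamma delta n alpha t (fun z => p.[z] * z ^+ k))^-1.

Definition mx2 (C : Type) (a b c d : C) : 'M[C]_2 :=
  \matrix_(i, j) if i == 0 :> 'I_2 then (if j == 0 :> 'I_2 then a else b)
                 else (if j == 0 :> 'I_2 then c else d).

Definition sigma3 (R : realType) : 'M[R[i]]_2 := mx2 1 0 0 (-1).

(* x^sigma_3 *)
Definition xsigma3 (R : realType) (x : R[i]) : 'M[R[i]]_2 := mx2 x 0 0 x^-1.

(* int_Gamma p(x) w(x;t) / (x - z) dx *)
Definition cauchy (R : realType) (delta : R) (n : nat) (alpha : R[i]) (t : R)
    (p : {poly R[i]}) (z : R[i]) : R[i] :=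
  intGamma delta n alpha t (fun x => p.[x] / (x - z)).

(* p and q stand for pi_{k,n} and pi_{k-1,n}. *)
Definition Ymx (R : realType) (delta : R) (n : nat) (alpha : R[i]) (t : R)
    (k : nat) (p q : {poly R[i]}) (z : R[i]) : 'M[R[i]]_2 :=
  let ipi2 := 2 * pi%:C * iC R in
  let y11 := p.[z] in
  let y12 := cauchy delta n alpha t p z / ipi2 in
  if k is k'.+1 then
    let g := gamma_sq delta n alpha t k' q in
    mx2 y11 y12 (- ipi2 * g * q.[z]) (- g * cauchy delta n alpha t q z)
  else mx2 y11 y12 0 1.

Definition s_of (R : realType) (n : nat) (t : R) : R[i] :=
  n%:R * iC R * (Num.sqrt (- t))%:C.

Definition Phi (R : realType) (delta : R) (n : nat) (alpha : R[i]) (t : R)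
    (k : nat) (p q : {poly R[i]}) (l : R[i]) : 'M[R[i]]_2 :=
  let s := s_of n t in
  let ni := n%:R * iC R in
  let z := s * l / ni in
  xsigma3 (powC (ni / s) (n%:R / 2 + k%:R))
  *m Ymx delta n alpha t k p q z
  *m xsigma3 (expC (iC R / 2 * (s * l - s / l)))
  *m xsigma3 (powC z (n%:R / 2)).

(* Asymptotic expansion F(l) ~ \sum_m A_m l^{-m} as l -> oo, uniformly in every
   closed sector avoiding the positive real axis, along which the contour goes to
   infinity. *)
Definition expansion_oo (R : realType) (F : R[i] -> 'M[R[i]]_2)
    (A : nat -> 'M[R[i]]_2) : Prop :=
  forall (c : R) (M : nat), c < 1 -> exists K rho : R, forall l : R[i],
    rho <= absC l -> complex.Re l <= c * absC l -> forall i j,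
    absC ((F l - \sum_(m < M) (l^-1) ^+ m *: A m) i j) <= K * (absC l)^-1 ^+ M.

(* Asymptotic expansion F(l) ~ \sum_m A_m l^m as l -> 0, uniformly in every
   closed double sector avoiding the imaginary axis, to which the contour is
   tangent at its end point 0.  The weight is only O(|l|^n) on the contour, so
   the expansion is not uniform up to the contour. *)
Definition expansion_0 (R : realType) (F : R[i] -> 'M[R[i]]_2)
    (A : nat -> 'M[R[i]]_2) : Prop :=
  forall (c : R) (M : nat), 0 < c -> exists K rho : R, 0 < rho /\
    forall l : R[i], 0 < absC l <= rho -> c * absC l <= `|complex.Re l| ->
    forall i j,
    absC ((F l - \sum_(m < M) l ^+ m *: A m) i j) <= K * absC l ^+ M.

(* A_m is the coefficient Phi_{-m} of Phi_infinity. *)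
Definition Phi_expansion_oo (R : realType) (delta : R) (n : nat) (alpha : R[i])
    (t : R) (k : nat) (p q : {poly R[i]}) (A : nat -> 'M[R[i]]_2) : Prop :=
  let s := s_of n t in
  A 0%N = 1%:M /\ exists2 Phioo : R[i] -> 'M[R[i]]_2, expansion_oo Phioo A &
    forall l, l != 0 -> Phi delta n alpha t k p q l =
      Phioo l *m xsigma3 (powC l (n%:R / 2 + k%:R))
              *m xsigma3 (expC (iC R * s * l / 2)).

(* A_m is the coefficient Phi_m of Phi_0, and G is the matrix Phi(0). *)
Definition Phi_expansion_0 (R : realType) (delta : R) (n : nat) (alpha : R[i])
    (t : R) (k : nat) (p q : {poly R[i]}) (A : nat -> 'M[R[i]]_2) : Prop :=
  let s := s_of n t in
  A 0%N = 1%:M /\ exists (G : 'M[R[i]]_2) (Phi0 : R[i] -> 'M[R[i]]_2),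
    [/\ G \in unitmx, expansion_0 Phi0 A &
    forall l, l != 0 -> Phi delta n alpha t k p q l =
      G *m Phi0 l *m xsigma3 (powC l (n%:R / 2))
                  *m xsigma3 (expC (- iC R * s / (2 * l)))].

(* Formal power series are sequences of coefficients nat -> 'M[R[i]]_2. *)
Definition fps_one (R : realType) (m : nat) : 'M[R[i]]_2 := (m == 0%N)%:R%:M.

Definition fps_mul (R : realType) (A B : nat -> 'M[R[i]]_2) (m : nat) :
    'M[R[i]]_2 :=
  \sum_(i < m.+1) A i *m B (m - i)%N.

(* Neumann series \sum_j (1 - A)^j, which is A^{-1} when A_0 = 1. *)
Definition fps_inv (R : realType) (A : nat -> 'M[R[i]]_2) (m : nat) :
    'M[R[i]]_2 :=
  \sum_(j < m.+1)
    iter j (fps_mul (fun i => fps_one R i - A i)) (fps_one R) m.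

(* Coefficient of l^m in d/dl \sum_j A_j l^j. *)
Definition fps_deriv (R : realType) (A : nat -> 'M[R[i]]_2) (m : nat) :
    'M[R[i]]_2 := A m.+1 *+ m.+1.

(* Coefficient of l^{-m} in d/dl \sum_j A_j l^{-j}. *)
Definition fps_deriv_oo (R : realType) (A : nat -> 'M[R[i]]_2) (m : nat) :
    'M[R[i]]_2 := - (A m.-1 *+ m.-1).

(* Res_{l=0} Tr{Phi_0^{-1} Phi_0' dT_0}/ds, with dT_0/ds = - i/(2 l) sigma_3: the
   coefficient of l^{-1} picks the constant term of Phi_0^{-1} Phi_0'. *)
Definition res_0 (R : realType) (A : nat -> 'M[R[i]]_2) : R[i] :=
  \tr (fps_mul (fps_inv A) (fps_deriv A) 0%N *m (- (iC R / 2) *: sigma3 R)).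

(* Res_{l=oo} Tr{Phi_oo^{-1} Phi_oo' dT_oo}/ds, with dT_oo/ds = i l/2 sigma_3:
   minus the coefficient of l^{-1}, which picks the l^{-2} term of
   Phi_oo^{-1} Phi_oo'. *)
Definition res_oo (R : realType) (A : nat -> 'M[R[i]]_2) : R[i] :=
  - \tr (fps_mul (fps_inv A) (fps_deriv_oo A) 2%N *m ((iC R / 2) *: sigma3 R)).

(* tau, as a function of t through s = s_of n t, is the isomonodromy tau-function:
   d log tau / dt = (- Res_0 - Res_oo) ds/dt wherever Y is defined.  The zeros of
   D_{k-1} and D_k, where Y is not defined, may disconnect the half-line t < 0;
   real-analyticity across them makes tau unique up to a single constant. *)
Definition is_tau (R : realType) (delta : R) (n : nat) (alpha : R[i]) (k : nat)
    (tau : R -> R[i]) : Prop :=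
  analyticC `]-oo, 0[ tau /\
  forall (t : R) (p q : {poly R[i]}), t < 0 ->
    is_pi delta n alpha t k p -> is_pi_pred delta n alpha t k q ->
    exists Aoo A0 : nat -> 'M[R[i]]_2,
    [/\ Phi_expansion_oo delta n alpha t k p q Aoo,
        Phi_expansion_0 delta n alpha t k p q A0, tau t != 0 &
        deriveC tau t / tau t = (- res_0 A0 - res_oo Aoo) * deriveC (s_of n) t].

(* Main.v *)
Require Import Defs.
From HB Require Import structures.
From mathcomp Require Import all_boot all_order all_algebra.
From mathcomp Require Import fingroup perm.
From mathcomp Require Import all_classical all_reals all_analysis.
From mathcomp Require Import measurable_realfun.
From mathcomp Require Import complex.
From mathcomp Require Import ring lra.

Set Implicit Arguments.
Unset Strict Implicit.
Unset Printing Implicit Defensive.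

Import Order.TTheory GRing.Theory Num.Theory.
Import numFieldNormedType.Exports.
Local Open Scope classical_set_scope.
Local Open Scope ring_scope.
Local Open Scope complex_scope.

(** The weight satisfies the Pearson equation
   [w' / w = n / z - n + n t / z ^ 2] and [dw / dt = - (n / z) w].  Integration by
   parts on the contour therefore gives a three-term recursion for the moments
   [int z ^ j w], [j >= -1], and the derivative of a moment in [t] is a multiple of
   the preceding moment.  With these two facts and the limits of the moments as [t]
   tends to 0, everything about the orthogonal polynomials is algebra over the
   moment sequence.

   Painlevé III.  Let [p] and [q] be the orthogonal polynomials of degrees [k] and
   [k - 1], with norms [h] and [g].  Integration by parts applied to [p ^ 2] shows
   that [a = t * int p ^ 2 w / z / h] ([alpha_identity], [afunE]).  Put
   [r = t * int p q w / z / g], and [r = 0] if [k = 0].  Differentiating the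
   orthogonality relations and eliminating the neighbouring levels through
   [subleading_identity], [Lam_next] and [product_identity] yields, with
   [c = 2 k + 1 + n],
     [t a' = n (2 r - t) + n a ^ 2 + c a],
     [t a r' = c r a - k t a + 2 n r (r - t)],
   from which [PIII_elimination] removes [r].  As [t] tends to 0 the moments tend to
   those of a Laguerre weight, whose Hankel determinants do not vanish
   ([laguerre_det_neq0]); so [a / t] and [r / t] have the limits [1] and [- k / n],
   and the first equation gives the slope of [a].

   The tau-function.  Let [s] be the subleading coefficient of [p].  The shifted
   Hankel matrix is a companion matrix times the Hankel matrix, whence
   [t D' / D = k (k + n) + n s] for [D = D_k] ([hankel_derivative]).  On the other
   side, the coefficient of order one of Phi at infinity has the diagonal of the
   expansion of the polynomials, that is [s] and [- s], up to explicit terms; the one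
   at 0 is evaluated by integrating the Wronskian of [p] and [q] by parts
   ([trace_identity]).  Both residues become affine in [s], and
     [d log tau / dt = (2 n s + k (k + n)) / (2 t) - n ^ 2 / 2]
   ([log_derivative]), which is the logarithmic derivative of
   [D * exp (- n ^ 2 t / 2) * t ^ (- k (k + n) / 2)].

   The expansions themselves come from Cauchy integrals of powers.  At infinity the
   geometric series suffices.  At 0 the contour is tangent to the imaginary axis and
   the weight only vanishes to order [n], so the geometric series reaches an order
   limited by the degree; the Pearson equation, read as an expression of a Cauchy
   integral by ones of higher degree, raises the degree as far as needed
   ([cauchy_mu_asym_0]).

   Finally the moments solve linear differential equations in [t] and are therefore
   analytic for [t < 0], as is [D]; two tau-functions agree up to a constant near 0,
   where all polynomials exist, and hence everywhere ([tau_proportional]). *)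

(** * Complex-valued functions: modulus, limits, derivatives *)

Section ComplexCalculus.
Context {R : realType}.
Implicit Types (z w l m : R[i]).

Lemma absCE z : absC z = Num.sqrt (complex.Re z ^+ 2 + complex.Im z ^+ 2).
Proof. by rewrite /absC normc_def. Qed.

Lemma normC_absC z : `|z| = (absC z)%:C.
Proof. by rewrite absCE normc_def. Qed.

Lemma absC_ge0 z : 0 <= absC z. Proof. by rewrite absCE sqrtr_ge0. Qed.
#[local] Hint Resolve absC_ge0 : core.


Lemma absC0 : absC (0 : R[i]) = 0.
Proof. by rewrite /absC normr0. Qed.

Lemma absC1 : absC (1 : R[i]) = 1.
Proof. by rewrite /absC normr1. Qed.

Lemma absCN z : absC (- z) = absC z.
Proof. by rewrite /absC normrN. Qed.

Lemma absCM z w : absC (z * w) = absC z * absC w.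
Proof. by apply: complexI; rewrite rmorphM /= -!normC_absC normrM. Qed.

Lemma absCV z : absC z^-1 = (absC z)^-1.
Proof. by apply: complexI; rewrite fmorphV /= -!normC_absC normfV. Qed.

Lemma absCX z k : absC (z ^+ k) = absC z ^+ k.
Proof. by apply: complexI; rewrite rmorphXn /= -!normC_absC normrX. Qed.

Lemma ler_absCD z w : absC (z + w) <= absC z + absC w.
Proof. by rewrite -lecR rmorphD /= -!normC_absC ler_normD. Qed.

Lemma ler_absCB z w : absC z - absC w <= absC (z - w).
Proof. by rewrite -lecR rmorphB /= -!normC_absC lerB_dist. Qed.

Lemma ler_absC_sum (I : Type) (r : seq I) (P : pred I) (F : I -> R[i]) :
  absC (\sum_(i <- r | P i) F i) <= \sum_(i <- r | P i) absC (F i).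
Proof.
rewrite -lecR rmorph_sum /= -normC_absC (le_trans (ler_norm_sum _ _ _)) //.
Qed.

Lemma absC_eq0 z : (absC z == 0) = (z == 0).
Proof. by rewrite -(normr_eq0 z) normC_absC eq_complex /= eqxx andbT. Qed.

Lemma absC_gt0 z : (0 < absC z) = (z != 0).
Proof. by rewrite lt_def absC_ge0 andbT absC_eq0. Qed.

Lemma absCR (x : R) : absC x%:C = `|x|.
Proof. by rewrite absCE /= expr0n addr0 sqrtr_sqr. Qed.

Lemma natCR (k : nat) : k%:R = (k%:R : R)%:C.
Proof. by rewrite rmorph_nat. Qed.

Lemma absC_nat (k : nat) : absC (k%:R : R[i]) = k%:R.
Proof. by rewrite natCR absCR ger0_norm. Qed.

Lemma ler_ReC z : `|complex.Re z| <= absC z.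
Proof.
rewrite absCE -sqrtr_sqr ler_sqrt ?lerDl ?sqr_ge0 //.
by rewrite addr_ge0 ?sqr_ge0.
Qed.

Lemma ler_ImC z : `|complex.Im z| <= absC z.
Proof.
rewrite absCE -sqrtr_sqr ler_sqrt ?lerDr ?sqr_ge0 //.
by rewrite addr_ge0 ?sqr_ge0.
Qed.

Lemma ler_absC z : absC z <= `|complex.Re z| + `|complex.Im z|.
Proof.
rewrite absCE -[leRHS]ger0_norm ?addr_ge0 // -sqrtr_sqr ler_sqrt ?sqr_ge0 //.
rewrite sqrrD !real_normK ?num_real //.
by have := mulr_ge0 (normr_ge0 (complex.Re z)) (normr_ge0 (complex.Im z)); lra.
Qed.

Lemma ReM z w : complex.Re (z * w) =
  complex.Re z * complex.Re w - complex.Im z * complex.Im w.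
Proof. by case: z => a b; case: w. Qed.

Lemma ImM z w : complex.Im (z * w) =
  complex.Re z * complex.Im w + complex.Im z * complex.Re w.
Proof. by case: z => a b; case: w. Qed.

Lemma ReD z w : complex.Re (z + w) = complex.Re z + complex.Re w.
Proof. by case: z => a b; case: w. Qed.

Lemma ImD z w : complex.Im (z + w) = complex.Im z + complex.Im w.
Proof. by case: z => a b; case: w. Qed.

Lemma ReN z : complex.Re (- z) = - complex.Re z. Proof. by case: z. Qed.
Lemma ImN z : complex.Im (- z) = - complex.Im z. Proof. by case: z. Qed.

Lemma Re_realM (x : R) z : complex.Re (x%:C * z) = x * complex.Re z.
Proof. by case: z => p q /=; rewrite mul0r subr0. Qed.

Lemma ReV z : complex.Re z^-1 =
  complex.Re z / (complex.Re z ^+ 2 + complex.Im z ^+ 2).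
Proof. by case: z. Qed.

Lemma ImV z : complex.Im z^-1 =
  - (complex.Im z / (complex.Re z ^+ 2 + complex.Im z ^+ 2)).
Proof. by case: z. Qed.

Lemma sqrReIm_neq0 z : z != 0 -> complex.Re z ^+ 2 + complex.Im z ^+ 2 != 0.
Proof.
move=> z0; apply: contra_neq z0 => H; apply/eqP.
by rewrite -absC_eq0 absCE H sqrtr0.
Qed.

Lemma complexP z w :
  complex.Re z = complex.Re w -> complex.Im z = complex.Im w -> z = w.
Proof. by case: z => a b; case: w => c d /= -> ->. Qed.

(** ** Limits of complex-valued functions *)

Section Limits.
Context {T : Type} {F : set_system T} {FF : Filter F}.
Implicit Types f g : T -> R[i].

Lemma cvgC_cst l : cvgC F (fun=> l) l.
Proof. by split; exact: cvg_cst. Qed.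

Lemma cvgC_D f g l m : cvgC F f l -> cvgC F g m ->
  cvgC F (fun x => f x + g x) (l + m).
Proof.
move=> [f1 f2] [g1 g2]; split; rewrite ?ReD ?ImD.
- by under eq_fun do rewrite ReD; exact: cvgD.
- by under eq_fun do rewrite ImD; exact: cvgD.
Qed.

Lemma cvgC_M f g l m : cvgC F f l -> cvgC F g m ->
  cvgC F (fun x => f x * g x) (l * m).
Proof.
move=> [f1 f2] [g1 g2]; split; rewrite ?ReM ?ImM.
- by under eq_fun do rewrite ReM; apply: cvgB; exact: cvgM.
- by under eq_fun do rewrite ImM; apply: cvgD; exact: cvgM.
Qed.

Lemma cvgC_N f l : cvgC F f l -> cvgC F (fun x => - f x) (- l).
Proof.
move=> [f1 f2]; split; rewrite ?ReN ?ImN.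
- by under eq_fun do rewrite ReN; exact: cvgN.
- by under eq_fun do rewrite ImN; exact: cvgN.
Qed.

Lemma cvgC_V f l : l != 0 -> cvgC F f l -> cvgC F (fun x => (f x)^-1) l^-1.
Proof.
move=> l0 [f1 f2]; have Hn : complex.Re (f x) ^+ 2 + complex.Im (f x) ^+ 2 @[x --> F]
    --> complex.Re l ^+ 2 + complex.Im l ^+ 2.
  by rewrite !expr2; under eq_fun do rewrite !expr2; apply: cvgD; exact: cvgM.
split; rewrite ?ReV ?ImV.
- by under eq_fun do rewrite ReV; apply: cvgM => //; apply: cvgV => //; exact: sqrReIm_neq0.
- under eq_fun do rewrite ImV; apply: cvgN.
  by apply: cvgM => //; apply: cvgV => //; exact: sqrReIm_neq0.
Qed.

Lemma near_cvgC f g l : (\forall x \near F, f x = g x) -> cvgC F g l ->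
  cvgC F f l.
Proof.
move=> fg [g1 g2]; split.
- apply: cvg_trans g1; apply: near_eq_cvg.
  by apply: filterS fg => x ->.
- apply: cvg_trans g2; apply: near_eq_cvg.
  by apply: filterS fg => x ->.
Qed.

Lemma near_le_cvg0 (h g : T -> R) : (\forall u \near F, `|h u| <= g u) ->
  g u @[u --> F] --> (0 : R) -> h u @[u --> F] --> (0 : R).
Proof.
move=> hg g0; apply: norm_cvg0.
apply: (@squeeze_cvgr _ _ _ _ (fun=> 0) g) => //; last exact: cvg_cst.
by apply: filterS hg => u; rewrite normr_ge0.
Qed.

Lemma cvgC_absP f l : cvgC F f l <-> absC (f x - l) @[x --> F] --> (0 : R).
Proof.
split=> [[f1 f2]|Hf].
  apply: (@near_le_cvg0 _
    (fun u => `|complex.Re (f u - l)| + `|complex.Im (f u - l)|)).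
    by apply: nearW => u; rewrite ger0_norm ?ler_absC.
  rewrite -[X in _ --> X](addr0 0) -(normr0 R); apply: cvgD; apply: cvg_norm.
  - by under eq_fun do rewrite ReD ReN; exact/subr_cvg0.
  - by under eq_fun do rewrite ImD ImN; exact/subr_cvg0.
split; apply/subr_cvg0; apply: near_le_cvg0 Hf; apply: nearW => u.
- by rewrite -ReN -ReD ler_ReC.
- by rewrite -ImN -ImD ler_ImC.
Qed.

Lemma cvgC_X f l k : cvgC F f l -> cvgC F (fun u => f u ^+ k) (l ^+ k).
Proof.
move=> fl; elim: k => [|k IH]; first exact: cvgC_cst.
by under eq_fun do rewrite exprS; rewrite exprS; exact: cvgC_M.
Qed.

Lemma cvgC_B f g l m : cvgC F f l -> cvgC F g m ->
  cvgC F (fun x => f x - g x) (l - m).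
Proof. by move=> fl gm; apply: cvgC_D => //; exact: cvgC_N. Qed.

Lemma cvgC_abs f l : cvgC F f l -> absC (f u) @[u --> F] --> absC l.
Proof.
move/cvgC_absP => H; apply/subr_cvg0; apply: near_le_cvg0 H; apply: nearW => u.
rewrite ler_norml; apply/andP; split; last exact: ler_absCB.
by rewrite lerNl opprB -(absCN (f u - l)) opprB ler_absCB.
Qed.

Lemma cvgC_neq0 f l : cvgC F f l -> l != 0 -> \forall u \near F, f u != 0.
Proof.
move=> /cvgC_abs fl; rewrite -absC_gt0 => l0.
have H : \forall u \near F, 0 < absC (f u) by exact: cvgr_gt fl _ l0.
by apply: filterS H => u; rewrite absC_gt0.
Qed.


End Limits.

Lemma cvgC_unique (T : Type) (F : set_system T) {FF : ProperFilter F}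
  (f : T -> R[i]) l m : cvgC F f l -> cvgC F f m -> l = m.
Proof.
move=> [f1 f2] [g1 g2]; apply: complexP.
- by rewrite -(cvg_lim _ f1) // (cvg_lim _ g1).
- by rewrite -(cvg_lim _ f2) // (cvg_lim _ g2).
Qed.

(** ** Differentiation of complex-valued functions of a real variable *)

(** Existence and value of the derivative travel together through the rules of
   calculus; [is_derCP] recovers [derivableC] and [deriveC]. *)
Definition is_derC (f : R -> R[i]) (x : R) (l : R[i]) : Prop :=
  is_derive x 1 (fun u => complex.Re (f u)) (complex.Re l) /\
  is_derive x 1 (fun u => complex.Im (f u)) (complex.Im l).

Lemma is_derCP (f : R -> R[i]) (x : R) l :
  is_derC f x l <-> derivableC f x /\ deriveC f x = l.
Proof.
split=> [[H1 H2]|[[H1 H2] <-]].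
  split; first by split; [case: H1|case: H2].
  by apply: complexP; rewrite /= derive1E; [case: H1|case: H2].
by split; rewrite /= derive1E; exact: derivableP.
Qed.

Lemma is_derC_unique (f : R -> R[i]) (x : R) l m :
  is_derC f x l -> is_derC f x m -> l = m.
Proof. by move=> /is_derCP[_ <-] /is_derCP[_ <-]. Qed.

Lemma is_derC_eq (f : R -> R[i]) (x : R) l m :
  is_derC f x l -> l = m -> is_derC f x m.
Proof. by move=> + <-. Qed.

Lemma is_derC_cvg (f : R -> R[i]) (x : R) l :
  is_derC f x l -> cvgC (nbhs x) f (f x).
Proof.
move=> [[H1 _] [H2 _]]; split.
- by apply: differentiable_continuous; apply/derivable1_diffP.
- by apply: differentiable_continuous; apply/derivable1_diffP.
Qed.

Lemma is_derC_cst (x : R) l : is_derC (fun=> l) x 0.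
Proof. by split; exact: is_derive_cst. Qed.

Lemma is_derC_real (f : R -> R) (x l : R) :
  is_derive x 1 f l -> is_derC (fun u => (f u)%:C) x l%:C.
Proof. by move=> H; split => //=; exact: is_derive_cst. Qed.

Lemma is_derC_id (x : R) : is_derC (real_complex R) x 1.
Proof. by apply: is_derC_real; exact: is_derive_id. Qed.

Lemma is_derC_D (f g : R -> R[i]) (x : R) l m : is_derC f x l -> is_derC g x m ->
  is_derC (fun u => f u + g u) x (l + m).
Proof.
move=> [f1 f2] [g1 g2]; split; rewrite ?ReD ?ImD.
- by under eq_fun do rewrite ReD; exact: is_deriveD.
- by under eq_fun do rewrite ImD; exact: is_deriveD.
Qed.

Lemma is_derC_N (f : R -> R[i]) (x : R) l : is_derC f x l ->
  is_derC (fun u => - f u) x (- l).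
Proof.
move=> [f1 f2]; split; rewrite ?ReN ?ImN.
- by under eq_fun do rewrite ReN; exact: is_deriveN.
- by under eq_fun do rewrite ImN; exact: is_deriveN.
Qed.

Lemma is_derC_B (f g : R -> R[i]) (x : R) l m : is_derC f x l -> is_derC g x m ->
  is_derC (fun u => f u - g u) x (l - m).
Proof. by move=> fl gm; apply: is_derC_D => //; exact: is_derC_N. Qed.

Lemma is_derC_M (f g : R -> R[i]) (x : R) l m : is_derC f x l -> is_derC g x m ->
  is_derC (fun u => f u * g u) x (l * g x + f x * m).
Proof.
move=> [f1 f2] [g1 g2]; split.
- under eq_fun do rewrite ReM.
  have H := is_deriveB (is_deriveM f1 g1) (is_deriveM f2 g2).
  by apply: is_derive_eq H _; rewrite !ReD !ReM /GRing.scale /=; ring.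
- under eq_fun do rewrite ImM.
  have H := is_deriveD (is_deriveM f1 g2) (is_deriveM f2 g1).
  by apply: is_derive_eq H _; rewrite !ImD !ImM /GRing.scale /=; ring.
Qed.

Lemma is_derC_V (f : R -> R[i]) (x : R) l : f x != 0 -> is_derC f x l ->
  is_derC (fun u => (f u)^-1) x (- l / f x ^+ 2).
Proof.
move=> f0 [f1 f2].
have n0 := sqrReIm_neq0 f0.
have N := is_deriveD (is_deriveM f1 f1) (is_deriveM f2 f2).
have n0' : complex.Re (f x) * complex.Re (f x) + complex.Im (f x) * complex.Im (f x) != 0
  by rewrite -!expr2.
have V := @is_deriveV _ _ _ _ _ (n0' : (_ + _) x != 0) N.
have -> : - l / f x ^+ 2 = - l * ((f x)^-1 * (f x)^-1) by rewrite -expr2 exprVn.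
split.
- under eq_fun do rewrite ReV !expr2.
  have H := is_deriveM f1 V.
  apply: is_derive_eq H _.
  rewrite !ReM !ImM !ReV !ImV ReN ImN /GRing.scale /= !fctE.
  by field.
- under eq_fun do rewrite ImV !expr2.
  have H := is_deriveN (is_deriveM f2 V).
  apply: is_derive_eq H _.
  rewrite !ImM !ReM !ReV !ImV ReN ImN /GRing.scale /= !fctE.
  by field.
Qed.
End ComplexCalculus.
#[global] Hint Extern 0 (is_true (0 <= absC _)) => solve [apply: absC_ge0] : core.

Definition ReImE (R : realType) := (@ReM R, @ImM R, @ReD R, @ImD R, @ReN R, @ImN R).

(** * Exponential, logarithm and powers *)

Section ExpLog.
Context {R : realType}.
Implicit Types (z w l m : R[i]).

Lemma expCD z w : expC (z + w) = expC z * expC w.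
Proof.
rewrite /expC ReD ImD expRD cosD sinD; apply: complexP; rewrite !ReImE /=; ring.
Qed.

Lemma expC0 : expC (0 : R[i]) = 1.
Proof. by rewrite /expC /= expR0 cos0 sin0 mul1r. Qed.

Lemma absC_expC z : absC (expC z) = expR (complex.Re z).
Proof.
rewrite /expC absCM absCR ger0_norm ?expR_ge0 //.
by rewrite absCE /= cos2Dsin2 sqrtr1 mulr1.
Qed.

Lemma expC_neq0 z : expC z != 0.
Proof. by rewrite -absC_gt0 absC_expC expR_gt0. Qed.

Lemma expCN z : expC (- z) = (expC z)^-1.
Proof.
apply: (mulfI (expC_neq0 z)).
by rewrite divff ?expC_neq0 // -expCD subrr expC0.
Qed.

Lemma expC_nat k z : expC (k%:R * z) = expC z ^+ k.
Proof.
elim: k => [|k IH]; first by rewrite mul0r expC0.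
by rewrite mulrSr mulrDl mul1r expCD IH exprSr.
Qed.

(** The sign chosen in [argC] is that of the imaginary part, so that the cosine
   and the sine of the argument both come out right. *)
Lemma expCK z : z != 0 -> expC (logC z) = z.
Proof.
rewrite -absC_gt0 => z0.
have zE : absC z ^+ 2 = complex.Re z ^+ 2 + complex.Im z ^+ 2.
  by rewrite absCE sqr_sqrtr // addr_ge0 ?sqr_ge0.
have H : -1 <= complex.Re z / absC z <= 1.
  by rewrite -ler_norml normrM normfV (ger0_norm (ltW z0)) ler_pdivrMr // mul1r ler_ReC.
rewrite /expC /logC /= lnK ?posrE // /argC.
have -> : cos ((if complex.Im z < 0 then -1 else 1) * acos (complex.Re z / absC z))
    = complex.Re z / absC z.
  by case: ifP => _; rewrite ?mulN1r ?mul1r ?cosN acosK.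
have -> : sin ((if complex.Im z < 0 then -1 else 1) * acos (complex.Re z / absC z))
    = complex.Im z / absC z.
  have -> : sin ((if complex.Im z < 0 then -1 else 1) * acos (complex.Re z / absC z))
     = (if complex.Im z < 0 then -1 else 1) * sin (acos (complex.Re z / absC z)).
    by case: ifP => _; rewrite ?mulN1r ?mul1r ?sinN.
  rewrite sin_acos //.
  have -> : 1 - (complex.Re z / absC z) ^+ 2 = (complex.Im z / absC z) ^+ 2.
    rewrite !expr_div_n zE; field; rewrite -zE sqrf_eq0 gt_eqF //.
  rewrite sqrtr_sqr normrM normfV (ger0_norm (ltW z0)).
  case: ltP => Hi; first by rewrite ltr0_norm // mulN1r mulNr opprK.
  by rewrite ger0_norm // mul1r.
apply: complexP; rewrite !ReImE /=; field; exact: lt0r_neq0.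
Qed.

(** A positive factor leaves the argument unchanged; for other factors the branch
   cut could add a multiple of [2 pi i]. *)
Lemma logCM (x : R) z : 0 < x -> z != 0 -> logC (x%:C * z) = (ln x)%:C + logC z.
Proof.
move=> x0; rewrite -absC_gt0 => z0; rewrite /logC absCM absCR ger0_norm ?ltW //.
rewrite lnM ?posrE //; apply: complexP; rewrite !ReImE /= ?add0r //.
rewrite /argC absCM absCR ger0_norm ?ltW // ReM ImM /= !mul0r subr0 addr0.
by rewrite pmulr_rlt0 // -mulf_div divff ?mul1r ?gt_eqF.
Qed.

Lemma logCR (x : R) : 0 < x -> logC x%:C = (ln x)%:C.
Proof.
move=> x0; rewrite -[x%:C]mulr1 logCM ?oner_eq0 // /logC /argC absC1 ln1 /= ltxx.
by rewrite mul1r divr1 acos1 addr0.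
Qed.

Lemma powC_neq0 z w : powC z w != 0.
Proof. exact: expC_neq0. Qed.

Lemma powCD z w l : powC z (w + l) = powC z w * powC z l.
Proof. by rewrite /powC mulrDl expCD. Qed.

Lemma powC_nat z k : z != 0 -> powC z k%:R = z ^+ k.
Proof. by move=> z0; rewrite /powC expC_nat expCK. Qed.

Lemma powCM (x : R) z w : 0 < x -> z != 0 ->
  powC (x%:C * z) w = powC x%:C w * powC z w.
Proof. by move=> x0 z0; rewrite /powC logCM // logCR // mulrDr expCD. Qed.

Lemma powCV (x : R) w : 0 < x -> powC (x^-1)%:C w = (powC x%:C w)^-1.
Proof.
move=> x0; rewrite /powC !logCR ?invr_gt0 // lnV ?posrE // rmorphN mulrN.
by rewrite expCN.
Qed.

Lemma is_derC_expC (f : R -> R[i]) (x : R) l : is_derC f x l ->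
  is_derC (fun u => expC (f u)) x (l * expC (f x)).
Proof.
move=> [f1 f2]; have E := is_derive1_comp (is_derive_expR _) f1.
have C := is_derive1_comp (is_derive_cos _) f2.
have S := is_derive1_comp (is_derive_sin _) f2.
apply: (is_derC_eq (l := (expR (complex.Re (f x)) * complex.Re l)%:C *
  (cos (complex.Im (f x)) +i* sin (complex.Im (f x))) +
  (expR (complex.Re (f x)))%:C * ((- sin (complex.Im (f x)) * complex.Im l) +i*
   (cos (complex.Im (f x)) * complex.Im l)))); last first.
  by apply: complexP; rewrite !ReImE /=; ring.
apply: is_derC_M; last by split.
exact: is_derC_real.
Qed.

Lemma is_derC_X (f : R -> R[i]) (x : R) l k : is_derC f x l ->
  is_derC (fun u => f u ^+ k) x (k%:R * f x ^+ k.-1 * l).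
Proof.
move=> fl; elim: k => [|k IH]; first by rewrite !mul0r; exact: is_derC_cst.
under eq_fun do rewrite exprS.
apply: (is_derC_eq (is_derC_M fl IH)).
case: k {IH} => [|k] /=; first by ring.
by rewrite -natr1 exprS; ring.
Qed.

Lemma is_derC_sum (I : Type) (r : seq I) (P : pred I) (f : I -> R -> R[i])
  (x : R) (l : I -> R[i]) : (forall i, P i -> is_derC (f i) x (l i)) ->
  is_derC (fun u => \sum_(i <- r | P i) f i u) x (\sum_(i <- r | P i) l i).
Proof.
move=> H; elim: r => [|i r IH].
  by under eq_fun do rewrite big_nil; rewrite big_nil; exact: is_derC_cst.
under eq_fun do rewrite big_cons; rewrite big_cons.
by case: ifP => // Pi; apply: is_derC_D => //; exact: H.
Qed.

Lemma is_derC_Z (f : R -> R[i]) (x : R) l c : is_derC f x l ->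
  is_derC (fun u => c * f u) x (c * l).
Proof.
move=> fl; apply: (is_derC_eq (is_derC_M (is_derC_cst x c) fl)).
by rewrite mul0r add0r.
Qed.

Lemma near_is_derC (f g : R -> R[i]) (x : R) l :
  (\forall u \near x, f u = g u) -> is_derC g x l -> is_derC f x l.
Proof.
move=> fg [g1 g2]; split.
- apply: near_eq_is_derive g1.
  by apply: filterS fg => u ->.
- apply: near_eq_is_derive g2.
  by apply: filterS fg => u ->.
Qed.

Let le_deriv_mono (h dh : R -> R) (a b : R) : a <= b ->
  (forall u, a <= u <= b -> is_derive u 1 h (dh u)) ->
  (forall u, a <= u <= b -> 0 <= dh u) -> h a <= h b.
Proof.
move=> ab dH dh0; have [u||c] := MVT_segment ab (f := h) (df := dh).
- by rewrite in_itv /= => /andP[/ltW ? /ltW ?]; apply: dH; apply/andP.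
- apply: derivable_within_continuous => u; rewrite in_itv /= => H.
  by have [] := dH u H.
- rewrite in_itv /= => cab E; rewrite -subr_ge0 E mulr_ge0 ?subr_ge0 //.
  exact: dh0.
Qed.

Let is_derive_pow (f : R -> R) (x df : R) k : is_derive x 1 f df ->
  is_derive x 1 (fun u => f u ^+ k) (k%:R * f x ^+ k.-1 * df).
Proof.
move=> fx; elim: k => [|k IH]; first by rewrite !mul0r; exact: is_derive_cst.
under eq_fun do rewrite exprS.
apply: (is_derive_eq (is_deriveM fx IH)); rewrite /GRing.scale /=.
case: k {IH} => [|k] /=; first by ring.
by rewrite -natr1 exprS; ring.
Qed.

Let pow_bound_right (g dg : R -> R) (a x C : R) (N : nat) : a <= x ->
  (forall u, a <= u <= x -> is_derive u 1 g (dg u)) -> g a = 0 ->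
  (forall u, a <= u <= x -> dg u <= C * `|u - a| ^+ N) ->
  g x <= C * `|x - a| ^+ N.+1 / N.+1%:R.
Proof.
move=> ax dG ga Hb.
pose q (u : R) := C / N.+1%:R * (u - a) ^+ N.+1.
have dq (u : R) : is_derive u 1 q (C * (u - a) ^+ N).
  have H1 : is_derive u 1 (fun v : R => v - a) 1.
    apply: (is_derive_eq (is_deriveB (is_derive_id u (1 : R)) (is_derive_cst a u (1 : R)))).
    by rewrite subr0.
  have H := is_deriveZ (C / N.+1%:R) (is_derive_pow N.+1 H1).
  apply: (is_derive_eq H); rewrite /GRing.scale /= mulr1.
  by field; rewrite nat1r pnatr_eq0.
have := @le_deriv_mono (fun u => q u - g u) (fun u => C * (u - a) ^+ N - dg u) a x ax.
rewrite ga subr0 /q subrr expr0n mulr0.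
rewrite subr_ge0 => H; rewrite (ger0_norm (_ : 0 <= x - a)) ?subr_ge0 //.
rewrite mulrAC; apply: H.
- by move=> u Hu; apply: is_deriveB => //; exact: dG.
- move=> u Hu; rewrite subr_ge0 -(@ger0_norm _ (u - a)) ?Hb //.
  by case/andP: Hu => ? _; rewrite subr_ge0.
Qed.

Let pow_bound_left (g dg : R -> R) (a x C : R) (N : nat) : x <= a ->
  (forall u, x <= u <= a -> is_derive u 1 g (dg u)) -> g a = 0 ->
  (forall u, x <= u <= a -> - dg u <= C * `|u - a| ^+ N) ->
  g x <= C * `|x - a| ^+ N.+1 / N.+1%:R.
Proof.
move=> xa dG ga Hb.
have := @pow_bound_right (fun u => g (- u)) (fun u => - dg (- u)) (- a) (- x) C N.
have E (u v : R) : `|- u - - v| = `|u - v| by rewrite opprK addrC distrC.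
rewrite lerN2 E !opprK => H; apply: H => //.
- move=> u Hu; rewrite -mulrN1.
  have Du : is_derive u 1 (fun v : R => - v) (-1) by exact: is_deriveNid.
  apply: (@is_derive1_comp _ g) => //; apply: dG.
  by rewrite lerNr lerNl andbC.
- move=> u Hu; rewrite -normrN opprD; apply: Hb.
  by rewrite lerNr lerNl andbC.
Qed.

(** A bound on the derivative by a power of the distance to [a] integrates;
   the factor 2 comes from treating the real and imaginary parts apart. *)
Lemma derC_pow_bound (g dg : R -> R[i]) (a x C : R) (N : nat) :
  (forall u, `|u - a| <= `|x - a| -> is_derC g u (dg u)) -> g a = 0 ->
  (forall u, `|u - a| <= `|x - a| -> absC (dg u) <= C * `|u - a| ^+ N) ->
  absC (g x) <= 2 * C * `|x - a| ^+ N.+1 / N.+1%:R.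
Proof.
move=> dG ga Hb.
have key (h dh : R -> R) : h a = 0 ->
    (forall u, `|u - a| <= `|x - a| -> is_derive u 1 h (dh u)) ->
    (forall u, `|u - a| <= `|x - a| -> `|dh u| <= C * `|u - a| ^+ N) ->
    h x <= C * `|x - a| ^+ N.+1 / N.+1%:R.
  move=> ha dH hb; have [ax|xa] := leP a x.
    have In u : a <= u <= x -> `|u - a| <= `|x - a|.
      by move=> /andP[au ux]; rewrite !ger0_norm ?subr_ge0 // lerD2r.
    apply: (@pow_bound_right h dh) => // u /In Hu; first exact: dH.
    by apply: le_trans (hb _ Hu); exact: ler_norm.
  have In u : x <= u <= a -> `|u - a| <= `|x - a|.
    move=> /andP[xu ua]; rewrite !(distrC _ a) !ger0_norm ?subr_ge0 ?(ltW xa) //.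
    by rewrite lerD2l lerN2.
  apply: (@pow_bound_left h dh) => //; first exact: ltW.
    by move=> u /In Hu; exact: dH.
  by move=> u /In Hu; apply: le_trans (hb _ Hu); rewrite -normrN ler_norm.
have key2 (h dh : R -> R) : h a = 0 ->
    (forall u, `|u - a| <= `|x - a| -> is_derive u 1 h (dh u)) ->
    (forall u, `|u - a| <= `|x - a| -> `|dh u| <= C * `|u - a| ^+ N) ->
    `|h x| <= C * `|x - a| ^+ N.+1 / N.+1%:R.
  move=> ha dH hb; rewrite ler_norml lerNl (key _ _ ha dH hb) andbT.
  apply: (key (fun u => - h u) (fun u => - dh u)).
  - by rewrite ha oppr0.
  - by move=> u Hu; apply: is_deriveN; exact: dH.
  - by move=> u Hu; rewrite normrN hb.
apply: le_trans (ler_absC _) _.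
have -> : 2 * C * `|x - a| ^+ N.+1 / N.+1%:R = C * `|x - a| ^+ N.+1 / N.+1%:R +
  C * `|x - a| ^+ N.+1 / N.+1%:R by rewrite -!mulrA mulr_natl mulr2n.
apply: lerD.
- apply: (key2 (fun u => complex.Re (g u)) (fun u => complex.Re (dg u))).
  + by rewrite ga.
  + by move=> u /dG[].
  + by move=> u /Hb; apply: le_trans; exact: ler_ReC.
- apply: (key2 (fun u => complex.Im (g u)) (fun u => complex.Im (dg u))).
  + by rewrite ga.
  + by move=> u /dG[].
  + by move=> u /Hb; apply: le_trans; exact: ler_ImC.
Qed.

End ExpLog.

(** * Real-analytic functions of one real variable *)

Section Analytic.
Context {R : realType}.
Implicit Types (f g : R -> R[i]) (c : nat -> R[i]).

Definition psum c (h : R) (N : nat) : R[i] := \sum_(m < N) c m * h%:C ^+ m.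

(** The geometric bound on the coefficients makes sums, products and derivatives
   elementary, and convergence in a neighbourhood already implies it
   ([analyticCP]). *)
Definition analytic_at f (t0 : R) : Prop :=
  exists2 r : R, 0 < r & exists c, exists2 K : R, 0 <= K & exists2 s : R, 0 < s &
    (forall m, absC (c m) <= K * s ^+ m) /\
    forall t, `|t - t0| < r -> cvgC \oo (psum c (t - t0)) (f t).

Lemma absC_term c (K s h : R) m : (forall m, absC (c m) <= K * s ^+ m) ->
  absC (c m * h%:C ^+ m) <= K * (s * `|h|) ^+ m.
Proof.
move=> Hc; rewrite absCM absCX absCR exprMn mulrA.
by rewrite ler_wpM2r // exprn_ge0.
Qed.

(** Geometric coefficients bound all tails at once, by the first omitted term. *)
Lemma psum_tail c (K s h : R) (M N : nat) : 0 <= K ->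
  (forall m, absC (c m) <= K * s ^+ m) -> 0 <= s -> s * `|h| <= 2^-1 ->
  (M <= N)%N -> absC (psum c h N - psum c h M) <= 2 * K * (s * `|h|) ^+ M.
Proof.
move=> K0 Hc s0 sh MN; have x0 : 0 <= s * `|h| by rewrite mulr_ge0.
have -> : psum c h N - psum c h M = \sum_(M <= m < N) c m * h%:C ^+ m.
  rewrite /psum -!(big_mkord xpredT (fun m => c m * h%:C ^+ m)).
  by rewrite (big_cat_nat (leq0n M) MN) //=; ring.
apply: le_trans (ler_absC_sum _ _ _) _.
apply: le_trans (ler_sum _ (fun m _ => absC_term h m Hc)) _.
have Hg k : \sum_(M <= m < M + k) K * (s * `|h|) ^+ m
    <= 2 * K * (s * `|h|) ^+ M - K * (s * `|h|) ^+ M * 2 * (s * `|h|) ^+ k.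
  elim: k => [|k IH]; first by rewrite addn0 big_geq // expr0; lra.
  rewrite addnS big_nat_recr ?leq_addr //=.
  apply: le_trans (lerD IH (lexx _)) _; rewrite exprD exprS.
  have : 0 <= K * (s * `|h|) ^+ M * (s * `|h|) ^+ k.
    by rewrite !mulr_ge0 ?exprn_ge0.
  set a := (s * `|h|) ^+ M; set b := _ ^+ k; move: (s * `|h|) sh x0 => x sh x0 H.
  have : 0 <= K * a * b * (1 - 2 * x) by rewrite mulr_ge0 // subr_ge0; lra.
  nra.
apply: le_trans (_ : _ <= 2 * K * (s * `|h|) ^+ M - K * (s * `|h|) ^+ M * 2 * (s * `|h|) ^+ (N - M)) _.
  by rewrite -{1}(subnKC MN); exact: Hg.
by rewrite gerBl !mulr_ge0 // exprn_ge0.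
Qed.

Lemma cvgC_absC_le (F : nat -> R[i]) l m (B : R) : cvgC \oo F l ->
  (\forall N \near \oo, absC (F N - m) <= B) -> absC (l - m) <= B.
Proof.
move=> Fl H; have /cvgC_abs C : cvgC \oo (fun N => F N - m) (l - m).
  by apply: cvgC_B => //; exact: cvgC_cst.
rewrite -(cvg_lim _ C) //; apply: limr_le; first by apply/cvg_ex; eexists; exact: C.
exact: H.
Qed.

Lemma analytic_tail (M : nat) f (t0 K s : R) c t : 0 <= K ->
  (forall m, absC (c m) <= K * s ^+ m) -> 0 <= s -> s * `|t - t0| <= 2^-1 ->
  cvgC \oo (psum c (t - t0)) (f t) ->
  absC (f t - psum c (t - t0) M) <= 2 * K * (s * `|t - t0|) ^+ M.
Proof.
move=> K0 Hc s0 sh Cf; apply: (cvgC_absC_le Cf).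
by exists M => // N /= MN; apply: psum_tail.
Qed.

Lemma psum0 c N : psum c 0 N.+1 = c 0%N.
Proof.
rewrite /psum big_ord_recl expr0 mulr1 big1 ?addr0 // => i _.
by rewrite /bump /= exprS mul0r mulr0.
Qed.

Lemma analytic_val f (t0 r : R) c : 0 < r ->
  (forall t, `|t - t0| < r -> cvgC \oo (psum c (t - t0)) (f t)) -> f t0 = c 0%N.
Proof.
move=> r0 Hf; have := Hf t0; rewrite subrr normr0 => /(_ r0) H.
apply: (cvgC_unique H); apply: near_cvgC (cvgC_cst (c 0%N)).
by exists 1%N => // -[|N] //= _; rewrite psum0.
Qed.

(** Convergence of the series at one point [h] of the disc bounds its terms
   there, so the coefficients grow at most like [h ^- m]. *)
Lemma analyticCP (D : set R) f :
  analyticC D f <-> forall t, D t -> analytic_at f t.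
Proof.
split=> [H t0 /H[r r0 [c Hc]]|H t0 /H[r r0 [c [K K0 [s s0 [Kc Hc]]]]]]; last first.
  by exists r => //; exists c.
exists r => //; exists c.
have r2 : 0 < r / 2 by rewrite divr_gt0.
have := Hc (t0 + r / 2); rewrite addrC addKr ger0_norm ?ltW // ltr_pdivrMr //.
rewrite ltr_pMr // ltr1n => /(_ isT) [H1 H2].
have bd (h : R[i] -> R) : (forall z w, h (z + w) = h z + h w) ->
   (h (psum c (r / 2) N) @[N --> \oo] --> h (f (t0 + r / 2))) ->
   exists2 K : R, 0 <= K & forall m, `|h (c m * (r / 2)%:C ^+ m)| <= K.
  move=> hD Hh; have : cvgn (series (fun m => h (c m * (r / 2)%:C ^+ m))).
    apply/cvg_ex; exists (h (f (t0 + r / 2))).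
    have E : series (fun m => h (c m * (r / 2)%:C ^+ m)) = fun N => h (psum c (r / 2) N).
      apply/funext => N; rewrite seriesEord /psum /=.
      have h0 : h 0 = 0 by apply: (addrI (h 0)); rewrite -hD !addr0.
      elim: N => [|N IH]; first by rewrite /= !big_ord0 h0.
      by rewrite !big_ord_recr /= hD IH.
    by rewrite E.
  move=> /cvg_series_bounded[K [Kr KH]]; exists (`|K| + 1); first by rewrite addr_ge0.
  move=> m; apply: (KH (`|K| + 1)) => //.
  by rewrite (le_lt_trans (ler_norm K)) // ltrDl.
have [K1 K10 HK1] := bd _ (@ReD _) H1.
have [K2 K20 HK2] := bd _ (@ImD _) H2.
exists (K1 + K2); first exact: addr_ge0.
exists (r / 2)^-1; first by rewrite invr_gt0.
split=> // m; rewrite exprVn ler_pdivlMr ?exprn_gt0 //.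
have -> : absC (c m) * (r / 2) ^+ m = absC (c m * (r / 2)%:C ^+ m).
  by rewrite absCM absCX absCR ger0_norm // ltW.
by apply: le_trans (ler_absC _) _; apply: lerD.
Qed.

Lemma le_geom (K s s' : R) m : 0 <= K -> 0 < s -> s <= s' ->
  K * s ^+ m <= K * s' ^+ m.
Proof.
move=> K0 s0 ss; rewrite ler_wpM2l // lerXn2r ?nnegrE ?(ltW s0) //.
exact: le_trans (ltW s0) ss.
Qed.

Lemma analytic_cst l (t0 : R) : analytic_at (fun=> l) t0.
Proof.
exists 1 => //; exists (fun m => if m is 0%N then l else 0).
exists (absC l) => //; exists 1 => //; split.
  by case=> [|m] /=; rewrite ?expr1n mulr1 ?absC0.
move=> t _; apply: near_cvgC (cvgC_cst l); exists 1%N => // -[|N] //= _.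
rewrite /psum big_ord_recl expr0 mulr1 big1 ?addr0 // => i _.
by rewrite /bump /= mul0r.
Qed.

Lemma analytic_D f g (t0 : R) : analytic_at f t0 -> analytic_at g t0 ->
  analytic_at (fun t => f t + g t) t0.
Proof.
move=> [r1 r10 [c [K1 K10 [s1 s10 [Hc Cf]]]]] [r2 r20 [d [K2 K20 [s2 s20 [Hd Cg]]]]].
exists (Num.min r1 r2); first by rewrite lt_min r10.
exists (fun m => c m + d m); exists (K1 + K2); first exact: addr_ge0.
exists (Num.max s1 s2); first by rewrite lt_max s10.
split=> [m|t]; last first.
  rewrite lt_min => /andP[h1 h2].
  apply: near_cvgC (cvgC_D (Cf _ h1) (Cg _ h2)); apply: nearW => N.
  by rewrite /psum -big_split /=; apply: eq_bigr => i _; rewrite mulrDl.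
apply: le_trans (ler_absCD _ _) _; rewrite mulrDl; apply: lerD.
  by apply: le_trans (Hc m) _; apply: le_geom; rewrite // le_max lexx.
by apply: le_trans (Hd m) _; apply: le_geom; rewrite // le_max lexx orbT.
Qed.

Lemma leq_pow2 N : (N <= 2 ^ N)%N. Proof. exact/ltnW/ltn_expl. Qed.

(** The Cauchy product: the product of the N-th partial sums is a polynomial in
   [h] whose first N coefficients are those of the product series, and whose
   remaining coefficients contribute geometrically little. *)
Lemma analytic_M f g (t0 : R) : analytic_at f t0 -> analytic_at g t0 ->
  analytic_at (fun t => f t * g t) t0.
Proof.
move=> [r1 r10 [c [K1 K10 [s1 s10 [Hc Cf]]]]] [r2 r20 [d [K2 K20 [s2 s20 [Hd Cg]]]]].
pose s := Num.max s1 s2.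
have s0 : 0 < s by rewrite lt_max s10.
have {}Hc m : absC (c m) <= K1 * s ^+ m.
  by apply: le_trans (Hc m) _; apply: le_geom; rewrite // le_max lexx.
have {}Hd m : absC (d m) <= K2 * s ^+ m.
  by apply: le_trans (Hd m) _; apply: le_geom; rewrite // le_max lexx orbT.
have bdM m (c' d' : nat -> R[i]) : (forall i, absC (c' i) <= K1 * s ^+ i) ->
    (forall i, absC (d' i) <= K2 * s ^+ i) ->
    absC (\sum_(i < m.+1) c' i * d' (m - i)%N) <= K1 * K2 * (2 * s) ^+ m.
  move=> Hc' Hd'; apply: le_trans (ler_absC_sum _ _ _) _.
  apply: (@le_trans _ _ (\sum_(i < m.+1) K1 * K2 * s ^+ m)).
    apply: ler_sum => i _; rewrite absCM.
    apply: le_trans (ler_pM _ _ (Hc' i) (Hd' (m - i)%N)) _ => //.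
    by rewrite mulrACA -exprD subnKC // -ltnS.
  rewrite sumr_const card_ord.
  have -> : (K1 * K2 * s ^+ m) *+ m.+1 = K1 * K2 * (m.+1%:R * s ^+ m).
    by rewrite -mulr_natl mulrCA.
  rewrite exprMn ler_wpM2l ?mulr_ge0 //.
  by rewrite ler_wpM2r ?exprn_ge0 ?(ltW s0) // -natrX ler_nat ltn_expl.
pose e m := \sum_(i < m.+1) c i * d (m - i)%N.
pose r := Num.min (Num.min r1 r2) (8 * s)^-1.
have r0 : 0 < r by rewrite !lt_min r10 r20 invr_gt0 mulr_gt0.
exists r => //; exists e; exists (K1 * K2); first exact: mulr_ge0.
exists (2 * s); first by rewrite mulr_gt0.
split=> [m|t]; first exact: bdM.
rewrite !lt_min -andbA => /and3P[h1 h2 h3].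
set h := t - t0; set x := 2 * s * `|h|.
have x0 : 0 <= x by rewrite !mulr_ge0 // ltW.
have x4 : x <= 4^-1.
  have : `|h| * (8 * s) <= 1 by rewrite -ler_pdivlMr ?mulr_gt0 // div1r ltW.
  rewrite /x; lra.
have Hlim := cvgC_M (Cf _ h1) (Cg _ h2).
have Hdiff N : absC (psum c h N * psum d h N - psum e h N) <= K1 * K2 * 2^-1 ^+ N.
  pose p := \poly_(i < N) c i; pose q := \poly_(i < N) d i.
  have hor (b : nat -> R[i]) : psum b h N = (\poly_(i < N) b i).[h%:C].
    by rewrite horner_poly.
  have Hp i : absC p`_i <= K1 * s ^+ i.
    by rewrite coef_poly; case: ifP => _ //; rewrite absC0 mulr_ge0 ?exprn_ge0 // ltW.
  have Hq i : absC q`_i <= K2 * s ^+ i.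
    by rewrite coef_poly; case: ifP => _ //; rewrite absC0 mulr_ge0 ?exprn_ge0 // ltW.
  rewrite (hor c) (hor d) -hornerM.
  have Hs : (size (p * q)%R <= N + N)%N.
    apply: leq_trans (size_polyMleq _ _) _.
    by apply: leq_trans (leq_pred _) _; apply: leq_add; exact: size_poly.
  rewrite (horner_coef_wide _ Hs) /psum -!(big_mkord xpredT (fun m => _ m * h%:C ^+ m)).
  rewrite (big_cat_nat (leq0n N) (leq_addr N N)) //=.
  have -> : \sum_(0 <= i < N) (p * q)%R`_i * h%:C ^+ i = \sum_(0 <= i < N) e i * h%:C ^+ i.
    apply: eq_big_nat => i /andP[_ iN]; congr (_ * _); rewrite coefM.
    apply: eq_bigr => j _; rewrite !coef_poly.
    have jN : (j < N)%N by apply: leq_ltn_trans iN; rewrite -ltnS.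
    by rewrite jN (leq_ltn_trans (leq_subr _ _) iN).
  rewrite addrAC subrr add0r; apply: le_trans (ler_absC_sum _ _ _) _.
  apply: (@le_trans _ _ (\sum_(N <= i < N + N) K1 * K2 * 4^-1 ^+ N)).
    apply: ler_sum_nat => i /andP[Ni _]; rewrite absCM absCX absCR coefM.
    apply: le_trans (ler_wpM2r _ (bdM i _ _ Hp Hq)) _; first exact: exprn_ge0.
    have -> : K1 * K2 * (2 * s) ^+ i * `|h| ^+ i = K1 * K2 * x ^+ i.
      by rewrite /x [(2 * s * _) ^+ _]exprMn mulrA.
    rewrite ler_wpM2l ?mulr_ge0 //.
    apply: (@le_trans _ _ (x ^+ N)); last by rewrite lerXn2r ?nnegrE.
    by rewrite ler_wiXn2l //; apply: le_trans x4 _; rewrite invf_le1 // ler1n.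
  rewrite sumr_const_nat addnK.
  have -> : (K1 * K2 * 4^-1 ^+ N) *+ N = K1 * K2 * (4^-1 ^+ N * N%:R).
    by rewrite -mulr_natr mulrA.
  rewrite ler_wpM2l ?mulr_ge0 //.
  have -> : (4^-1 : R) = 2^-1 * 2^-1 by field.
  rewrite exprMn -mulrA ler_piMr ?exprn_ge0 // exprVn mulrC.
  by rewrite ler_pdivrMr ?exprn_gt0 // mul1r -natrX ler_nat leq_pow2.
have H0 : cvgC \oo (fun N => psum c h N * psum d h N - psum e h N) 0.
  apply/cvgC_absP; apply: (@near_le_cvg0 _ _ _ _ _ (fun N => K1 * K2 * 2^-1 ^+ N)).
    by apply: nearW => N; rewrite subr0 ger0_norm.
  rewrite -(mulr0 (K1 * K2)); apply: cvgM; first exact: cvg_cst.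
  by apply: cvg_expr; rewrite ger0_norm ?invr_ge0 // invf_lt1 // ltr1n.
rewrite -[f t * g t]subr0; apply: near_cvgC (cvgC_B (Hlim _) H0).
by apply: nearW => N; rewrite /= subKr.
Qed.

(** A quadratic remainder is more than enough for differentiability. *)
Lemma is_derC_quad f (t0 r C : R) l : 0 < r ->
  (forall t, `|t - t0| < r -> absC (f t - f t0 - l * (t - t0)%:C) <= C * `|t - t0| ^+ 2) ->
  is_derC f t0 l.
Proof.
move=> r0 H.
have key (p : R[i] -> R) : (forall z w, p (z + w) = p z + p w) ->
   (forall z, p (- z) = - p z) -> (forall z (x : R), p (z * x%:C) = p z * x) ->
   (forall z, `|p z| <= absC z) -> is_derive t0 1 (fun u => p (f u)) (p l).
  move=> pD pN pM ple.
  have Hc : h^-1 *: (p (f (h *: (1 : R) + t0)) - p (f t0)) @[h --> 0^'] --> p l.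
    apply/subr_cvg0; apply: (@near_le_cvg0 _ _ _ _ _ (fun h => C * `|h|)); last first.
      rewrite -[X in _ --> X](mulr0 C); apply: cvgM; first exact: cvg_cst.
      rewrite -[X in _ --> X](normr0 R); apply: cvg_norm; exact: cvg_within.
    near=> h; have h0 : h != 0 by near: h; exact: nbhs_dnbhs_neq.
    have hr : `|h| < r.
      by near: h; apply: dnbhs0_lt.
    rewrite /GRing.scale /= mulr1.
    have := H (h + t0); rewrite addrK => /(_ hr).
    set z := f _ - _ - _; move=> Hz.
    have -> : h^-1 * (p (f (h + t0)) - p (f t0)) - p l = h^-1 * p z.
      by rewrite /z !pD !pN pM; field.
    rewrite normrM normfV ler_pdivrMl ?normr_gt0 // mulrCA -expr2.
    exact: le_trans (ple _) Hz.
  by apply: DeriveDef; [apply/cvg_ex; exists (p l)|exact: cvg_lim].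
split; apply: key => *; rewrite ?ReImE /= ?mulr0 ?mul0r ?addr0 ?subr0 ?add0r //.
- exact: ler_ReC.
- exact: ler_ImC.
Unshelve. all: by end_near. Qed.

(** The tail bound of order two is a quadratic remainder. *)
Lemma analytic_is_derC f (t0 : R) : analytic_at f t0 -> exists l, is_derC f t0 l.
Proof.
move=> [r r0 [c [K K0 [s s0 [Hc Cf]]]]]; exists (c 1%N).
pose r' := Num.min r (2 * s)^-1.
apply: (@is_derC_quad _ _ r' (2 * K * s ^+ 2)).
  by rewrite lt_min r0 invr_gt0 mulr_gt0.
move=> t; rewrite lt_min => /andP[h1 h2].
have sh : s * `|t - t0| <= 2^-1.
  have : `|t - t0| * (2 * s) <= 1 by rewrite -ler_pdivlMr ?mulr_gt0 // div1r ltW.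
  lra.
have := analytic_tail 2 K0 Hc (ltW s0) sh (Cf _ h1).
rewrite (analytic_val r0 Cf) exprMn mulrA.
by rewrite /psum 2!big_ord_recr big_ord0 /= add0r expr0 mulr1 expr1 opprD addrA.
Qed.

(** The first non-zero coefficient would dominate all later terms close to [t0],
   where the function is assumed to vanish. *)
Lemma analytic_coef0 f (t0 e r K s : R) c : 0 < e -> 0 < r -> 0 <= K -> 0 < s ->
  (forall m, absC (c m) <= K * s ^+ m) ->
  (forall t, `|t - t0| < r -> cvgC \oo (psum c (t - t0)) (f t)) ->
  (forall t, t0 < t < t0 + e -> f t = 0) -> forall m, c m = 0.
Proof.
move=> e0 r0 K0 s0 Hc Cf f0; elim/ltn_ind => m IH.
apply/eqP; rewrite -absC_eq0; apply/negPn/negP => cm0.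
have {}cm0 : 0 < absC (c m) by rewrite lt_def cm0 absC_ge0.
pose B := 2 * K * s ^+ m.+1 + 1.
have B0 : 0 < B by rewrite ltr_wpDl // !mulr_ge0 ?exprn_ge0 // ltW.
pose d := Num.min (Num.min (Num.min e r) (2 * s)^-1) (absC (c m) / B).
have d0 : 0 < d by rewrite !lt_min e0 r0 invr_gt0 divr_gt0 // mulr_gt0.
pose h := d / 2; have h0 : 0 < h by rewrite divr_gt0.
have hd : h < d by rewrite /h ltr_pdivrMr // ltr_pMr // ltr1n.
have hd' : h < Num.min (Num.min (Num.min e r) (2 * s)^-1) (absC (c m) / B) := hd.
move: hd'; rewrite !lt_min => /andP[/andP[/andP[he hr] hs] hB].
have E : t0 + h - t0 = h by rewrite addrC addKr.
have nh : `|t0 + h - t0| = h by rewrite E ger0_norm // ltW.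
have sh : s * `|t0 + h - t0| <= 2^-1.
  rewrite nh; have : h * (2 * s) <= 1 by rewrite -ler_pdivlMr ?mulr_gt0 // div1r ltW.
  lra.
have := @analytic_tail m.+1 f t0 K s c (t0 + h) K0 Hc (ltW s0) sh.
rewrite nh; have /[swap]/[apply] : cvgC \oo (psum c (t0 + h - t0)) (f (t0 + h)).
  by apply: Cf; rewrite nh.
rewrite f0 ?ltrDl ?ltrD2l ?h0 // sub0r absCN E /psum big_ord_recr /= big1 ?add0r; last first.
  by move=> i _; rewrite IH ?mul0r.
have -> : 2 * K * (s * h) ^+ m.+1 = 2 * K * s ^+ m.+1 * h * h ^+ m.
  by rewrite exprMn (exprS h); ring.
rewrite absCM absCX absCR gtr0_norm // ler_pM2r ?exprn_gt0 // leNgt => /negP; apply.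
move: hB; rewrite ltr_pdivlMr //; apply: le_lt_trans.
by rewrite mulrC ler_pM2l // /B lerDl.
Qed.

(** Identity theorem on the half-line: to the left of the infimum of the points
   from which [f] vanishes up to 0, the power series there is zero as well. *)
Lemma analytic_identity f (e : R) : 0 < e ->
  (forall t, t < 0 -> analytic_at f t) ->
  (forall t, - e < t < 0 -> f t = 0) -> forall t, t < 0 -> f t = 0.
Proof.
move=> e0 an f0 t1 t10; apply/eqP/negPn/negP => /eqP ft1.
pose S := [set s : R | s < 0 /\ forall u, s < u < 0 -> f u = 0].
have Sne : S (- e) by split => //; rewrite oppr_lt0.
have lbS : lbound S t1.
  move=> s [s0 Hs]; rewrite leNgt; apply/negP => st; apply: ft1.
  by apply: Hs; rewrite st.
have hS : has_inf S by split; [exists (- e)|exists t1].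
have ise : inf S <= - e by apply: ge_inf => //; exists t1.
have is0 : inf S < 0 by rewrite (le_lt_trans ise) // oppr_lt0.
have fS u : inf S < u < 0 -> f u = 0.
  move=> /andP[su u0]; have [s [_ Hs] su'] := inf_lt (proj1 hS) su.
  by apply: Hs; rewrite su'.
have [r r0 [c [K K0 [s s0 [Hc Cf]]]]] := an _ is0.
have c0 := @analytic_coef0 f (inf S) (- inf S) r K s c _ r0 K0 s0 Hc Cf.
rewrite subrr oppr_gt0 in c0; have {}c0 := c0 is0 fS.
have fz t : `|t - inf S| < r -> f t = 0.
  move=> /Cf H; apply: (cvgC_unique H); apply: near_cvgC (cvgC_cst 0).
  by apply: nearW => N; rewrite /psum big1 // => i _; rewrite c0 mul0r.
have : S (inf S - r / 2).
  have r2 : r / 2 < r by rewrite ltr_pdivrMr // ltr_pMr // ltr1n.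
  have r20 : 0 < r / 2 by rewrite divr_gt0.
  split=> [|u /andP[h1 h2]]; first by rewrite ltr_wnDr // oppr_le0 ltW.
  have [us|su] := leP u (inf S); last by apply: fS; rewrite su.
  apply: fz; rewrite ler0_norm ?subr_le0 // opprB.
  by apply: lt_trans r2; rewrite ltrBlDl -ltrBlDr.
move=> /(ge_inf (proj2 hS)); rewrite lerBrDl gerDr leNgt => /negP; apply.
by rewrite divr_gt0.
Qed.

(** Taylor's theorem by induction on the order: the remainder of order [N + 1] of
   [v m] has the remainder of order [N] of [v m.+1] as its derivative.  The factor
   [2 ^ N] is lost to the separate treatment of real and imaginary parts. *)
Lemma taylor_bound (v : nat -> R -> R[i]) (t0 r K s : R) : 0 <= K -> 0 <= s ->
  (forall m u, `|u - t0| <= r -> is_derC (v m) u (v m.+1 u)) ->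
  (forall m u, `|u - t0| <= r -> absC (v m u) <= K * m`!%:R * s ^+ m) ->
  forall N m t, `|t - t0| <= r ->
  absC (v m t - \sum_(i < N) v (m + i)%N t0 / i`!%:R * (t - t0)%:C ^+ i)
   <= 2 ^+ N * K * (m + N)`!%:R * s ^+ (m + N) * `|t - t0| ^+ N / N`!%:R.
Proof.
move=> K0 s0 dv bv; elim=> [|N IH] m t Ht.
  by rewrite big_ord0 subr0 addn0 !expr0 fact0 mul1r mulr1 divr1 bv.
pose P k M (u : R) := \sum_(i < M) v (k + i)%N t0 / i`!%:R * (u - t0)%:C ^+ i.
have dP (u : R) : is_derC (P m N.+1) u (P m.+1 N u).
  have -> : P m N.+1 = (fun u => v m t0 + \sum_(i < N)
      (v (m.+1 + i)%N t0 / i.+1`!%:R) * (u - t0)%:C ^+ i.+1).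
    apply/funext => w; rewrite /P big_ord_recl expr0 mulr1 addn0 fact0 divr1.
    by congr (_ + _); apply: eq_bigr => i _; rewrite /bump /= addSnnS.
  rewrite -[P m.+1 N u]add0r; apply: is_derC_D; first exact: is_derC_cst.
  apply: is_derC_sum => i _; have Du : is_derC (fun w : R => (w - t0)%:C) u 1.
    apply: (is_derC_eq (l := 1 - 0)); last by rewrite subr0.
    under eq_fun do rewrite rmorphB /=.
    by apply: is_derC_B; [exact: is_derC_id|exact: is_derC_cst].
  apply: (is_derC_eq (is_derC_Z _ (is_derC_X i.+1 Du))).
  rewrite mulr1 /= factS natrM mulrA; congr (_ * _).
  field.
  by rewrite nat1r !pnatr_eq0 -lt0n fact_gt0.
have := @derC_pow_bound R (fun u => v m u - P m N.+1 u)
  (fun u => v m.+1 u - P m.+1 N u) t0 t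
  (2 ^+ N * K * (m.+1 + N)`!%:R * s ^+ (m.+1 + N) / N`!%:R) N.
move=> H; apply: le_trans (H _ _ _) _.
- move=> u Hu; apply: is_derC_B => //; apply: dv; exact: le_trans Ht.
- rewrite /P big_ord_recl expr0 mulr1 addn0 fact0 divr1 big1 ?addr0 ?subrr // => i _.
  by rewrite lift0 exprS mul0r mulr0.
- move=> u Hu; have := IH m.+1 u (le_trans Hu Ht).
  by rewrite [X in _ <= X -> _]mulrAC.
rewrite addSnnS le_eqVlt; apply/orP; left; apply/eqP.
rewrite factS natrM (exprS 2 N); field.
by rewrite nat1r !pnatr_eq0 -lt0n fact_gt0.
Qed.

(** Factorial bounds on the derivatives make the Taylor series converge to the
   function; solutions of linear differential equations are analytic this way. *)
Lemma analytic_of_deriv_bounds (v : nat -> R -> R[i]) (t0 r K s : R) :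
  0 < r -> 0 <= K -> 0 < s ->
  (forall m u, `|u - t0| <= r -> is_derC (v m) u (v m.+1 u)) ->
  (forall m u, `|u - t0| <= r -> absC (v m u) <= K * m`!%:R * s ^+ m) ->
  analytic_at (v 0%N) t0.
Proof.
move=> r0 K0 s0 dv bv.
exists (Num.min r (4 * s)^-1); first by rewrite lt_min r0 invr_gt0 mulr_gt0.
exists (fun m => v m t0 / m`!%:R); exists K => //; exists s => //; split=> [m|t].
  rewrite absCM absCV absC_nat ler_pdivrMr ?ltr0n ?fact_gt0 // mulrAC.
  by apply: bv; rewrite subrr normr0 ltW.
rewrite lt_min => /andP[h1 h2]; apply/cvgC_absP.
apply: (@near_le_cvg0 _ _ _ _ _ (fun N => K * 2^-1 ^+ N)); last first.
  rewrite -(mulr0 K); apply: cvgM; first exact: cvg_cst.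
  by apply: cvg_expr; rewrite ger0_norm ?invr_ge0 // invf_lt1 // ltr1n.
apply: nearW => N; rewrite ger0_norm // -absCN opprB.
apply: le_trans (taylor_bound K0 (ltW s0) dv bv N 0 (ltW h1)) _.
rewrite add0n.
have -> : 2 ^+ N * K * N`!%:R * s ^+ N * `|t - t0| ^+ N / N`!%:R =
   K * (2 * (s * `|t - t0|)) ^+ N.
  by rewrite !exprMn; field; rewrite pnatr_eq0 -lt0n fact_gt0.
rewrite ler_wpM2l // lerXn2r ?nnegrE ?mulr_ge0 ?invr_ge0 ?(ltW s0) //.
have : `|t - t0| * (4 * s) <= 1 by rewrite -ler_pdivlMr ?mulr_gt0 // div1r ltW.
lra.
Qed.

End Analytic.

(** * Integrals of complex-valued functions *)

Section ComplexIntegral.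
Context {R : realType}.
Notation mu := (@lebesgue_measure R).
Notation meas D := (@measurable _ (measurableTypeR R) D).
Implicit Types (D : set R) (f g : R -> R[i]).

Definition integrableC D f : Prop :=
  mu.-integrable D (fun x => (complex.Re (f x))%:E) /\
  mu.-integrable D (fun x => (complex.Im (f x))%:E).

Definition continuousC_on D f : Prop := forall x, D x -> cvgC (nbhs x) f (f x).

Lemma intC_D D f g : meas D -> integrableC D f -> integrableC D g ->
  intC D (fun x => f x + g x) = intC D f + intC D g.
Proof.
move=> mD [f1 f2] [g1 g2]; apply: complexP; rewrite ?ReImE /=.
- by under eq_Rintegral do rewrite ReD; rewrite RintegralD.
- by under eq_Rintegral do rewrite ImD; rewrite RintegralD.
Qed.

Lemma intC_Z D f (c : R[i]) : meas D -> integrableC D f ->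
  intC D (fun x => c * f x) = c * intC D f.
Proof.
move=> mD [f1 f2]; have Z (a : R) (h : R -> R) :
    mu.-integrable D (fun x => (h x)%:E) -> mu.-integrable D (EFin \o (fun x => a * h x)).
  by move=> hi; exact: (integrableZl mD a hi).
apply: complexP; rewrite ?ReImE /=.
- by under eq_Rintegral do rewrite ReM; rewrite RintegralB ?RintegralZl //; exact: Z.
- by under eq_Rintegral do rewrite ImM; rewrite RintegralD ?RintegralZl //; exact: Z.
Qed.

Lemma eq_intC D f g : (forall x, D x -> f x = g x) -> intC D f = intC D g.
Proof.
move=> fg; rewrite /intC; congr (_ +i* _); apply: eq_Rintegral => x;
  by rewrite inE => /fg ->.
Qed.

Lemma absC_intC_le D f (g : R -> R) : meas D -> integrableC D f ->
  mu.-integrable D (EFin \o g) -> (forall x, D x -> absC (f x) <= g x) ->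
  absC (intC D f) <= 2 * \int[mu]_(x in D) g x.
Proof.
move=> mD [f1 f2] gi fg; apply: le_trans (ler_absC _) _; rewrite /intC /=.
have -> : 2 * \int[mu]_(x in D) g x = \int[mu]_(x in D) g x + \int[mu]_(x in D) g x.
  by rewrite mulr_natl mulr2n.
apply: lerD; [apply: (le_trans (le_normr_Rintegral mD f1))|
  apply: (le_trans (le_normr_Rintegral mD f2))]; apply: le_Rintegral => //.
- exact: integrable_norm.
- by move=> x Dx; apply: le_trans (fg _ Dx); exact: ler_ReC.
- exact: integrable_norm.
- by move=> x Dx; apply: le_trans (fg _ Dx); exact: ler_ImC.
Qed.

Lemma measurable_of_continuous D (f : R -> R) : meas D -> open D ->
  (forall x, D x -> f @ x --> f x) -> measurable_fun D f.
Proof.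
move=> mD oD cf; apply: open_continuous_measurable_fun => //.
by move=> x; rewrite inE => /cf.
Qed.

Lemma integrableC_bound D f (g : R -> R) : meas D -> open D ->
  continuousC_on D f -> mu.-integrable D (EFin \o g) ->
  (forall x, D x -> absC (f x) <= g x) -> integrableC D f.
Proof.
move=> mD oD cf gi fg.
split; apply: le_integrable gi => //.
- by apply/measurable_EFinP; apply: measurable_of_continuous => // x /cf[].
- move=> x Dx; rewrite lee_fin; apply: le_trans (ler_ReC _) _.
  by apply: le_trans (fg _ Dx) _; exact: ler_norm.
- by apply/measurable_EFinP; apply: measurable_of_continuous => // x /cf[].
- move=> x Dx; rewrite lee_fin; apply: le_trans (ler_ImC _) _.
  by apply: le_trans (fg _ Dx) _; exact: ler_norm.
Qed.

Let FTC_seq_real D (F dF : R -> R) (u v : nat -> R) (A B : R) :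
  meas D -> (forall k, u k < v k) ->
  (forall k x, u k <= x <= v k -> D x) ->
  (forall x, D x -> \forall k \near \oo, u k <= x <= v k) ->
  (forall x, D x -> is_derive x 1 F (dF x)) ->
  (forall x, D x -> dF @ x --> dF x) ->
  mu.-integrable D (fun x => (dF x)%:E) ->
  F (u k) @[k --> \oo] --> A -> F (v k) @[k --> \oo] --> B ->
  \int[mu]_(x in D) dF x = B - A.
Proof.
move=> mD uv subD exh dFP cdF idF FA FB.
have I k : \int[mu]_(x in `[u k, v k]) dF x = F (v k) - F (u k).
  have H := @continuous_FTC2 R dF F (u k) (v k) (uv k).
  rewrite /Rintegral H //.
  - apply/continuous_in_subspaceT => x; rewrite inE /= in_itv /= => /subD Dx.
    exact: cdF.
  - have cF x : D x -> F @ x --> F x.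
      move=> Dx; apply: differentiable_continuous; apply/derivable1_diffP.
      by have [] := dFP x Dx.
    split.
    + move=> x; rewrite in_itv /= => /andP[h1 h2].
      by have [] := dFP x (subD k x _); rewrite ?ltW.
    + by apply: cvg_at_right_filter; apply: cF; apply: (subD k); rewrite lexx ltW.
    + by apply: cvg_at_left_filter; apply: cF; apply: (subD k); rewrite lexx ltW.
  - move=> x; rewrite in_itv /= => /andP[h1 h2] /=; rewrite derive1E.
    by have [] := dFP x (subD k x _); rewrite ?ltW.
pose fk k := dF \_ `[u k, v k].
have DI k : D `&` [set` `[u k, v k]] = [set` `[u k, v k]].
  by apply/setIidr => x /=; rewrite in_itv /=; exact: subD.
have mdF : measurable_fun D (EFin \o dF) by exact: (measurable_int mu).
have mfk k : measurable_fun D (EFin \o fk k).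
  have := integrableS mD (measurable_itv `[u k, v k] : meas _) _ idF.
  rewrite /fk => H; have {}H : mu.-integrable `[u k, v k] (EFin \o dF).
    by apply: H => x /=; rewrite in_itv /=; exact: subD.
  apply: (measurable_int mu).
  rewrite -restrict_EFin; apply/integrable_restrict => //.
  by rewrite DI.
have [|||_ _ Hl] := @dominated_convergence _ _ R mu D mD (fun k => EFin \o fk k)
  (EFin \o dF) (EFin \o (fun x => `|dF x|)) mfk mdF.
- apply: aeW => x Dx; apply: cvg_near_cst.
  apply: filterS (exh x Dx) => k Hk.
  by rewrite /fk /= patchE mem_set //= in_itv.
- exact: integrable_norm.
- apply: aeW => x k Dx /=; rewrite lee_fin /fk patchE; case: ifP => // _.
  by rewrite normr0.
have {Hl} Hl : \int[mu]_(x in D) fk k x @[k --> \oo] --> \int[mu]_(x in D) dF x.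
  have fin : (\int[mu]_(x in D) (EFin \o dF) x)%E \is a fin_num by exact: integrable_fin_num.
  by move: Hl; rewrite -(fineK fin) => /fine_cvg.
have E k : \int[mu]_(x in D) fk k x = F (v k) - F (u k).
  by rewrite /fk -Rintegral_mkcondr DI I.
move: Hl; under eq_fun do rewrite E.
by move=> Hl; apply: (cvg_unique _ Hl (cvgB FB FA)).
Qed.

(** The fundamental theorem on the compact intervals [u k, v k] passes to the limit
   by dominated convergence of the truncated integrands. *)
Lemma FTC_seq D (F dF : R -> R[i]) (u v : nat -> R) (A B : R[i]) :
  meas D -> (forall k, u k < v k) ->
  (forall k x, u k <= x <= v k -> D x) ->
  (forall x, D x -> \forall k \near \oo, u k <= x <= v k) ->
  (forall x, D x -> is_derC F x (dF x)) ->
  continuousC_on D dF -> integrableC D dF ->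
  cvgC \oo (fun k => F (u k)) A -> cvgC \oo (fun k => F (v k)) B ->
  intC D dF = B - A.
Proof.
move=> mD uv subD exh dFP cdF [i1 i2] [A1 A2] [B1 B2].
apply: complexP; rewrite ?ReImE /=.
- by apply: (@FTC_seq_real D (fun x => complex.Re (F x)) _ u v) => // x Dx;
    [have [] := dFP x Dx|have [] := cdF x Dx].
- by apply: (@FTC_seq_real D (fun x => complex.Im (F x)) _ u v) => // x Dx;
    [have [] := dFP x Dx|have [] := cdF x Dx].
Qed.

End ComplexIntegral.

(** * The fundamental theorem of calculus on open intervals *)

Section OpenFTC.
Context {R : realType}.
Notation mu := (@lebesgue_measure R).
Notation meas D := (@measurable _ (measurableTypeR R) D).

Lemma cvgC_comp (T U : Type) (F : set_system T) (G : set_system U)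
    (f : U -> R[i]) (h : T -> U) l :
  h x @[x --> F] --> G -> cvgC G f l -> cvgC F (fun x => f (h x)) l.
Proof. by move=> hG [f1 f2]; split; [apply: cvg_comp f1|apply: cvg_comp f2]. Qed.

Let harm_to0 (e : R) : e / k.+3%:R @[k --> \oo] --> (0 : R).
Proof.
rewrite -[X in _ --> X](mulr0 e); apply: cvgM; first exact: cvg_cst.
have /(_ R) H := @cvg_harmonic.
have := H; rewrite -(cvg_shiftn 2) /harmonic /=.
by under eq_fun do rewrite addn2.
Qed.

Let at_right_seq (f : R -> R[i]) (a e : R) l : 0 < e ->
  cvgC a^'+ f l -> cvgC \oo (fun k : nat => f (a + e / k.+3%:R)) l.
Proof.
move=> e0 [f1 f2].
have H : (forall k, a + e / k.+3%:R > a) /\ (a + e / k.+3%:R @[k --> \oo] --> a).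
  split=> [k|]; first by rewrite ltrDl divr_gt0.
  by rewrite -[X in _ --> X]addr0; apply: cvgD; [exact: cvg_cst|exact: harm_to0].
by split; [move/cvg_at_rightP: f1; apply|move/cvg_at_rightP: f2; apply].
Qed.

Let at_left_seq (f : R -> R[i]) (b e : R) l : 0 < e ->
  cvgC b^'- f l -> cvgC \oo (fun k : nat => f (b - e / k.+3%:R)) l.
Proof.
move=> e0 [f1 f2].
have H : (forall k, b - e / k.+3%:R < b) /\ (b - e / k.+3%:R @[k --> \oo] --> b).
  split=> [k|]; first by rewrite ltrBlDr ltrDl divr_gt0.
  by rewrite -[X in _ --> X]subr0; apply: cvgB; [exact: cvg_cst|exact: harm_to0].
by split; [move/cvg_at_leftP: f1; apply|move/cvg_at_leftP: f2; apply].
Qed.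

Lemma FTC_oo (a b : R) (F dF : R -> R[i]) A B : a < b ->
  (forall x, a < x < b -> is_derC F x (dF x)) ->
  continuousC_on `]a, b[ dF -> integrableC `]a, b[ dF ->
  cvgC a^'+ F A -> cvgC b^'- F B -> intC `]a, b[ dF = B - A.
Proof.
move=> ab dFP cdF idF FA FB; have e0 : 0 < b - a by rewrite subr_gt0.
have half k : (b - a) / k.+3%:R < (b - a) / 2.
  by rewrite ltr_pM2l // ltf_pV2 ?posrE // ltr_nat.
have split2 : (b - a) / 2 + (b - a) / 2 = b - a by rewrite -splitr.
apply: (@FTC_seq _ _ F dF (fun k => a + (b - a) / k.+3%:R) (fun k => b - (b - a) / k.+3%:R)) => //.
- by move=> k; move: (half k); move: (_ / _.+3%:R) => q; lra.
- move=> k x /andP[h1 h2]; rewrite /= in_itv /=.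
  have : 0 < (b - a) / k.+3%:R by rewrite divr_gt0.
  move: h1 h2; move: (_ / _.+3%:R) => q ? ? ?; apply/andP; split; lra.
- move=> x; rewrite /= in_itv /= => /andP[ax xb].
  near=> k; apply/andP; split.
  + near: k; apply: (cvgr_le a) => //.
    by rewrite -[X in _ --> X]addr0; apply: cvgD; [exact: cvg_cst|exact: harm_to0].
  + near: k; apply: (cvgr_ge b) => //.
    by rewrite -[X in _ --> X]subr0; apply: cvgB; [exact: cvg_cst|exact: harm_to0].
- exact: at_right_seq.
- exact: at_left_seq.
Unshelve. all: by end_near. Qed.

Lemma FTC_oy (a : R) (F dF : R -> R[i]) A B :
  (forall x, a < x -> is_derC F x (dF x)) ->
  continuousC_on `]a, +oo[ dF -> integrableC `]a, +oo[ dF ->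
  cvgC a^'+ F A -> cvgC +oo F B -> intC `]a, +oo[ dF = B - A.
Proof.
move=> dFP cdF idF FA FB.
have cv : a + 1 + k%:R @[k --> \oo] --> (+oo : set_system R).
  under eq_fun do rewrite addrC.
  exact: (cvg_comp (fun k : nat => k%:R) (fun x => x + (a + 1)) cvgr_idn (cvg_addrr _)).
have lt3 k : 1 / k.+3%:R < (1 : R) by rewrite div1r invf_lt1 // ltr1n.
apply: (@FTC_seq _ _ F dF (fun k => a + 1 / k.+3%:R) (fun k => a + 1 + k%:R)) => //.
- by move=> k; rewrite -addrA ltrD2l ltr_wpDr.
- move=> k x /andP[h1 h2]; rewrite /= in_itv /= andbT.
  by apply: lt_le_trans h1; rewrite ltrDl divr_gt0.
- move=> x; rewrite /= in_itv /= andbT => ax.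
  near=> k; apply/andP; split.
  + near: k; apply: (cvgr_le a) => //.
    by rewrite -[X in _ --> X]addr0; apply: cvgD; [exact: cvg_cst|exact: harm_to0].
  + near: k; move/cvgryPge: cv; exact.
- by move=> x; rewrite /= in_itv /= andbT; exact: dFP.
- exact: at_right_seq.
- exact: cvgC_comp cv FB.
Unshelve. all: by end_near. Qed.

Lemma integrable_expRN (a c : R) : 0 < c ->
  mu.-integrable `]a, +oo[ (EFin \o (fun x => expR (- c * x))).
Proof.
move=> c0; apply/integrableP; split.
  apply/measurable_EFinP; apply: measurable_of_continuous.
  - exact: measurable_itv.
  - exact: interval_open.
  - move=> x _; apply: continuous_comp; last exact: continuous_expR.
    by apply: cvgM; [exact: cvg_cst|exact: cvg_id].
under eq_integral do rewrite /= ger0_norm ?expR_ge0 //.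
rewrite integral_itv_obnd_cbnd; last first.
  apply/measurable_EFinP; apply: measurable_of_continuous.
  - exact: measurable_itv.
  - exact: interval_open.
  - move=> x _; apply: continuous_comp; last exact: continuous_expR.
    by apply: cvgM; [exact: cvg_cst|exact: cvg_id].
have D (x : R) : is_derive x 1 (fun y => - (expR (- c * y) / c)) (expR (- c * x)).
  have H1 : is_derive x 1 (fun y : R => - c * y) (- c).
    apply: (is_derive_eq (is_deriveZ (- c) (is_derive_id x (1 : R)))).
    by rewrite /GRing.scale /= mulr1.
  have H2 := is_derive1_comp (is_derive_expR (- c * x)) H1.
  have H3 := is_deriveN (is_deriveZ c^-1 H2).
  have -> : (fun y : R => - (expR (- c * y) / c)) = (fun y => - (c^-1 *: expR (- c * y))).
    by apply/funext => y; rewrite mulrC.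
  apply: (is_derive_eq H3); rewrite /GRing.scale /=.
  by field; rewrite gt_eqF.
rewrite (@ge0_continuous_FTC2y _ _ (fun y => - (expR (- c * y) / c)) a 0) //.
- by rewrite -EFinB ltry.
- apply: continuous_subspaceT => x; apply: continuous_comp; last exact: continuous_expR.
  by apply: cvgM; [exact: cvg_cst|exact: cvg_id].
- rewrite -[X in _ --> X]oppr0 -(mul0r c^-1); apply: cvgN; apply: cvgM; last exact: cvg_cst.
  under eq_fun do rewrite mulNr.
  apply: (cvg_comp (fun x => c * x) (fun x => expR (- x))); last exact: cvgr_expR.
  by apply: gt0_cvgMry.
- have [/derivable1_diffP/differentiable_continuous Da _] := D a.
  exact: cvg_at_right_filter Da.
- by move=> x _ /=; rewrite derive1E; have [_ ->] := D x.
Qed.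

Lemma pow_le_expR (c x : R) m : 0 < c -> 0 <= x ->
  x ^+ m <= m`!%:R / c ^+ m * expR (c * x).
Proof.
move=> c0 x0; case: m => [|m].
  by rewrite !expr0 fact0 divr1 mul1r -expR0 ler_expR mulr_ge0 // ltW.
have := @expR_ge1Dxn _ (c * x) m (mulr_ge0 (ltW c0) x0).
move=> /(le_trans (_ : (c * x) ^+ m.+1 / m.+1`!%:R <= _)).
rewrite lerDr ler01 => /(_ isT).
rewrite ler_pdivrMr ?ltr0n ?fact_gt0 // exprMn -ler_pdivlMl ?exprn_gt0 //.
move=> H; apply: le_trans H _; rewrite le_eqVlt; apply/orP; left; apply/eqP.
by field; rewrite expf_neq0 // gt_eqF.
Qed.

End OpenFTC.

(** * The weight along an arc *)

Section Arc.
Context {R : realType}.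
Notation mu := (@lebesgue_measure R).
Notation meas D := (@measurable _ (measurableTypeR R) D).

(** A parametrized curve, so that the half-line and the two half-circles are
   treated alike. *)
Record arc := Arc { adom : set R; apar : R -> R[i]; ader : R -> R[i] }.

(** The bound on [Re (1/z)] controls the essential singularity [exp (- n t / z)]
   locally uniformly in [t], although [1/z] is unbounded on the circle. *)
Record arc_ok (n : nat) (kappa : R) (a : arc) : Prop := ArcOk {
  arc_meas : meas (adom a);
  arc_open : open (adom a);
  arc_der : forall x, adom a x -> is_derC (apar a) x (ader a x);
  arc_dcont : continuousC_on (adom a) (ader a);
  arc_neq0 : forall x, adom a x -> apar a x != 0;
  arc_inv : forall x, adom a x -> 0 <= complex.Re (apar a x)^-1 <= kappa;
  arc_int : forall m, mu.-integrable (adom a) (EFin \o (fun x =>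
    absC (apar a x) ^+ m * expR (- n%:R * complex.Re (apar a x)) * absC (ader a x)))
}.

(** Since [n] is an integer, the branch of the logarithm disappears and the weight
   is a single-valued function off the origin. *)
Lemma weightE (n : nat) (c : R[i]) (t : R) (z : R[i]) : z != 0 ->
  weight n c t z =
  c * (z ^+ n * expC (- n%:R * z) * expC (- (n%:R * t%:C / z))).
Proof.
move=> z0; rewrite /weight /potential; congr (_ * _).
have -> : z ^+ n = expC (n%:R * logC z) by rewrite expC_nat expCK.
by rewrite -!expCD; congr expC; ring.
Qed.

Lemma weight_scale (n : nat) (c : R[i]) (t : R) (z : R[i]) :
  weight n c t z = c * weight n 1 t z.
Proof. by rewrite /weight mul1r. Qed.

Lemma weight_derC (n : nat) (t x : R) (g : R -> R[i]) (dg : R[i]) :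
  g x != 0 -> is_derC g x dg ->
  is_derC (fun u => weight n 1 t (g u)) x
    ((n%:R / g x - n%:R + n%:R * t%:C / g x ^+ 2) * weight n 1 t (g x) * dg).
Proof.
move=> z0 dz; have nD : \forall u \near x, g u != 0 by exact: cvgC_neq0 (is_derC_cvg dz) z0.
apply: (near_is_derC (g := fun u => g u ^+ n * expC (- n%:R * g u)
    * expC (- n%:R * t%:C * (g u)^-1))).
  by apply: filterS nD => u Du; rewrite weightE // mul1r !mulNr.
have H1 := is_derC_X n dz.
have H2 := is_derC_expC (is_derC_Z (- n%:R) dz).
have H3 := is_derC_expC (is_derC_Z (- n%:R * t%:C) (is_derC_V z0 dz)).
apply: (is_derC_eq (is_derC_M (is_derC_M H1 H2) H3)).
rewrite weightE // mul1r -!mulNr.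
case: n H1 H2 H3 => [|m] _ _ _; first by rewrite !mul0r; field.
rewrite /= exprS; field => //.
Qed.

Context (n : nat) (kappa : R) (a : arc).
Hypothesis ok : arc_ok n kappa a.
Let kappa0 x : adom a x -> 0 <= kappa.
Proof. by move=> /(arc_inv ok)/andP[]; exact: le_trans. Qed.

Lemma absC_weight_le (t x : R) : adom a x ->
  absC (weight n 1 t (apar a x)) <= absC (apar a x) ^+ n *
    expR (- n%:R * complex.Re (apar a x)) * expR (n%:R * `|t| * kappa).
Proof.
move=> Dx; have z0 := arc_neq0 ok Dx; have /andP[h1 h2] := arc_inv ok Dx.
rewrite weightE // mul1r 2!absCM absCX 2!absC_expC.
have -> : complex.Re (- n%:R * apar a x) = - n%:R * complex.Re (apar a x).
  by rewrite natCR -rmorphN ReM /= mul0r subr0.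
rewrite ler_wpM2l ?mulr_ge0 ?expR_ge0 ?exprn_ge0 // ler_expR.
have -> : complex.Re (- (n%:R * t%:C / apar a x)) = n%:R * (- t * complex.Re (apar a x)^-1).
  by rewrite natCR -rmorphM ReN ReM /= mul0r subr0; ring.
rewrite -mulrA ler_wpM2l //.
apply: le_trans (_ : `|t| * complex.Re (apar a x)^-1 <= _).
  by rewrite ler_wpM2r // -normrN ler_norm.
by rewrite ler_wpM2l.
Qed.

Lemma weight_der (t x : R) : adom a x ->
  is_derC (fun u => weight n 1 t (apar a u)) x
    ((n%:R / apar a x - n%:R + n%:R * t%:C / apar a x ^+ 2) *
     weight n 1 t (apar a x) * ader a x).
Proof.
move=> Dx; apply: weight_derC; first exact: (arc_neq0 ok).
exact: (arc_der ok).
Qed.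

(** Admissible functions: the bound compensates the zero of the weight at the
   origin, so that products with the weight stay integrable for every [t]. *)
Definition tame (f : R[i] -> R[i]) (K : R) (m : nat) : Prop :=
  continuousC_on (adom a) (fun x => f (apar a x)) /\
  forall x, adom a x ->
    absC (f (apar a x)) * absC (apar a x) ^+ n <= K * (1 + absC (apar a x) ^+ m).

Definition pint (t : R) (f : R[i] -> R[i]) : R[i] :=
  intC (adom a) (fun x => f (apar a x) * weight n 1 t (apar a x) * ader a x).

Let dom (m : nat) (x : R) :=
  absC (apar a x) ^+ m * expR (- n%:R * complex.Re (apar a x)) * absC (ader a x).

Let dom1 (m : nat) (x : R) := dom 0 x + dom m x.

Let dom1_int m : mu.-integrable (adom a) (EFin \o dom1 m).
Proof.
rewrite /dom1 (_ : EFin \o _ = (EFin \o dom 0) \+ (EFin \o dom m))%E.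
  by apply: integrableD; [exact: arc_meas ok|exact: (arc_int ok 0)|exact: (arc_int ok m)].
by apply/funext => x /=; rewrite EFinD.
Qed.

Let domE m x : dom1 m x =
  (1 + absC (apar a x) ^+ m) * expR (- n%:R * complex.Re (apar a x)) * absC (ader a x).
Proof. by rewrite /dom1 /dom expr0; ring. Qed.

Let dom1_ge0 m x : 0 <= dom1 m x.
Proof. by rewrite domE !mulr_ge0 ?expR_ge0 // addr_ge0 // exprn_ge0. Qed.

Let Zint (c : R) m : mu.-integrable (adom a) (EFin \o (fun x => c * dom1 m x)).
Proof. exact: (integrableZl (arc_meas ok) c (dom1_int m)). Qed.

Lemma tame_bound f K m t x : tame f K m -> adom a x ->
  absC (f (apar a x) * weight n 1 t (apar a x) * ader a x) <=
  K * expR (n%:R * `|t| * kappa) * dom1 m x.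
Proof.
move=> [_ fK] Dx; rewrite 2!absCM domE.
have H := ler_wpM2l (absC_ge0 (f (apar a x))) (absC_weight_le t Dx).
apply: le_trans (ler_wpM2r (absC_ge0 _) H) _.
have E0 := expR_ge0 (- n%:R * complex.Re (apar a x)).
have E1 := expR_ge0 (n%:R * `|t| * kappa).
move: (fK x Dx) E0 E1.
set f' := absC (f _); set z' := _ ^+ n; set e0 := expR _; set e1 := expR _.
set d' := absC (ader a x); move=> H1 E0 E1.
have -> : f' * (z' * e0 * e1) * d' = f' * z' * (e0 * e1 * d') by ring.
have -> : K * e1 * ((1 + absC (apar a x) ^+ m) * e0 * d') =
  K * (1 + absC (apar a x) ^+ m) * (e0 * e1 * d') by ring.
by rewrite ler_wpM2r // !mulr_ge0 //; exact: absC_ge0.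
Qed.

Lemma tame_continuous f K m t : tame f K m ->
  continuousC_on (adom a)
    (fun x => f (apar a x) * weight n 1 t (apar a x) * ader a x).
Proof.
move=> [cf _] x Dx; apply: cvgC_M; last exact: (arc_dcont ok).
apply: cvgC_M; first exact: cf.
exact: is_derC_cvg (weight_der t Dx).
Qed.

Lemma tame_integrable f K m t : tame f K m ->
  integrableC (adom a) (fun x => f (apar a x) * weight n 1 t (apar a x) * ader a x).
Proof.
move=> tf; apply: (integrableC_bound (arc_meas ok) (arc_open ok)
  (tame_continuous t tf) (Zint (K * expR (n%:R * `|t| * kappa)) m)).
by move=> x Dx; exact: tame_bound.
Qed.

Lemma pint_bound t m : exists2 C : R, 0 <= C &
  forall f K, tame f K m -> absC (pint t f) <= C * K.
Proof.
exists (2 * expR (n%:R * `|t| * kappa) * \int[mu]_(x in adom a) dom1 m x).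
  by rewrite !mulr_ge0 ?expR_ge0 // Rintegral_ge0 // => x _; exact: dom1_ge0.
move=> f K tf; apply: le_trans (absC_intC_le (arc_meas ok) (tame_integrable t tf)
  (Zint (K * expR (n%:R * `|t| * kappa)) m) _) _.
  by move=> x Dx; exact: tame_bound.
rewrite RintegralZl; [|exact: arc_meas ok|exact: dom1_int].
by rewrite le_eqVlt; apply/orP; left; apply/eqP; ring.
Qed.

Lemma pint_D t f g K K' m m' : tame f K m -> tame g K' m' ->
  pint t (fun z => f z + g z) = pint t f + pint t g.
Proof.
move=> tf tg; rewrite /pint -intC_D.
- by apply: eq_intC => x _; ring.
- exact: arc_meas ok.
- exact: tame_integrable tf.
- exact: tame_integrable tg.
Qed.

Lemma pint_Z t f K m c : tame f K m ->
  pint t (fun z => c * f z) = c * pint t f.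
Proof.
move=> tf; rewrite /pint -intC_Z.
- by apply: eq_intC => x _; ring.
- exact: arc_meas ok.
- exact: tame_integrable tf.
Qed.

(** Dominated convergence: for [|t| < 1] the weights have a common bound. *)
Lemma pint_cvg0 f K m : 0 <= K -> tame f K m ->
  cvgC (nbhs (0 : R)) (fun t => pint t f) (pint 0 f).
Proof.
move=> K0 tf; pose F t x := f (apar a x) * weight n 1 t (apar a x) * ader a x.
have ub (t x : R) : -1 < t < 1 -> adom a x ->
    absC (F t x) <= K * expR (n%:R * kappa) * dom1 m x.
  move=> t1 Dx; apply: le_trans (tame_bound t tf Dx) _.
  rewrite ler_wpM2r // ler_wpM2l // ler_expR -mulrA ler_wpM2l //.
  by rewrite ler_piMl ?(kappa0 Dx) // ler_norml; case/andP: t1 => /ltW -> /ltW ->.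
have dF (t x : R) : adom a x -> cvgC (nbhs t) (F ^~ x) (F t x).
  move=> Dx; apply: cvgC_M; last exact: cvgC_cst.
  apply: cvgC_M; first exact: cvgC_cst.
  have z0 := arc_neq0 ok Dx; rewrite weightE //.
  under eq_fun do rewrite weightE //.
  apply: cvgC_M; first exact: cvgC_cst.
  apply: cvgC_M; first exact: cvgC_cst.
  have H := is_derC_expC (is_derC_Z (- (n%:R / apar a x)) (is_derC_id t)).
  have -> : (fun u : R => expC (- (n%:R * u%:C / apar a x))) =
            (fun u => expC (- (n%:R / apar a x) * u%:C)).
    by apply/funext => u; congr expC; ring.
  have -> : expC (- (n%:R * t%:C / apar a x)) = expC (- (n%:R / apar a x) * t%:C).
    by congr expC; ring.
  exact: is_derC_cvg H.
have key (p : R[i] -> R) : (forall z, `|p z| <= absC z) ->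
    (forall t x, adom a x -> p (F u x) @[u --> t] --> p (F t x)) ->
    (forall t, mu.-integrable (adom a) (EFin \o (fun x => p (F t x)))) ->
    \int[mu]_(x in adom a) p (F u x) @[u --> (0:R)] --> \int[mu]_(x in adom a) p (F 0 x).
  move=> ple pc pint; apply: (@continuity_under_integral R _ _ mu
    (fun t x => p (F t x)) (adom a) (arc_meas ok) (-1) 1 _ _
    (fun x => K * expR (n%:R * kappa) * dom1 m x)) => //.
  - by apply: aeW => x Dx t _; exact: pc.
  - move=> t /=; rewrite in_itv /= => t1; apply: aeW => x Dx.
    by apply: le_trans (ple _) _; exact: ub.
  - by rewrite inE /= in_itv /= ltrN10 ltr01.
split; apply: key.
- exact: ler_ReC.
- by move=> t x Dx; have [] := dF t x Dx.
- by move=> t; have [] := tame_integrable t tf.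
- exact: ler_ImC.
- by move=> t x Dx; have [] := dF t x Dx.
- by move=> t; have [] := tame_integrable t tf.
Qed.

End Arc.

(** * The three arcs of the contour *)

Section Contour.
Context {R : realType} (delta : R).
Hypothesis delta0 : 0 < delta.
Notation mu := (@lebesgue_measure R).
Notation meas D := (@measurable _ (measurableTypeR R) D).

Definition ray : arc := Arc `]2 * delta, +oo[ (real_complex R) (fun=> 1).
Definition upper_arc : arc := Arc `]0, pi[ (circ delta) (dcirc delta).
Definition lower_arc : arc := Arc `](- pi), 0[ (circ delta) (dcirc delta).

Lemma circE (theta : R) : circ delta theta =
  (delta * (1 + cos theta)) +i* (delta * sin theta).
Proof.
have -> : circ delta theta = delta%:C * (1 + expC (0 +i* theta)).
  by congr (_ * (_ + expC _)); apply: complexP; rewrite !ReImE /=; ring.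
by apply: complexP; rewrite /expC !ReImE /= expR0; ring.
Qed.

Lemma is_derC_circ (theta : R) : is_derC (circ delta) theta (dcirc delta theta).
Proof.
apply: is_derC_Z; rewrite -[X in is_derC _ _ X]add0r; apply: is_derC_D; first exact: is_derC_cst.
apply: is_derC_expC; apply: (is_derC_eq (is_derC_Z _ (is_derC_id theta))).
by rewrite mulr1.
Qed.

Lemma continuousC_dcirc (theta : R) :
  cvgC (nbhs theta) (dcirc delta) (dcirc delta theta).
Proof.
apply: is_derC_cvg; apply: is_derC_Z; apply: is_derC_Z; apply: is_derC_expC.
exact: is_derC_Z (is_derC_id theta).
Qed.

Lemma cos_gtN1 (theta : R) : - pi < theta < pi -> 0 < 1 + cos theta.
Proof.
move=> /andP[h1 h2]; have -> : theta = (theta / 2) *+ 2 by rewrite -mulr_natr divfK.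
rewrite cos_mulr2n addrC subrK pmulrn_lgt0 // exprn_gt0 //.
apply: cos_gt0_pihalf; apply/andP; split; lra.
Qed.

Lemma circ_pi : circ delta pi = 0.
Proof. by rewrite circE cospi sinpi subrr !mulr0. Qed.

Lemma circ_Npi : circ delta (- pi) = 0.
Proof. by rewrite circE cosN sinN cospi sinpi subrr oppr0 !mulr0. Qed.

Lemma circ_0 : circ delta 0 = (2 * delta)%:C.
Proof. by rewrite circE cos0 sin0 mulr0; congr (_ +i* _); rewrite mulrC. Qed.

Lemma Re_circ (theta : R) : - pi < theta < pi -> 0 < complex.Re (circ delta theta).
Proof. by move=> H; rewrite circE /= mulr_gt0 // cos_gtN1. Qed.

Lemma circ_neq0 (theta : R) : - pi < theta < pi -> circ delta theta != 0.
Proof.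
move=> /Re_circ H; apply/eqP => H0; move: H; rewrite H0 /=.
by rewrite ltxx.
Qed.

(** Inversion maps the circle to the vertical line of abscissa [1/(2 delta)]. *)
Lemma Re_circV (theta : R) : - pi < theta < pi ->
  complex.Re (circ delta theta)^-1 = (2 * delta)^-1.
Proof.
move=> H; rewrite ReV circE /=.
have c0 := cos_gtN1 H; have cs := cos2Dsin2 theta.
have -> : (delta * (1 + cos theta)) ^+ 2 + (delta * sin theta) ^+ 2 =
  2 * delta ^+ 2 * (1 + cos theta).
  by rewrite !exprMn; have -> : sin theta ^+ 2 = 1 - cos theta ^+ 2; [lra|ring].
by field; rewrite !gt_eqF.
Qed.

Lemma absC_circ_le (theta : R) : absC (circ delta theta) <= 2 * delta.
Proof.
rewrite /circ absCM absCR gtr0_norm // mulrC ler_pM2r //.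
apply: le_trans (ler_absCD _ _) _; rewrite absC1 absC_expC.
have -> : complex.Re (iC R * theta%:C) = 0.
  by rewrite ReM /= mul0r mulr0 subr0.
by rewrite expR0.
Qed.

Lemma absC_dcirc (theta : R) : absC (dcirc delta theta) = delta.
Proof.
rewrite /dcirc 2!absCM absCR gtr0_norm // absC_expC.
have -> : complex.Re (iC R * theta%:C) = 0.
  by rewrite ReM /= mul0r mulr0 subr0.
have -> : absC (iC R) = 1 by rewrite absCE /= expr0n expr1n add0r sqrtr1.
by rewrite expR0 !mulr1.
Qed.

Lemma circ_arc_ok (n : nat) (b c : R) : - pi <= b -> c <= pi -> b < c ->
  arc_ok n (2 * delta)^-1 (Arc `]b, c[ (circ delta) (dcirc delta)).
Proof.
move=> pb cp bc; have sub x : `]b, c[%classic x -> - pi < x < pi.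
  by rewrite /= in_itv /= => /andP[h1 h2]; apply/andP; split; lra.
split.
- exact: measurable_itv.
- exact: interval_open.
- by move=> x _; exact: is_derC_circ.
- by move=> x _; exact: continuousC_dcirc.
- by move=> x /sub; exact: circ_neq0.
- by move=> x /sub H; rewrite Re_circV // lexx invr_ge0 mulr_ge0 // ltW.
- move=> m; apply: measurable_bounded_integrable.
  + exact: measurable_itv.
  + change ((mu `]b, c[%classic < +oo)%E).
    by rewrite lebesgue_measure_itv /= lte_fin bc -EFinB ltry.
  + apply: measurable_of_continuous; [exact: measurable_itv|exact: interval_open|].
    have E u : absC (circ delta u) ^+ m * expR (- n%:R * complex.Re (circ delta u)) *
      absC (dcirc delta u) =
      absC (circ delta u ^+ m * expC (- n%:R * circ delta u) * dcirc delta u).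
      rewrite 2![in RHS]absCM absCX absC_expC; congr (_ * expR _ * _).
      by rewrite natCR -rmorphN (Re_realM (- n%:R) (circ delta u)).
    move=> x _; have cx := is_derC_circ x.
    change (absC (circ delta u) ^+ m * expR (- n%:R * complex.Re (circ delta u)) *
      absC (dcirc delta u) @[u --> x] --> absC (circ delta x) ^+ m *
      expR (- n%:R * complex.Re (circ delta x)) * absC (dcirc delta x)).
    under eq_fun do rewrite E; rewrite E; apply: cvgC_abs.
    apply: cvgC_M; last exact: continuousC_dcirc.
    apply: cvgC_M; first exact: cvgC_X (is_derC_cvg cx).
    exact: is_derC_cvg (is_derC_expC (is_derC_Z (- n%:R) cx)).
  + exists ((2 * delta) ^+ m * delta); split; first exact: num_real.
    move=> M HM x /sub Hx /=; apply: le_trans (ltW HM).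
    rewrite absC_dcirc ger0_norm; last first.
      by rewrite !mulr_ge0 ?exprn_ge0 ?expR_ge0 // ltW.
    rewrite ler_pM2r // -[leRHS]mulr1; apply: ler_pM.
    * by rewrite exprn_ge0.
    * exact: expR_ge0.
    * by rewrite lerXn2r ?nnegrE ?absC_circ_le // mulr_ge0 // ltW.
    * by rewrite expR_le1 mulNr oppr_le0 mulr_ge0 // ltW // Re_circ.
Qed.

Lemma upper_arc_ok (n : nat) : arc_ok n (2 * delta)^-1 upper_arc.
Proof. by apply: circ_arc_ok; rewrite ?oppr_le0 ?pi_ge0 ?pi_gt0. Qed.

Lemma lower_arc_ok (n : nat) : arc_ok n (2 * delta)^-1 lower_arc.
Proof. by apply: circ_arc_ok; rewrite ?oppr_lt0 ?pi_ge0 ?pi_gt0. Qed.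

Lemma pow_expRN_le (n m : nat) (x : R) : (0 < n)%N -> 0 <= x ->
  x ^+ m * expR (- n%:R * x) <= m`!%:R / (n%:R / 2) ^+ m * expR (- (n%:R / 2) * x).
Proof.
move=> n0 x0; have n2 : 0 < n%:R / 2 :> R by rewrite divr_gt0 // ltr0n.
apply: le_trans (ler_wpM2r (expR_ge0 _) (pow_le_expR m n2 x0)) _.
rewrite -[leLHS]mulrA -expRD le_eqVlt; apply/orP; left; apply/eqP.
by congr (_ * expR _); field.
Qed.

Lemma ray_ok (n : nat) : (0 < n)%N -> arc_ok n (2 * delta)^-1 ray.
Proof.
move=> n0; have n2 : 0 < n%:R / 2 :> R by rewrite divr_gt0 // ltr0n.
have d2 : 0 < 2 * delta by rewrite mulr_gt0.
have pos x : adom ray x -> 0 < x.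
  by rewrite /= in_itv /= andbT; exact: lt_trans.
split.
- exact: measurable_itv.
- exact: interval_open.
- by move=> x _; exact: is_derC_id.
- by move=> x _; exact: cvgC_cst.
- by move=> x /pos x0; rewrite eq_complex /= eqxx andbT gt_eqF.
- move=> x Dx; have x0 := pos x Dx.
  have -> : apar ray x = x%:C by [].
  rewrite -fmorphV /= invr_ge0 ltW //=.
  by rewrite lef_pV2 ?posrE //; move: Dx; rewrite /= in_itv /= andbT => /ltW.
- move=> m; have H := integrableZl (measurable_itv `]2 * delta, +oo[ : meas _)
    (m`!%:R / (n%:R / 2) ^+ m) (integrable_expRN (2 * delta) n2).
  apply: (le_integrable _ _ _ H) => //.
  + apply/measurable_EFinP; apply: measurable_of_continuous;
      [exact: measurable_itv|exact: interval_open|].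
    move=> x _; have cx := is_derC_cvg (is_derC_id x).
    apply: cvgM; last exact: cvg_cst.
    apply: cvgM.
      apply: (cvg_comp (fun u : R => absC u%:C) (fun y => y ^+ m)).
        exact: cvgC_abs cx.
      exact: exprn_continuous.
    apply: (cvg_comp (fun u : R => - n%:R * u) (@expR R)).
      by apply: cvgM; [exact: cvg_cst|exact: cvg_id].
    exact: continuous_expR.
  + move=> x Dx; have x0 := ltW (pos x Dx).
    rewrite lee_fin [ader ray x]/(1 : R[i]) absC1 mulr1 [apar ray x]/(x%:C) absCR (ger0_norm x0).
    apply: le_trans (ler_norm _); rewrite ger0_norm ?mulr_ge0 ?exprn_ge0 ?expR_ge0 //.
    exact: pow_expRN_le.
Qed.

End Contour.

(** * Integration over the contour *)

Section GammaIntegral.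
Context {R : realType} (delta : R) (n : nat) (alpha : R[i]).
Hypothesis delta0 : 0 < delta.
Hypothesis n0 : (0 < n)%N.

Definition on_Gamma (z : R[i]) : Prop :=
  (exists2 x : R, 2 * delta < x & z = x%:C) \/
  (exists2 theta : R, - pi < theta < pi & theta != 0 /\ z = circ delta theta).

(** [f1] is the derivative of [f] along every curve through points of [S], which
   is as much of complex differentiability as the contour sees. *)
Definition curve_diff (S : R[i] -> Prop) (f f1 : R[i] -> R[i]) : Prop :=
  forall (g : R -> R[i]) (x : R) dg, S (g x) -> is_derC g x dg ->
    is_derC (fun u => f (g u)) x (f1 (g x) * dg).

Let ray_on x : adom (ray delta) x -> on_Gamma (apar (ray delta) x).
Proof. by rewrite /= in_itv /= andbT => H; left; exists x. Qed.

Let up_on x : adom (upper_arc delta) x -> on_Gamma (apar (upper_arc delta) x).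
Proof.
rewrite /= in_itv /= => /andP[h1 h2]; right; exists x; rewrite ?h2 ?gt_eqF //.
by rewrite (lt_trans _ h1) // oppr_lt0 pi_gt0.
Qed.

Let dn_on x : adom (lower_arc delta) x -> on_Gamma (apar (lower_arc delta) x).
Proof.
rewrite /= in_itv /= => /andP[h1 h2]; right; exists x; rewrite ?h1 ?lt_eqF //=.
by rewrite (lt_trans h2) // pi_gt0.
Qed.

Lemma on_Gamma_neq0 z : on_Gamma z -> z != 0.
Proof.
case=> [[x xd ->]|[theta th [_ ->]]]; last exact: circ_neq0.
rewrite eq_complex /= eqxx andbT gt_eqF //.
by apply: lt_trans xd; rewrite mulr_gt0.
Qed.

Definition tameG (f : R[i] -> R[i]) (K : R) (m : nat) : Prop :=
  [/\ tame n (ray delta) f K m, tame n (upper_arc delta) f K m &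
      tame n (lower_arc delta) f K m].

Lemma tameG_intro f f1 K m : curve_diff on_Gamma f f1 ->
  (forall z, on_Gamma z -> absC (f z) * absC z ^+ n <= K * (1 + absC z ^+ m)) ->
  tameG f K m.
Proof.
move=> cd bd; split; split.
- move=> x Dx; apply: is_derC_cvg; apply: cd; first exact: ray_on.
  exact: (arc_der (ray_ok delta0 n0) Dx).
- by move=> x /ray_on /bd.
- move=> x Dx; apply: is_derC_cvg; apply: cd; first exact: up_on.
  exact: (arc_der (upper_arc_ok delta0 n) Dx).
- by move=> x /up_on /bd.
- move=> x Dx; apply: is_derC_cvg; apply: cd; first exact: dn_on.
  exact: (arc_der (lower_arc_ok delta0 n) Dx).
- by move=> x /dn_on /bd.
Qed.

Definition admissible f : Prop := exists K m, tameG f K m.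

Lemma intGammaE t f : admissible f -> intGamma delta n alpha t f =
  pint n (ray delta) t f - alpha * pint n (upper_arc delta) t f
  + (1 - alpha) * pint n (lower_arc delta) t f.
Proof.
move=> [K [m [t1 t2 t3]]]; rewrite /intGamma; congr (_ - _ + _).
- by apply: eq_intC => x _ /=; rewrite mulr1.
- rewrite /pint -intC_Z.
  + by apply: eq_intC => x _ /=; rewrite (weight_scale n alpha); ring.
  + exact: (arc_meas (upper_arc_ok delta0 n)).
  + exact: (tame_integrable (upper_arc_ok delta0 n) t t2).
- rewrite /pint -intC_Z.
  + by apply: eq_intC => x _ /=; rewrite (weight_scale n (1 - alpha)); ring.
  + exact: (arc_meas (lower_arc_ok delta0 n)).
  + exact: (tame_integrable (lower_arc_ok delta0 n) t t3).
Qed.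

Let pow_le2 (x : R) (m M : nat) : 0 <= x -> (m <= M)%N ->
  1 + x ^+ m <= 2 * (1 + x ^+ M).
Proof.
move=> x0 mM; have [x1|x1] := leP x 1.
  have H : x ^+ m <= 1 by exact: exprn_ile1.
  have := exprn_ge0 M x0; lra.
have H : x ^+ m <= x ^+ M by rewrite ler_eXn2l.
have := exprn_ge0 M x0; lra.
Qed.

Lemma tame_weaken (a : @arc R) f K m M : tame n a f K m -> (m <= M)%N ->
  tame n a f (2 * `|K|) M.
Proof.
move=> [cf bf] mM; split => // x Dx; apply: le_trans (bf x Dx) _.
apply: le_trans (_ : `|K| * (1 + absC (apar a x) ^+ m) <= _).
  by rewrite ler_wpM2r ?ler_norm // addr_ge0 // exprn_ge0.
by rewrite [2 * _]mulrC -mulrA ler_wpM2l // pow_le2.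
Qed.

Lemma admissible_D f g : admissible f -> admissible g ->
  admissible (fun z => f z + g z).
Proof.
move=> [K [m [f1 f2 f3]]] [K' [m' [g1 g2 g3]]].
have key a : tame n a f K m -> tame n a g K' m' ->
    tame n a (fun z => f z + g z) (2 * `|K| + 2 * `|K'|) (m + m').
  move=> /tame_weaken/(_ (leq_addr m' m))[cf bf] /tame_weaken/(_ (leq_addl m m'))[cg bg].
  split=> [x Dx|x Dx]; first by apply: cvgC_D; [exact: cf|exact: cg].
  rewrite [X in _ <= X]mulrDl; apply: le_trans (lerD (bf x Dx) (bg x Dx)).
  by rewrite -mulrDl ler_wpM2r ?exprn_ge0 // ler_absCD.
by exists (2 * `|K| + 2 * `|K'|), (m + m')%N; split; exact: key.
Qed.

Lemma admissible_Z f c : admissible f -> admissible (fun z => c * f z).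
Proof.
move=> [K [m [f1 f2 f3]]].
have key a : tame n a f K m -> tame n a (fun z => c * f z) (absC c * K) m.
  move=> [cf bf]; split=> [x Dx|x Dx].
    by apply: cvgC_M; [exact: cvgC_cst|exact: cf].
  by rewrite absCM -!mulrA ler_wpM2l // bf.
by exists (absC c * K), m; split; exact: key.
Qed.

Lemma intGamma_D t f g : admissible f -> admissible g ->
  intGamma delta n alpha t (fun z => f z + g z) =
  intGamma delta n alpha t f + intGamma delta n alpha t g.
Proof.
move=> af ag; rewrite !intGammaE //; last exact: admissible_D.
case: af => [K [m [f1 f2 f3]]]; case: ag => [K' [m' [g1 g2 g3]]].
rewrite (pint_D (ray_ok delta0 n0) t f1 g1) (pint_D (upper_arc_ok delta0 n) t f2 g2).
rewrite (pint_D (lower_arc_ok delta0 n) t f3 g3); ring.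
Qed.

Lemma intGamma_Z t f c : admissible f ->
  intGamma delta n alpha t (fun z => c * f z) = c * intGamma delta n alpha t f.
Proof.
move=> af; rewrite !intGammaE //; last exact: admissible_Z.
case: af => [K [m [f1 f2 f3]]].
rewrite (pint_Z (ray_ok delta0 n0) t c f1) (pint_Z (upper_arc_ok delta0 n) t c f2).
rewrite (pint_Z (lower_arc_ok delta0 n) t c f3); ring.
Qed.

Lemma eq_intGamma t f g : (forall z, on_Gamma z -> f z = g z) ->
  intGamma delta n alpha t f = intGamma delta n alpha t g.
Proof.
move=> fg; rewrite /intGamma; congr (_ - _ + _); apply: eq_intC => x Dx /=.
- by rewrite fg //; exact: ray_on.
- by rewrite fg //; exact: up_on.
- by rewrite fg //; exact: dn_on.
Qed.

Lemma eq_admissible f g : (forall z, on_Gamma z -> f z = g z) ->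
  admissible f -> admissible g.
Proof.
move=> fg [K [m [f1 f2 f3]]]; exists K, m.
have key k a : arc_ok n k a -> (forall x, adom a x -> on_Gamma (apar a x)) ->
    tame n a f K m -> tame n a g K m.
  move=> ok aon [cf bf]; split=> [x Dx|x Dx]; last first.
    by rewrite -fg; [exact: bf|exact: aon].
  rewrite -(fg _ (aon _ Dx)); apply: near_cvgC (cf x Dx).
  have nD : \forall u \near x, adom a u.
    by apply: open_nbhs_nbhs; split => //; exact: arc_open ok.
  by apply: filterS nD => u /aon /fg.
split.
- exact: key (ray_ok delta0 n0) ray_on f1.
- exact: key (upper_arc_ok delta0 n) up_on f2.
- exact: key (lower_arc_ok delta0 n) dn_on f3.
Qed.

Lemma admissible0 : admissible (fun=> 0).
Proof.
exists 0, 0%N; apply: (@tameG_intro _ (fun=> 0)).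
  by move=> g x dg _ _; rewrite mul0r; exact: is_derC_cst.
by move=> z _; rewrite absC0 !mul0r.
Qed.

Lemma intGamma0 t : intGamma delta n alpha t (fun=> 0) = 0.
Proof.
have ad := admissible0.
by rewrite -[X in intGamma _ _ _ _ X](_ : (fun=> 0 * 0) = _) ?intGamma_Z ?mul0r //; apply/funext => z; rewrite mul0r.
Qed.

Lemma admissible_sum (I : Type) (r : seq I) (P : pred I) (f : I -> R[i] -> R[i]) :
  (forall i, P i -> admissible (f i)) ->
  admissible (fun z => \sum_(i <- r | P i) f i z).
Proof.
move=> H; elim: r => [|i r IH].
  by under eq_fun do rewrite big_nil; exact: admissible0.
under eq_fun do rewrite big_cons.
by case Pi: (P i) => //; apply: admissible_D => //; exact: H.
Qed.

Lemma intGamma_sum t (I : Type) (r : seq I) (P : pred I) (f : I -> R[i] -> R[i]) :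
  (forall i, P i -> admissible (f i)) ->
  intGamma delta n alpha t (fun z => \sum_(i <- r | P i) f i z) =
  \sum_(i <- r | P i) intGamma delta n alpha t (f i).
Proof.
move=> H; elim: r => [|i r IH].
  by rewrite big_nil; under eq_fun do rewrite big_nil; exact: intGamma0.
rewrite big_cons; under eq_fun do rewrite big_cons.
case Pi: (P i) => //; rewrite intGamma_D ?IH //; first exact: H.
exact: admissible_sum.
Qed.

(** The constant does not depend on [f], so that families of integrands depending
   on a spectral parameter are bounded uniformly. *)
Lemma intGamma_bound t m : exists2 C : R, 0 <= C &
  forall f K, tameG f K m -> absC (intGamma delta n alpha t f) <= C * K.
Proof.
have [C1 C10 H1] := pint_bound (ray_ok delta0 n0) t m.
have [C2 C20 H2] := pint_bound (upper_arc_ok delta0 n) t m.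
have [C3 C30 H3] := pint_bound (lower_arc_ok delta0 n) t m.
exists (C1 + absC alpha * C2 + absC (1 - alpha) * C3).
  by rewrite !addr_ge0 // mulr_ge0.
move=> f K tf; rewrite intGammaE; last by exists K, m.
case: tf => f1 f2 f3; rewrite [leRHS]mulrDl [X in _ <= X + _]mulrDl.
apply: le_trans (ler_absCD _ _) _; apply: lerD.
  apply: le_trans (ler_absCD _ _) _; apply: lerD; first exact: H1.
  by rewrite absCN absCM -mulrA ler_wpM2l // H2.
by rewrite absCM -mulrA ler_wpM2l // H3.
Qed.

Lemma intGamma_cvg0 f : admissible f ->
  cvgC (nbhs (0 : R)) (fun t => intGamma delta n alpha t f)
    (intGamma delta n alpha 0 f).
Proof.
move=> af; rewrite intGammaE //; under eq_fun do rewrite intGammaE //.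
have [K [m [/tame_weaken/(_ (leqnn m)) f1 /tame_weaken/(_ (leqnn m)) f2
  /tame_weaken/(_ (leqnn m)) f3]]] := af.
have K0 : 0 <= 2 * `|K| by rewrite mulr_ge0.
apply: cvgC_D; last apply: cvgC_M; last 2 first.
- exact: cvgC_cst.
- exact: (pint_cvg0 (lower_arc_ok delta0 n) K0 f3).
apply: cvgC_B; last apply: cvgC_M; last 2 first.
- exact: cvgC_cst.
- exact: (pint_cvg0 (upper_arc_ok delta0 n) K0 f2).
exact: (pint_cvg0 (ray_ok delta0 n0) K0 f1).
Qed.

(** The fundamental theorem of calculus on the contour: the contributions of the
   three arcs at their common end point cancel since [c_2 + c_3 = c_1]. *)
Lemma intGamma_FTC t (f F : R[i] -> R[i]) (A : R[i]) : admissible f ->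
  (forall (g : R -> R[i]) (x : R) dg, on_Gamma (g x) -> is_derC g x dg ->
    is_derC (fun u => F (g u)) x (f (g x) * weight n 1 t (g x) * dg)) ->
  (forall (g : R -> R[i]) (x : R) dg, g x = (2 * delta)%:C -> is_derC g x dg ->
    exists l, is_derC (fun u => F (g u)) x l) ->
  cvgC pi^'- (fun u => F (circ delta u)) A ->
  cvgC (- pi)^'+ (fun u => F (circ delta u)) A ->
  cvgC +oo (fun x : R => F x%:C) 0 ->
  intGamma delta n alpha t f = - A.
Proof.
move=> af dF d2 FA1 FA2 Foo; rewrite intGammaE //.
case: af => [K [m [f1 f2 f3]]].
pose B := F (2 * delta)%:C.
have c0 : cvgC (nbhs (0 : R)) (fun u => F (circ delta u)) B.
  have [l Hl] := d2 _ _ _ (circ_0 delta) (is_derC_circ delta 0).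
  by have := is_derC_cvg Hl; rewrite circ_0.
have c2 : cvgC (nbhs (2 * delta)) (fun x : R => F x%:C) B.
  have [l Hl] := d2 (real_complex R) (2 * delta) _ erefl (is_derC_id _).
  exact: is_derC_cvg Hl.
have -> : pint n (ray delta) t f = 0 - B.
  apply: (@FTC_oy _ (2 * delta) (fun x : R => F x%:C)).
  - move=> x xd; apply: dF; last exact: is_derC_id.
    by left; exists x.
  - exact: (tame_continuous (ray_ok delta0 n0) t f1).
  - exact: (tame_integrable (ray_ok delta0 n0) t f1).
  - by case: c2 => c21 c22; split; exact: cvg_at_right_filter.
  - exact: Foo.
have -> : pint n (upper_arc delta) t f = A - B.
  apply: (@FTC_oo _ 0 pi (fun x : R => F (circ delta x))).
  - exact: pi_gt0.
  - move=> x x0p; apply: dF; last exact: is_derC_circ.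
    by apply: up_on; rewrite /= in_itv.
  - exact: (tame_continuous (upper_arc_ok delta0 n) t f2).
  - exact: (tame_integrable (upper_arc_ok delta0 n) t f2).
  - by case: c0 => c01 c02; split; exact: cvg_at_right_filter.
  - exact: FA1.
have -> : pint n (lower_arc delta) t f = B - A.
  apply: (@FTC_oo _ (- pi) 0 (fun x : R => F (circ delta x))).
  - by rewrite oppr_lt0 pi_gt0.
  - move=> x x0p; apply: dF; last exact: is_derC_circ.
    by apply: dn_on; rewrite /= in_itv.
  - exact: (tame_continuous (lower_arc_ok delta0 n) t f3).
  - exact: (tame_integrable (lower_arc_ok delta0 n) t f3).
  - exact: FA2.
  - by case: c0 => c01 c02; split; exact: cvg_at_left_filter.
ring.
Qed.

(** Integration by parts, where the factor of [f] is the logarithmic derivative of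
   the weight; the bound on [f] makes the boundary terms vanish. *)
Lemma intGamma_ibp t (f f1 : R[i] -> R[i]) (K : R) (m : nat) :
  curve_diff (fun z => on_Gamma z \/ z = (2 * delta)%:C) f f1 ->
  admissible (fun z => f1 z + f z * (n%:R / z - n%:R + n%:R * t%:C / z ^+ 2)) ->
  (forall z, on_Gamma z -> absC (f z) * absC z ^+ n <= K * absC z * (1 + absC z ^+ m)) ->
  intGamma delta n alpha t
    (fun z => f1 z + f z * (n%:R / z - n%:R + n%:R * t%:C / z ^+ 2)) = 0.
Proof.
move=> cd ad bd; rewrite -[RHS]oppr0.
have d2 : 0 < 2 * delta by rewrite mulr_gt0.
have dF (g : R -> R[i]) (x : R) dg : (on_Gamma (g x) \/ g x = (2 * delta)%:C) ->
    is_derC g x dg -> is_derC (fun u => f (g u) * weight n 1 t (g u)) x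
      ((f1 (g x) + f (g x) * (n%:R / g x - n%:R + n%:R * t%:C / g x ^+ 2)) *
       weight n 1 t (g x) * dg).
  move=> Hg dg'; have z0 : g x != 0.
    case: Hg => [|->]; first exact: on_Gamma_neq0.
    by rewrite eq_complex /= eqxx andbT gt_eqF.
  apply: (is_derC_eq (is_derC_M (cd _ _ _ Hg dg') (weight_derC n t z0 dg'))).
  ring.
have K0 : 0 <= K.
  have Hx : on_Gamma (3 * delta)%:C by left; exists (3 * delta) => //; rewrite ltr_pM2r // ltr_nat.
  have := bd _ Hx; apply: contraTT; rewrite -!ltNge => Kn.
  apply: (@lt_le_trans _ _ 0); last by rewrite mulr_ge0 // exprn_ge0.
  rewrite pmulr_llt0; last by rewrite ltr_wpDr // exprn_ge0.
  by rewrite nmulr_rlt0 // absC_gt0 on_Gamma_neq0.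
pose E := expR (n%:R * `|t| * (2 * delta)^-1).
have circ_bd (theta : R) : - pi < theta < pi -> theta != 0 ->
    absC (f (circ delta theta) * weight n 1 t (circ delta theta)) <=
    K * (1 + (2 * delta) ^+ m) * E * absC (circ delta theta).
  move=> th th0; have Hon : on_Gamma (circ delta theta) by right; exists theta.
  have ok := circ_arc_ok delta0 n (lexx (- pi)) (lexx pi)
    (lt_trans (_ : - pi < 0) (pi_gt0 R)).
  have W := @absC_weight_le _ n _ _ (ok _) t theta.
  rewrite absCM; apply: le_trans (ler_wpM2l (absC_ge0 _) (W _ _)) _.
  - by rewrite oppr_lt0 pi_gt0.
  - by rewrite /= in_itv.
  - have E0 : 0 <= E by exact: expR_ge0.
    have F1 : expR (- n%:R * complex.Re (circ delta theta)) <= 1.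
      by rewrite expR_le1 mulNr oppr_le0 mulr_ge0 // ltW // Re_circ.
    apply: (@le_trans _ _ (absC (f (circ delta theta)) * absC (circ delta theta) ^+ n * E)).
      rewrite -[leRHS]mulrA ler_wpM2l // ler_wpM2r // ler_piMr //.
      exact: exprn_ge0.
    rewrite [leRHS]mulrAC ler_wpM2r //; apply: le_trans (bd _ Hon) _.
    rewrite [leRHS]mulrAC ler_wpM2l ?mulr_ge0 // lerD2l lerXn2r ?nnegrE //.
      exact: ltW.
    exact: absC_circ_le.
have to0 (F : set_system R) : Filter F ->
    cvgC F (circ delta) 0 -> (\forall u \near F, - pi < u < pi /\ u != 0) ->
    cvgC F (fun u => f (circ delta u) * weight n 1 t (circ delta u)) 0.
  move=> FF /cvgC_abs; rewrite absC0 => c0 nr; apply/cvgC_absP.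
  apply: (@near_le_cvg0 _ _ _ _ _ (fun u => K * (1 + (2 * delta) ^+ m) * E * absC (circ delta u))).
    by apply: filterS nr => u [u1 u2]; rewrite subr0 ger0_norm // circ_bd.
  by rewrite -[X in _ --> X](mulr0 (K * (1 + (2 * delta) ^+ m) * E)); apply: cvgM => //; exact: cvg_cst.
apply: (@intGamma_FTC t _ (fun z => f z * weight n 1 t z)) => //.
- by move=> g x dg Hg; apply: dF; left.
- by move=> g x dg Hg dg'; eexists; apply: dF dg'; right.
- apply: to0.
    have [c1 c2] := is_derC_cvg (is_derC_circ delta pi); rewrite circ_pi in c1 c2.
    by split; exact: cvg_at_left_filter.
  near=> u.
  have up : u < pi by near: u; exact: nbhs_left_lt.
  have u0 : 0 < u by near: u; apply: nbhs_left_gt; exact: pi_gt0.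
  by rewrite up gt_eqF //; split => //; rewrite andbT (lt_trans _ u0) // oppr_lt0 pi_gt0.
- apply: to0.
    have [c1 c2] := is_derC_cvg (is_derC_circ delta (- pi)); rewrite circ_Npi in c1 c2.
    by split; exact: cvg_at_right_filter.
  near=> u.
  have up : - pi < u by near: u; exact: nbhs_right_gt.
  have u0 : u < 0 by near: u; apply: nbhs_right_lt; rewrite oppr_lt0 pi_gt0.
  by rewrite up lt_eqF //; split => //=; rewrite (lt_trans u0) // pi_gt0.
- apply/cvgC_absP.
  have n2 : 0 < n%:R / 2 :> R by rewrite divr_gt0 // ltr0n.
  pose M (k : nat) : R := k`!%:R / (n%:R / 2) ^+ k.
  apply: (@near_le_cvg0 _ _ _ _ _ (fun x => K * E * (M 1%N + M m.+1) * expR (- (n%:R / 2) * x))); last first.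
    rewrite -[X in _ --> X](mulr0 (K * E * (M 1%N + M m.+1))); apply: cvgM; first exact: cvg_cst.
    under eq_fun do rewrite mulNr.
    apply: (cvg_comp (fun x => n%:R / 2 * x) (fun x => expR (- x))); last exact: cvgr_expR.
    by apply: gt0_cvgMry.
  near=> x.
  have xd : 2 * delta < x by near: x; apply: nbhs_pinfty_gt; exact: num_real.
  have x0 : 0 <= x by rewrite ltW // (lt_trans d2).
  have Hon : on_Gamma x%:C by left; exists x.
  rewrite subr0 ger0_norm // absCM.
  have W := @absC_weight_le _ n _ _ (ray_ok delta0 n0) t x.
  apply: le_trans (ler_wpM2l (absC_ge0 _) (W _)) _; first by rewrite /= in_itv /= andbT.
  have E0 : 0 <= E by exact: expR_ge0.
  have nx : absC x%:C = x by rewrite absCR ger0_norm.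
  have := bd _ Hon; rewrite [apar (ray delta) x]/(x%:C) nx -/E => Hb.
  apply: (@le_trans _ _ (K * x * (1 + x ^+ m) * expR (- n%:R * x) * E)).
    by rewrite !mulrA ler_wpM2r // ler_wpM2r ?expR_ge0.
  have -> : K * x * (1 + x ^+ m) * expR (- n%:R * x) * E =
    K * E * (x ^+ 1 * expR (- n%:R * x) + x ^+ m.+1 * expR (- n%:R * x)).
    by rewrite expr1 exprS; ring.
  rewrite -[leRHS]mulrA ler_wpM2l ?mulr_ge0 // mulrDl.
  by apply: lerD; exact: pow_expRN_le.
Unshelve. all: by end_near. Qed.

End GammaIntegral.

(** * Moments and Cauchy integrals of the weight *)

Section CurveDiff.
Context {R : realType} (S : R[i] -> Prop).
Implicit Types f : R[i] -> R[i].

Lemma curve_diff_id : curve_diff S id (fun=> 1).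
Proof. by move=> g x dg _ H; rewrite mul1r. Qed.

Lemma curve_diff_cst c : curve_diff S (fun=> c) (fun=> 0).
Proof. by move=> g x dg _ _; rewrite mul0r; exact: is_derC_cst. Qed.

Lemma curve_diff_D f1 f2 d1 d2 : curve_diff S f1 d1 -> curve_diff S f2 d2 ->
  curve_diff S (fun z => f1 z + f2 z) (fun z => d1 z + d2 z).
Proof.
move=> H1 H2 g x dg Sx H; apply: is_derC_eq (is_derC_D (H1 _ _ _ Sx H) (H2 _ _ _ Sx H)) _.
by rewrite mulrDl.
Qed.

Lemma curve_diff_M f1 f2 d1 d2 : curve_diff S f1 d1 -> curve_diff S f2 d2 ->
  curve_diff S (fun z => f1 z * f2 z) (fun z => d1 z * f2 z + f1 z * d2 z).
Proof.
move=> H1 H2 g x dg Sx H; apply: is_derC_eq (is_derC_M (H1 _ _ _ Sx H) (H2 _ _ _ Sx H)) _.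
ring.
Qed.

Lemma curve_diff_X f1 d1 k : curve_diff S f1 d1 ->
  curve_diff S (fun z => f1 z ^+ k) (fun z => k%:R * f1 z ^+ k.-1 * d1 z).
Proof.
move=> H1 g x dg Sx H; apply: is_derC_eq (is_derC_X k (H1 _ _ _ Sx H)) _.
by rewrite mulrA.
Qed.

Lemma curve_diff_V f1 d1 : (forall z, S z -> f1 z != 0) -> curve_diff S f1 d1 ->
  curve_diff S (fun z => (f1 z)^-1) (fun z => - d1 z / f1 z ^+ 2).
Proof.
move=> n0 H1 g x dg Sx H; apply: is_derC_eq (is_derC_V (n0 _ Sx) (H1 _ _ _ Sx H)) _.
ring.
Qed.

Lemma curve_diff_N f1 d1 : curve_diff S f1 d1 ->
  curve_diff S (fun z => - f1 z) (fun z => - d1 z).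
Proof.
move=> H1 g x dg Sx H; apply: is_derC_eq (is_derC_N (H1 _ _ _ Sx H)) _.
by rewrite mulNr.
Qed.

Lemma curve_diff_exp f1 d1 : curve_diff S f1 d1 ->
  curve_diff S (fun z => expC (f1 z)) (fun z => d1 z * expC (f1 z)).
Proof.
move=> H1 g x dg Sx H; apply: is_derC_eq (is_derC_expC (H1 _ _ _ Sx H)) _.
ring.
Qed.

Lemma eq_curve_diff f1 d1 d2 : (forall z, S z -> d1 z = d2 z) ->
  curve_diff S f1 d1 -> curve_diff S f1 d2.
Proof. by move=> E H g x dg Sx Hg; rewrite -E //; exact: H. Qed.

End CurveDiff.

Section ExpBounds.
Context {R : realType}.
Implicit Types w : R[i].

(** Only the real part enters the exponential of the bound.  On the contour the real
   part of [1/z] is bounded while its modulus is not, so this is what allows the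
   factor [exp (- n t / z)] to be differentiated under the integral. *)
Lemma expC_quad w : absC (expC w - 1 - w) <= 2 * absC w ^+ 2 * expR `|complex.Re w|.
Proof.
pose E := expR `|complex.Re w|.
have dexp (u : R) : is_derC (fun u : R => expC (w * u%:C)) u (w * expC (w * u%:C)).
  apply: (is_derC_eq (is_derC_expC (is_derC_Z w (is_derC_id u)))).
  by rewrite mulr1.
have bexp (u : R) : `|u - 0| <= `|1 - 0| -> absC (expC (w * u%:C)) <= E.
  rewrite !subr0 normr1 => u1; rewrite absC_expC ler_expR mulrC Re_realM.
  apply: le_trans (ler_norm _) _; rewrite normrM ler_piMl //.
have b1 (u : R) : `|u - 0| <= `|1 - 0| -> absC (expC (w * u%:C) - 1) <= 2 * (absC w * E) * `|u - 0|.
  move=> u1; have := @derC_pow_bound R (fun u : R => expC (w * u%:C) - 1)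
    (fun u => w * expC (w * u%:C)) 0 u (absC w * E) 0.
  rewrite expr1 divr1; apply.
  - move=> v _; rewrite -[X in is_derC _ _ X]subr0; apply: is_derC_B => //.
    exact: is_derC_cst.
  - by rewrite mulr0 expC0 subrr.
  - move=> v vu; rewrite expr0 mulr1 absCM ler_wpM2l // bexp //.
    exact: le_trans u1.
have := @derC_pow_bound R (fun u : R => expC (w * u%:C) - 1 - w * u%:C)
    (fun u => w * (expC (w * u%:C) - 1)) 0 1 (2 * absC w ^+ 2 * E) 1.
rewrite subr0 normr1 expr1n !mulr1 => H; apply: le_trans (H _ _ _) _.
- move=> u _; have D1 := is_derC_B (dexp u) (is_derC_cst u 1).
  have D2 := is_derC_Z w (is_derC_id u).
  apply: (is_derC_eq (is_derC_B D1 D2)); ring.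
- by rewrite mulr0 expC0 !subrr.
- move=> u u1; rewrite absCM; have := b1 u; rewrite !subr0 normr1 in u1 * => /(_ u1) Hb.
  apply: le_trans (ler_wpM2l (absC_ge0 w) Hb) _.
  by rewrite expr1 expr2 le_eqVlt; apply/orP; left; apply/eqP; ring.
- by rewrite le_eqVlt; apply/orP; left; apply/eqP; rewrite /E; field.
Qed.

End ExpBounds.

Section Moments.
Context {R : realType} (delta : R) (n : nat) (alpha : R[i]).
Hypothesis delta0 : 0 < delta.
Hypothesis n0 : (0 < n)%N.
Local Notation on_G := (on_Gamma delta).
Local Notation adm := (admissible delta n).
Local Notation I := (intGamma delta n alpha).

Let on_G_neq0 z : on_G z -> z != 0. Proof. exact: on_Gamma_neq0. Qed.

Lemma on_Gamma_inv z : on_G z -> 0 <= complex.Re z^-1 <= (2 * delta)^-1.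
Proof.
have d2 : 0 < 2 * delta by rewrite mulr_gt0.
case=> [[x xd ->]|[theta th [_ ->]]].
  apply: (arc_inv (ray_ok delta0 n0)).
  by rewrite /= in_itv /= andbT.
by rewrite Re_circV // lexx invr_ge0 ltW.
Qed.

Definition away (z0 : R[i]) (d : R) : Prop :=
  0 < d /\ forall z, on_G z -> d <= absC (z - z0).

Lemma away_neq z0 d z : away z0 d -> on_G z \/ z = (2 * delta)%:C -> z - z0 != 0.
Proof.
move=> [d0 aw] [/aw|->]; first by rewrite -absC_gt0; exact: lt_le_trans.
apply/eqP => E; have Hon : on_G (2 * delta + d / 2)%:C.
  by left; exists (2 * delta + d / 2) => //; rewrite ltrDl divr_gt0.
have := aw _ Hon; rewrite rmorphD /= addrAC E add0r absCR ger0_norm; last by rewrite divr_ge0 // ltW.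
by rewrite leNgt ltr_pdivrMr // ltr_pMr // ltr1n.
Qed.

Definition cauchy_mono (z0 : R[i]) (j i : nat) (z : R[i]) : R[i] :=
  z ^+ j / (z - z0) ^+ i.

Lemma cauchy_mono_diff S z0 j i : (forall z, S z -> z - z0 != 0) ->
  curve_diff S (cauchy_mono z0 j i) (fun z =>
    j%:R * z ^+ j.-1 / (z - z0) ^+ i - i%:R * z ^+ j / (z - z0) ^+ i.+1).
Proof.
move=> n00; have D0 := @curve_diff_id _ S.
have D1 : curve_diff S (fun z => z ^+ j) (fun z => j%:R * z ^+ j.-1 * 1) := curve_diff_X j D0.
have D2 : curve_diff S (fun z => z - z0) (fun=> 1 + 0) := curve_diff_D D0 (@curve_diff_cst _ S (- z0)).
have n0' z : S z -> (z - z0) ^+ i != 0 by move=> /n00 z0'; rewrite expf_neq0.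
apply: (eq_curve_diff _ (curve_diff_M D1 (curve_diff_V n0' (curve_diff_X i D2)))).
move=> z /n00 z0' /=; rewrite mulr1 addr0 mulr1.
case: i {n0'} => [|i]; first by rewrite /= !mul0r oppr0 mul0r mulr0; ring.
by rewrite /= !exprS; field; rewrite expf_neq0 // z0'.
Qed.

Let pow_inv_le (d x : R) (i : nat) : 0 < d -> d <= x -> (x ^+ i)^-1 <= (d ^+ i)^-1.
Proof.
move=> d0 dx; have x0 := lt_le_trans d0 dx.
by rewrite lef_pV2 ?posrE ?exprn_gt0 // lerXn2r ?nnegrE // ltW.
Qed.

Let pow_le1 (x : R) (k : nat) : 0 <= x -> x ^+ k <= 1 + x ^+ k.
Proof. by move=> _; rewrite lerDr. Qed.

Lemma cauchy_mono_tame z0 d j i : away z0 d ->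
  tameG delta n (cauchy_mono z0 j i) (d ^-1 ^+ i) (j + n).
Proof.
move=> aw; have [d0 aw'] := aw; apply: (tameG_intro delta0 n0).
  by apply: cauchy_mono_diff => z Hz; apply: (away_neq aw); left.
move=> z Hz; rewrite /cauchy_mono absCM absCV !absCX mulrAC -exprD mulrC exprVn.
apply: ler_pM; rewrite ?invr_ge0 ?exprn_ge0 //.
- by apply: pow_inv_le => //; exact: aw'.
- exact: pow_le1.
Qed.

Lemma cauchy_mono_adm z0 d j i : away z0 d -> adm (cauchy_mono z0 j i).
Proof. by move=> aw; do 2 eexists; exact: (cauchy_mono_tame j i aw). Qed.

(** The zero of order [n] of the weight pays for [l <= n] powers of [1/z]. *)
Lemma laurent_adm k l : (l <= n)%N -> adm (fun z => z ^+ k / z ^+ l).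
Proof.
move=> ln; exists 1, (k + (n - l))%N; apply: (tameG_intro delta0 n0).
  apply: curve_diff_M (curve_diff_X k (@curve_diff_id _ _)) (curve_diff_V _
    (curve_diff_X l (@curve_diff_id _ _))).
  by move=> z /on_G_neq0 z0; rewrite expf_neq0.
move=> z /on_G_neq0; rewrite -absC_gt0 => z0; rewrite absCM absCV !absCX mul1r.
rewrite -{1}(subnK ln) exprD.
have -> : absC z ^+ k / absC z ^+ l * (absC z ^+ (n - l) * absC z ^+ l) =
   absC z ^+ (k + (n - l)).
  by rewrite exprD; field; rewrite expf_neq0 // gt_eqF.
exact/pow_le1/ltW.
Qed.

(** The moment of order [J - 1]: the index is shifted because the moment of order
   [-1] also occurs in the recursion and in the derivative of the lowest moment. *)
Definition mu (t : R) (J : nat) : R[i] := I t (fun z => z ^+ J / z).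

Lemma mu_adm J : adm (fun z => z ^+ J / z).
Proof.
by apply: eq_admissible (laurent_adm J n0) => // z _; rewrite expr1.
Qed.

Lemma momentE t j : moment delta n alpha t j = mu t j.+1.
Proof.
by apply: eq_intGamma => z /on_G_neq0 z0; rewrite exprSr mulfK.
Qed.

Lemma pow_adm j : adm (fun z => z ^+ j).
Proof.
apply: eq_admissible (mu_adm j.+1) => // z /on_G_neq0 z0.
by rewrite exprSr mulfK.
Qed.

(** Integration by parts with [f = z ^ (J + 1)]. *)
Lemma mu_rec t J : (J.+1 + n)%:R * mu t J.+1 - n%:R * mu t J.+2 +
  n%:R * t%:C * mu t J = 0.
Proof.
have a1 := admissible_Z (J.+1 + n)%:R (mu_adm J.+1).
have a2 := admissible_Z (- n%:R) (mu_adm J.+2).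
have a3 := admissible_Z (n%:R * t%:C) (mu_adm J).
pose f1 (z : R[i]) : R[i] := J.+1%:R * z ^+ J.
have E z : on_G z -> (J.+1 + n)%:R * (z ^+ J.+1 / z) + - n%:R * (z ^+ J.+2 / z)
    + n%:R * t%:C * (z ^+ J / z) =
    f1 z + z ^+ J.+1 * (n%:R / z - n%:R + n%:R * t%:C / z ^+ 2).
  by move=> /on_G_neq0 z0; rewrite /f1 !exprS natrD; field.
have := @intGamma_ibp _ delta n alpha delta0 n0 t (fun z => z ^+ J.+1) f1 1 (J + n).
rewrite -(eq_intGamma _ _ _ E) intGamma_D //; last exact: admissible_D.
rewrite intGamma_D // !intGamma_Z ?mulNr //; try exact: mu_adm.
apply.
- apply: (eq_curve_diff _ (curve_diff_X J.+1 (@curve_diff_id _ _))).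
  by move=> z _; rewrite mulr1.
- by apply: eq_admissible (admissible_D (admissible_D a1 a2) a3).
- move=> z Hz; rewrite absCX mul1r -exprD addSn exprS ler_wpM2l //.
  exact: pow_le1.
Qed.

Definition cauchy_mu (t : R) (z0 : R[i]) (j i : nat) : R[i] :=
  I t (cauchy_mono z0 j i).

(** Integration by parts with [f = z ^ (j + 2) / (z - z0) ^ i]. *)
Lemma cauchy_mu_rec t z0 d j i : away z0 d ->
  n%:R * t%:C * cauchy_mu t z0 j i = n%:R * cauchy_mu t z0 j.+2 i
    + i%:R * cauchy_mu t z0 j.+2 i.+1 - (j.+2 + n)%:R * cauchy_mu t z0 j.+1 i.
Proof.
move=> aw; have [d0 aw'] := aw.
have a1 := admissible_Z (j.+2 + n)%:R (cauchy_mono_adm j.+1 i aw).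
have a2 := admissible_Z (- n%:R) (cauchy_mono_adm j.+2 i aw).
have a3 := admissible_Z (- i%:R) (cauchy_mono_adm j.+2 i.+1 aw).
have a4 := admissible_Z (n%:R * t%:C) (cauchy_mono_adm j i aw).
pose f1 (z : R[i]) : R[i] := j.+2%:R * z ^+ j.+1 / (z - z0) ^+ i -
  i%:R * z ^+ j.+2 / (z - z0) ^+ i.+1.
have E z : on_G z -> ((j.+2 + n)%:R * cauchy_mono z0 j.+1 i z +
    - n%:R * cauchy_mono z0 j.+2 i z) +
    (- i%:R * cauchy_mono z0 j.+2 i.+1 z + n%:R * t%:C * cauchy_mono z0 j i z) =
    f1 z + cauchy_mono z0 j.+2 i z * (n%:R / z - n%:R + n%:R * t%:C / z ^+ 2).
  move=> Hz; have z00 := on_G_neq0 Hz; have zz0 := away_neq aw (or_introl Hz).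
  rewrite /f1 /cauchy_mono !exprS natrD; field.
  by rewrite z00 expf_neq0 // zz0.
have := @intGamma_ibp _ delta n alpha delta0 n0 t (cauchy_mono z0 j.+2 i) f1
  (d^-1 ^+ i) (j.+1 + n).
rewrite -(eq_intGamma _ _ _ E) intGamma_D //; try exact: admissible_D.
rewrite 2?intGamma_D // !intGamma_Z //; try exact: cauchy_mono_adm aw.
move=> H; apply/eqP; rewrite -subr_eq0 -oppr_eq0; apply/eqP.
rewrite -/(cauchy_mu t z0 j i) -/(cauchy_mu t z0 j.+1 i) -/(cauchy_mu t z0 j.+2 i)
  -/(cauchy_mu t z0 j.+2 i.+1) in H.
rewrite -[RHS]oppr0 -H; first ring.
- by apply: cauchy_mono_diff => z Hz; apply: (away_neq aw).
- by apply: eq_admissible (admissible_D (admissible_D a1 a2) (admissible_D a3 a4)) => //.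
- move=> z Hz; rewrite /cauchy_mono absCM absCV !absCX mulrAC -exprD mulrC exprVn.
  rewrite -mulrA; apply: ler_pM; rewrite ?invr_ge0 ?exprn_ge0 //.
    by apply: pow_inv_le => //; exact: aw'.
  by rewrite addSn exprS ler_wpM2l // pow_le1.
Qed.

(** Moving the parameter out of the weight compares different values of [t]
   under the same integral. *)
Lemma intGamma_shift t t0 f : I t f =
  I t0 (fun z => f z * expC (- (n%:R * (t - t0)%:C) / z)).
Proof.
have key c z : on_G z -> f z * weight n c t z =
    f z * expC (- (n%:R * (t - t0)%:C) / z) * weight n c t0 z.
  move=> /on_G_neq0 z0; rewrite !weightE //.
  have -> : - (n%:R * t%:C / z) = - (n%:R * (t - t0)%:C) / z + - (n%:R * t0%:C / z).
    by rewrite rmorphB /=; ring.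
  by rewrite expCD; ring.
rewrite /intGamma; apply: (f_equal2 +%R); [apply: (f_equal2 +%R); [|apply: (f_equal -%R)]|];
  apply: eq_intC => x Dx.
- by apply: key; left; exists x => //; move: Dx; rewrite /= in_itv /= andbT.
- rewrite /= key //; right; exists x; move: Dx; rewrite /= in_itv /= => /andP[h1 h2].
    by rewrite h2 andbT (lt_trans _ h1) // oppr_lt0 pi_gt0.
  by rewrite gt_eqF.
- rewrite /= key //; right; exists x; move: Dx; rewrite /= in_itv /= => /andP[h1 h2].
    by rewrite h1 (lt_trans h2) // pi_gt0.
  by rewrite lt_eqF.
Qed.

(** The remainder of order two of the exponential costs two powers of [1/z],
   for which this range of indices leaves room. *)
Lemma is_derC_mu2 (t0 : R) J : is_derC (mu^~ J.+2) t0 (- n%:R * mu t0 J.+1).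
Proof.
have [C C0 HC] := @intGamma_bound _ delta n alpha delta0 n0 t0 (J + n.-1).
pose kap := (2 * delta)^-1.
have kap0 : 0 <= kap by rewrite invr_ge0 mulr_ge0 // ltW.
apply: (@is_derC_quad _ _ t0 1 (C * (2 * n%:R ^+ 2 * expR (n%:R * kap)))) => // t t1.
pose w (z : R[i]) := - (n%:R * (t - t0)%:C) / z.
pose f (z : R[i]) := z ^+ J.+1 * (expC (w z) - 1 - w z).
have tf : tameG delta n f (2 * n%:R ^+ 2 * expR (n%:R * kap) * `|t - t0| ^+ 2) (J + n.-1).
  apply: (tameG_intro delta0 n0).
    have D0 := @curve_diff_id _ on_G.
    have DV : curve_diff on_G (fun z => z^-1) (fun z => - 1 / z ^+ 2) := curve_diff_V on_G_neq0 D0.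
    have cw := curve_diff_M (@curve_diff_cst _ on_G (- (n%:R * (t - t0)%:C))) DV.
    exact: (curve_diff_M (curve_diff_X J.+1 D0) (curve_diff_D (curve_diff_D
      (curve_diff_exp cw) (@curve_diff_cst _ on_G (-1))) (curve_diff_N cw))).
  move=> z Hz; have z0 := on_G_neq0 Hz.
  have /andP[i0 ik] := on_Gamma_inv Hz.
  have za : 0 < absC z by rewrite absC_gt0.
  have wa : absC (w z) = n%:R * `|t - t0| / absC z.
    by rewrite /w absCM absCN absCM absC_nat absCR absCV.
  have wr : `|complex.Re (w z)| <= n%:R * kap.
    rewrite /w natCR -rmorphM -rmorphN Re_realM normrM normrN normrM (ger0_norm (ler0n _ n)).
    rewrite (ger0_norm i0) -mulrA ler_wpM2l //.
    by apply: le_trans ik; rewrite ler_piMl // ltW.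
  rewrite /f absCM absCX.
  apply: (@le_trans _ _ (absC z ^+ J.+1 * (2 * absC (w z) ^+ 2 * expR (n%:R * kap)) * absC z ^+ n)).
    rewrite ler_wpM2r ?exprn_ge0 // ler_wpM2l ?exprn_ge0 //.
    apply: le_trans (expC_quad _) _; rewrite ler_wpM2l ?ler_expR //.
    by rewrite mulr_ge0 // exprn_ge0.
  have -> : absC z ^+ J.+1 * (2 * absC (w z) ^+ 2 * expR (n%:R * kap)) * absC z ^+ n =
    2 * n%:R ^+ 2 * expR (n%:R * kap) * `|t - t0| ^+ 2 * absC z ^+ (J + n.-1).
    have -> : absC z ^+ n = absC z * absC z ^+ n.-1 by rewrite -exprS prednK.
    rewrite wa exprD !exprS; field.
    by rewrite gt_eqF.
  by rewrite ler_wpM2l ?pow_le1 ?mulr_ge0 ?exprn_ge0 ?expR_ge0.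
have af : adm f by do 2 eexists; exact: tf.
have E z : on_G z -> z ^+ J.+2 / z * expC (w z) =
   f z + (z ^+ J.+2 / z + - (n%:R * (t - t0)%:C) * (z ^+ J.+1 / z)).
  by move=> /on_G_neq0 z0; rewrite /f /w !exprS; field.
have EI : mu t J.+2 = I t0 f + (mu t0 J.+2 + - (n%:R * (t - t0)%:C) * mu t0 J.+1).
  rewrite {1}/mu (intGamma_shift t t0) (eq_intGamma n alpha t0 E).
  rewrite !intGamma_D ?intGamma_Z //; try exact: mu_adm.
  - exact/admissible_Z/mu_adm.
  - by apply: admissible_D; [exact: mu_adm|exact/admissible_Z/mu_adm].
have -> : mu t J.+2 - mu t0 J.+2 - - n%:R * mu t0 J.+1 * (t - t0)%:C = I t0 f.
  by rewrite EI; move: (I t0 f) (mu t0 J.+2) (mu t0 J.+1) => a b c; ring.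
by rewrite -[leRHS]mulrA; exact: HC tf.
Qed.

(** For the lowest index the integrand is too singular to differentiate directly;
   the recursion expresses it by moments of higher order. *)
Lemma is_derC_mu (t0 : R) J : t0 != 0 -> is_derC (mu^~ J.+1) t0 (- n%:R * mu t0 J).
Proof.
case: J => [|J] t00; last exact: is_derC_mu2.
have nC : n%:R != 0 :> R[i] by rewrite pnatr_eq0 -lt0n.
have tC (u : R) : u != 0 -> u%:C != 0 by rewrite eq_complex /= eqxx andbT.
have E u : u != 0 -> mu u 1 = (n%:R * mu u 3 - (2 + n)%:R * mu u 2) / (n%:R * u%:C).
  move=> u0; apply: (mulIf (mulf_neq0 nC (tC _ u0))); rewrite divfK ?mulf_neq0 ?tC //.
  have := mu_rec u 1; move: (mu u 1) (mu u 2) (mu u 3) => m1 m2 m3 H.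
  by rewrite -[RHS]addr0 -H; ring.
have nr : \forall u \near t0, mu u 1 = (n%:R * mu u 3 - (2 + n)%:R * mu u 2) / (n%:R * u%:C).
  by near=> u; apply: E; near: u; apply: (cvgr_neq0 t0) => //; exact: cvg_id.
apply: (near_is_derC nr).
have D1 := is_derC_B (is_derC_Z n%:R (is_derC_mu2 t0 1)) (is_derC_Z (2 + n)%:R (is_derC_mu2 t0 0)).
have D2 := is_derC_V (mulf_neq0 nC (tC _ t00)) (is_derC_Z n%:R (is_derC_id t0)).
apply: (is_derC_eq (is_derC_M D1 D2)) => /=.
have r0 := mu_rec t0 0; have r1 := mu_rec t0 1.
have F0 : mu t0 0 = (n%:R * mu t0 2 - (1 + n)%:R * mu t0 1) / (n%:R * t0%:C).
  apply: (mulIf (mulf_neq0 nC (tC _ t00))); rewrite divfK ?mulf_neq0 ?tC //.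
  move: r0; move: (mu t0 0) (mu t0 1) (mu t0 2) => m0 m1 m2 r0.
  by rewrite -[RHS]addr0 -r0; ring.
have F3 : mu t0 3 = ((2 + n)%:R * mu t0 2 + n%:R * t0%:C * mu t0 1) / n%:R.
  apply: (mulIf nC); rewrite divfK //; move: r1.
  move: (mu t0 1) (mu t0 2) (mu t0 3) => m1 m2 m3 r1.
  by rewrite -[RHS]subr0 -r1; ring.
rewrite F0 F3 !natrD; move: (mu t0 1) (mu t0 2) => m1 m2; field.
by rewrite nC tC.
Unshelve. all: by end_near. Qed.

Lemma mu_cvg0 J : cvgC 0^'- (mu^~ J) (mu 0 J).
Proof.
have [H1 H2] := intGamma_cvg0 alpha delta0 n0 (mu_adm J).
by split; exact: cvg_at_left_filter.
Qed.

(** At [t = 0] the integrand [z ^ m * exp (- n z)] is entire, and integration by parts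
   lowers [m] until the primitive of an exponential remains. *)
Lemma gamma_moment m : I 0 (fun z => z ^+ m / z ^+ n) = m`!%:R / n%:R ^+ m.+1.
Proof.
have nC : n%:R != 0 :> R[i] by rewrite pnatr_eq0 -lt0n.
elim: m => [|m IH].
  rewrite fact0 expr1 mul1r -[RHS]opprK.
  pose F (z : R[i]) : R[i] := - (n%:R^-1 * expC (- n%:R * z)).
  have dF (g : R -> R[i]) (x : R) dg : is_derC g x dg ->
      is_derC (fun u => F (g u)) x (expC (- n%:R * g x) * dg).
    move=> H; apply: (is_derC_eq (is_derC_N (is_derC_Z n%:R^-1 (is_derC_expC (is_derC_Z (- n%:R) H))))).
    by field.
  have F0 : F 0 = - n%:R^-1 by rewrite /F mulr0 expC0 mulr1.
  apply: (@intGamma_FTC _ delta n alpha delta0 n0 0 _ F); rewrite -?F0.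
  - exact: laurent_adm.
  - move=> g x dg /on_G_neq0 z0 H; apply: (is_derC_eq (dF _ _ _ H)); congr (_ * _).
    rewrite weightE // mulr0 mul0r oppr0 expC0 expr0; field.
    by rewrite expf_neq0.
  - by move=> g x dg _ H; eexists; exact: dF H.
  - have [c1 c2] := is_derC_cvg (dF _ _ _ (is_derC_circ delta pi)).
    by rewrite circ_pi in c1 c2; split; exact: cvg_at_left_filter.
  - have [c1 c2] := is_derC_cvg (dF _ _ _ (is_derC_circ delta (- pi))).
    by rewrite circ_Npi in c1 c2; split; exact: cvg_at_right_filter.
  - apply/cvgC_absP.
    apply: (@near_le_cvg0 _ _ _ _ _ (fun x => n%:R^-1 * expR (- (n%:R * x)))).
      apply: nearW => x; rewrite subr0 ger0_norm // /F absCN absCM absCV absC_nat.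
      by rewrite absC_expC natCR -rmorphN Re_realM mulNr.
    rewrite -[X in _ --> X](mulr0 n%:R^-1); apply: cvgM; first exact: cvg_cst.
    apply: (cvg_comp (fun x : R => n%:R * x) (fun x => expR (- x))); last exact: cvgr_expR.
    by apply: gt0_cvgMry => //; rewrite ltr0n.
have a1 := admissible_Z m.+1%:R (laurent_adm m (leqnn n)).
have a2 := admissible_Z (- n%:R) (laurent_adm m.+1 (leqnn n)).
pose f (z : R[i]) : R[i] := z ^+ m.+1 / z ^+ n.
pose f1 (z : R[i]) : R[i] := m.+1%:R * z ^+ m / (z - 0) ^+ n - n%:R * z ^+ m.+1 / (z - 0) ^+ n.+1.
have E z : on_G z -> m.+1%:R * (z ^+ m / z ^+ n) + - n%:R * (z ^+ m.+1 / z ^+ n) =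
    f1 z + f z * (n%:R / z - n%:R + n%:R * (0 : R)%:C / z ^+ 2).
  move=> /on_G_neq0 z0; rewrite /f1 /f !subr0 mulr0 mul0r addr0 !exprS; field.
  by rewrite z0 expf_neq0.
have H : I 0 (fun z => f1 z + f z * (n%:R / z - n%:R + n%:R * (0 : R)%:C / z ^+ 2)) = 0.
  apply: (@intGamma_ibp _ delta n alpha delta0 n0 0 f f1 1 m).
  - have := @cauchy_mono_diff (fun z => on_G z \/ z = (2 * delta)%:C) 0 m.+1 n.
    have -> : cauchy_mono 0 m.+1 n = f by apply/funext => z; rewrite /cauchy_mono subr0.
    apply => z; rewrite subr0 => -[/on_G_neq0 //|->].
    by rewrite eq_complex /= eqxx andbT gt_eqF // mulr_gt0.
  - by apply: eq_admissible (admissible_D a1 a2).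
  - move=> z /on_G_neq0; rewrite -absC_gt0 => z0.
    rewrite /f absCM absCV !absCX divfK ?expf_neq0 ?gt_eqF // mul1r exprS ler_wpM2l //.
    exact/pow_le1/ltW.
move: H; rewrite -(eq_intGamma n alpha 0 E) intGamma_D // !intGamma_Z //; try exact: laurent_adm.
rewrite IH => /eqP; rewrite mulNr subr_eq0 => /eqP H.
apply: (mulfI nC); rewrite -H factS natrM [_ ^+ m.+2]exprS; field.
by rewrite expf_neq0 // nC.
Qed.

Lemma mu_at0 J : mu 0 J = (J + n.-1)`!%:R / n%:R ^+ (J + n).
Proof.
have -> : (n%:R : R[i]) ^+ (J + n) = n%:R ^+ (J + n.-1).+1 by rewrite -addnS prednK.
rewrite -gamma_moment; apply: eq_intGamma => z /on_G_neq0 z0.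
have -> : z ^+ n = z * z ^+ n.-1 by rewrite -exprS prednK.
by rewrite exprD; field; rewrite z0 expf_neq0.
Qed.

End Moments.

(** * Formal orthogonal polynomials *)

Section FormalOP.
Context {F : fieldType} (m : nat -> F).
Implicit Types (p q u f : {poly F}).

(** The functional [p -> int p w / z], where [m i] stands for [int z ^ (i - 1) w];
   [Lmom] below is then [p -> int p w]. *)
Definition Lam p : F := \sum_(i < size p) p`_i * m i.
Definition Lmom p : F := Lam ('X * p).

Lemma Lam_wide N p : (size p <= N)%N -> Lam p = \sum_(i < N) p`_i * m i.
Proof.
move=> pN; rewrite /Lam (big_ord_widen N (fun i => p`_i * m i)) // big_mkcond /=.
apply: eq_bigr => i _; case: ifP => // /negbT; rewrite -leqNgt => Hi.
by rewrite nth_default // mul0r.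
Qed.

Lemma LamD p q : Lam (p + q) = Lam p + Lam q.
Proof.
have Hs := size_polyD p q; rewrite (Lam_wide Hs).
rewrite (Lam_wide (leq_maxl (size p) (size q))) (Lam_wide (leq_maxr (size p) (size q))).
by rewrite -big_split; apply: eq_bigr => i _; rewrite coefD mulrDl.
Qed.

Lemma LamZ c p : Lam (c *: p) = c * Lam p.
Proof.
rewrite (Lam_wide (size_scale_leq c p)) /Lam mulr_sumr.
by apply: eq_bigr => i _; rewrite coefZ mulrA.
Qed.

Lemma LamN p : Lam (- p) = - Lam p.
Proof. by rewrite -scaleN1r LamZ mulN1r. Qed.

Lemma LamB p q : Lam (p - q) = Lam p - Lam q.
Proof. by rewrite LamD LamN. Qed.

Lemma Lam0 : Lam 0 = 0.
Proof. by rewrite -(scale0r 0) LamZ mul0r. Qed.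

Lemma Lam_sum (I : Type) (r : seq I) (P : pred I) (f : I -> {poly F}) :
  Lam (\sum_(i <- r | P i) f i) = \sum_(i <- r | P i) Lam (f i).
Proof. by apply: (big_morph Lam LamD Lam0). Qed.

Lemma LamXn k : Lam 'X^k = m k.
Proof.
rewrite /Lam size_polyXn big_ord_recr /= coefXn eqxx mul1r big1 ?add0r // => i _.
by rewrite coefXn ltn_eqF ?mul0r.
Qed.

Lemma LmomD p q : Lmom (p + q) = Lmom p + Lmom q.
Proof. by rewrite /Lmom mulrDr LamD. Qed.
Lemma LmomZ c p : Lmom (c *: p) = c * Lmom p.
Proof. by rewrite /Lmom -scalerAr LamZ. Qed.
Lemma LmomB p q : Lmom (p - q) = Lmom p - Lmom q.
Proof. by rewrite /Lmom mulrBr LamB. Qed.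
Lemma Lmom0 : Lmom 0 = 0.
Proof. by rewrite /Lmom mulr0 Lam0. Qed.
Lemma LmomXn k : Lmom 'X^k = m k.+1.
Proof. by rewrite /Lmom -exprS LamXn. Qed.

Lemma Lmom_sum (I : Type) (r : seq I) (P : pred I) (f : I -> {poly F}) :
  Lmom (\sum_(i <- r | P i) f i) = \sum_(i <- r | P i) Lmom (f i).
Proof. by apply: (big_morph Lmom LmomD Lmom0). Qed.

Lemma Lmom_wide N p : (size p <= N)%N -> Lmom p = \sum_(i < N) p`_i * m i.+1.
Proof.
move=> pN; rewrite /Lmom (@Lam_wide N.+1) ?big_ord_recl; last first.
  have [->|p0] := eqVneq p 0; first by rewrite mulr0 size_poly0.
  by rewrite mulrC size_mulX.
by rewrite coefXM eqxx mul0r add0r; apply: eq_bigr => i _; rewrite coefXM.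
Qed.

Definition orth k p : Prop :=
  [/\ p \is monic, size p = k.+1 & forall j, (j < k)%N -> Lmom (p * 'X^j) = 0].

Definition opnorm k p : F := Lmom (p * 'X^k).

Lemma orth_mul k p u : orth k p -> (size u <= k.+1)%N ->
  Lmom (p * u) = u`_k * opnorm k p.
Proof.
move=> [_ _ po] su; rewrite -{1}(coefK u) (poly_def (size u)) mulr_sumr.
rewrite (big_ord_widen k.+1 (fun i => p * (u`_i *: 'X^i))) // big_mkcond /=.
rewrite /Lmom mulr_sumr Lam_sum big_ord_recr /= big1 ?add0r => [|i _]; last first.
  case: ifP => _; last by rewrite mulr0 Lam0.
  by rewrite -/(Lmom _) -scalerAr LmomZ po ?mulr0.
case: ifP => [_|/negbT]; first by rewrite -/(Lmom _) -scalerAr LmomZ.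
by rewrite -leqNgt => Hi; rewrite mulr0 Lam0 nth_default // mul0r.
Qed.

Lemma orth_mul0 k p u : orth k p -> (size u <= k)%N -> Lmom (p * u) = 0.
Proof.
move=> po su; rewrite (orth_mul po (leqW su)) nth_default ?mul0r //.
Qed.

Lemma orth_lead k p : orth k p -> p`_k = 1.
Proof. by move=> [/monicP + sp _]; rewrite lead_coefE sp. Qed.

Lemma polydivX u : u = u`_0 *: 1 + 'X * \poly_(i < (size u).-1) u`_i.+1.
Proof.
apply/polyP => i; rewrite coefD coefZ coef1 coefXM.
case: i => [|i] /=; first by rewrite mulr1 addr0.
rewrite mulr0 add0r coef_poly; case: ltnP => // H.
by rewrite nth_default //; move: H; case: (size u).
Qed.

(** Dividing by [X] reduces to the value at 0, up to a polynomial of lower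
   degree which orthogonality removes. *)
Lemma Lam_orth_mul k p u : orth k p -> (size u <= k.+2)%N ->
  Lam (p * u) = u`_0 * Lam p + u`_k.+1 * opnorm k p.
Proof.
move=> po su; rewrite {1}(polydivX u) mulrDr LamD -scalerAr mulr1 LamZ mulrCA.
congr (_ + _); rewrite -/(Lmom _) (orth_mul po); last first.
  by apply: leq_trans (size_poly _ _) _; case: (size u) su.
congr (_ * _); rewrite coef_poly; case: ltnP => // H.
by rewrite nth_default //; move: H; case: (size u).
Qed.

Lemma Lam_orth_mul0 k p u : orth k p -> (size u <= k.+1)%N ->
  Lam (p * u) = u`_0 * Lam p.
Proof.
move=> po su; rewrite (Lam_orth_mul po (leqW su)) [_`_k.+1]nth_default //.
by rewrite mul0r addr0.
Qed.

Definition hankmx k : 'M[F]_k := \matrix_(i, j) m (i + j).+1.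

Lemma hankmx_mul k (v : 'rV[F]_k) j : (v *m hankmx k) 0 j = Lmom (rVpoly v * 'X^j).
Proof.
rewrite mxE /Lmom /rVpoly poly_def mulr_suml mulr_sumr Lam_sum.
apply: eq_bigr => i _; rewrite mxE -scalerAl -exprD -scalerAr LamZ -exprS LamXn.
by rewrite insubT //= => Hi; congr (v _ _ * _); apply: val_inj.
Qed.

Lemma hankmx_kernel k p : \det (hankmx k) != 0 -> (size p <= k)%N ->
  (forall j, (j < k)%N -> Lmom (p * 'X^j) = 0) -> p = 0.
Proof.
move=> D0 sp po; have E : rVpoly (poly_rV p : 'rV_k) = p by exact: poly_rV_K.
have K : (poly_rV p : 'rV_k) *m hankmx k = 0.
  by apply/rowP => j; rewrite hankmx_mul E po // mxE.
rewrite -E; have -> : (poly_rV p : 'rV_k) = 0; last by rewrite linear0.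
apply/eqP; apply: contraNT D0 => v0; apply/det0P.
by exists (poly_rV p).
Qed.

(** The inverse of the Hankel matrix enters through its adjugate, so that the
   coefficients of [opoly k] are visibly rational in the moments. *)
Definition opoly k : {poly F} := 'X^k
  - rVpoly ((\det (hankmx k))^-1 *: ((\row_j m (k + j).+1) *m \adj (hankmx k))).

Lemma opoly_orth k : \det (hankmx k) != 0 -> orth k (opoly k).
Proof.
move=> D0; rewrite /opoly; set v := _ *: _.
have sv : (size (- rVpoly v) < size ('X^k : {poly F}))%N.
  by rewrite size_polyXn ltnS size_polyN size_poly.
split.
- by rewrite monicE lead_coefDl // lead_coefXn.
- by rewrite size_polyDl // size_polyXn.
- move=> j jk; rewrite mulrBl LmomB -exprD LmomXn.
  have -> : Lmom (rVpoly v * 'X^j) = (v *m hankmx k) 0 (Ordinal jk) by rewrite hankmx_mul.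
  by rewrite /v -scalemxAl -mulmxA mul_adj_mx mul_mx_scalar scalerA mulVf // scale1r mxE subrr.
Qed.

Lemma coef_opoly k (i : 'I_k) : (opoly k)`_i =
  - ((\det (hankmx k))^-1 * \sum_(j < k) m (k + j).+1 * (\adj (hankmx k)) j i).
Proof.
rewrite coefB coefXn ltn_eqF // sub0r coef_rVpoly_ord !mxE; congr (- (_ * _)).
by apply: eq_bigr => j _; rewrite mxE.
Qed.

Lemma coef_opoly_ge k i : (k <= i)%N -> (opoly k)`_i = (i == k)%:R.
Proof.
move=> ki; rewrite coefB coefXn coef_rVpoly.
by case: insubP => [j jk _|_]; [rewrite ltnNge ki in jk|rewrite subr0].
Qed.

Lemma size_opoly_le k : (size (opoly k) <= k.+1)%N.
Proof.
by apply/leq_sizeP => j kj; rewrite coef_opoly_ge ?(ltnW kj) // gtn_eqF.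
Qed.

Lemma opnormE k p : (size p <= k.+1)%N ->
  opnorm k p = \sum_(i < k.+1) p`_i * m (i + k).+1.
Proof.
move=> sp; rewrite /opnorm -{1}(coefK p) poly_def mulr_suml /Lmom mulr_sumr Lam_sum.
rewrite (big_ord_widen k.+1 (fun i => Lam ('X * (p`_i *: 'X^i * 'X^k)))) // big_mkcond.
apply: eq_bigr => i _; case: ifP => [_|/negbT]; last first.
  by rewrite -leqNgt => Hi; rewrite nth_default // mul0r.
by rewrite -scalerAl -exprD -scalerAr LamZ -exprS LamXn.
Qed.

Lemma orth_uniq k p q : \det (hankmx k) != 0 -> orth k p -> orth k q -> p = q.
Proof.
move=> D0 [pm sp po] [qm sq qo]; apply/eqP; rewrite -subr_eq0; apply/eqP.
apply: (hankmx_kernel D0) => [|j jk]; last by rewrite mulrBl LmomB po // qo // subrr.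
apply/leq_sizeP => j; rewrite leq_eqVlt => /predU1P[<-|kj].
  move/monicP: pm; move/monicP: qm; rewrite !lead_coefE sp sq /= coefB => -> ->.
  by rewrite subrr.
by rewrite coefB !nth_default ?sp ?sq // subrr.
Qed.

(** A kernel vector of the Hankel matrix can be added to an orthogonal polynomial. *)
Lemma orth_unique_det k : (exists p, unique (orth k) p) <-> \det (hankmx k) != 0.
Proof.
split=> [[p [[pm sp po] pu]]|D0]; last first.
  exists (opoly k); split; first exact: opoly_orth.
  by move=> q qo; apply: (orth_uniq D0) => //; exact: opoly_orth.
apply/negP => /det0P[v v0 vH]; move/eqP: v0; apply.
have E : p = p + rVpoly v.
  apply: pu; split.
  - rewrite monicE lead_coefDl -?monicE // sp ltnS; exact: size_poly.
  - by rewrite size_polyDl // sp ltnS; exact: size_poly.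
  - move=> j jk; rewrite mulrDl LmomD po // add0r.
    by have := hankmx_mul v (Ordinal jk); rewrite vH mxE => <-.
have V0 : rVpoly v = 0 by apply: (addrI p); rewrite -E addr0.
by rewrite -(rVpolyK v) V0 linear0.
Qed.

(** Were the norm zero, the polynomial would be orthogonal to one more power,
   hence in the kernel of the next Hankel matrix. *)
Lemma opnorm_neq0 k p : \det (hankmx k.+1) != 0 -> orth k p -> opnorm k p != 0.
Proof.
move=> D0 [pm sp po]; apply/eqP => h0.
have : p = 0.
  apply: (hankmx_kernel D0) => [|j]; first by rewrite sp.
  by rewrite ltnS leq_eqVlt => /predU1P[->//|]; exact: po.
by move=> p0; move: sp; rewrite p0 size_poly0.
Qed.

(** [X p - p1 - a p] has degree at most [k] and is orthogonal to all lower powers,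
   so it is a multiple of [q]. *)
Lemma three_term k q p p1 : \det (hankmx k) != 0 ->
  orth k q -> orth k.+1 p -> orth k.+2 p1 ->
  exists b, 'X * p = p1 + (p`_k - p1`_k.+1) *: p + b *: q.
Proof.
move=> D0 qo po p1o; set a := _ - _; pose u := 'X * p - p1 - a *: p.
have [_ sp pz] := po; have [_ sp1 p1z] := p1o; have [_ sq qz] := qo.
have su : (size u <= k.+1)%N.
  apply/leq_sizeP => j kj; rewrite /u !coefB coefZ coefXM.
  have [j0|j0] := eqVneq j 0%N; first by rewrite j0 in kj.
  case: j kj j0 => // j kj _ /=.
  move: kj; rewrite ltnS leq_eqVlt => /predU1P[<-|].
    by rewrite (orth_lead po) mulr1 /a; ring.
  rewrite leq_eqVlt => /predU1P[<-|kj].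
    by rewrite (orth_lead po) (orth_lead p1o) subrr nth_default ?sp // mulr0 subr0.
  by rewrite !nth_default ?sp ?sp1 ?mulr0 ?subr0 // ltnW.
exists (u`_k); have E : u - u`_k *: q = 0.
  apply: (hankmx_kernel D0) => [|j jk].
    apply/leq_sizeP => j; rewrite leq_eqVlt => /predU1P[<-|kj].
      by rewrite coefB coefZ (orth_lead qo) mulr1 subrr.
    have uj : u`_j = 0 by apply: nth_default; exact: leq_trans su kj.
    by rewrite coefB coefZ uj (nth_default 0 (_ : (size q <= j)%N)) ?sq // mulr0 subrr.
  rewrite /u !mulrBl !LmomB -!scalerAl !LmomZ (qz _ jk) (pz _ (ltnW _)) ?ltnS ?(ltnW jk) //.
  have -> : 'X * p * 'X^j = p * 'X^(j.+1) by rewrite exprS; ring.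
  have E1 : Lmom (p1 * 'X^j) = 0 by apply: p1z; rewrite ltnS (leq_trans (ltnW jk)).
  have E2 : Lmom (p * 'X^(j.+1)) = 0 by exact: pz.
  rewrite E1 E2 !mulr0.
  by rewrite !subr0.
move/eqP: E; rewrite subr_eq0 /u => /eqP <-; ring.
Qed.

End FormalOP.

(** * Identities from the Pearson equation *)

Section SemiClassical.
Context {F : fieldType} (m : nat -> F).
Implicit Types (p q u f : {poly F}).
Local Notation Lam := (Lam m).
Local Notation Lmom := (Lmom m).
Local Notation orth := (orth m).
Local Notation opnorm := (opnorm m).

Let linear_vanish (G : {poly F} -> F) :
  (forall p q, G (p + q) = G p + G q) -> (forall c p, G (c *: p) = c * G p) ->
  (forall i, G 'X^i = 0) -> forall p, G p = 0.
Proof.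
move=> GD GZ GX p; have G0 : G 0 = 0 by rewrite -(scale0r 0) GZ mul0r.
rewrite -(coefK p) poly_def (big_morph G GD G0) big1 // => i _.
by rewrite GZ GX mulr0.
Qed.

Lemma size_deriv_le p k : (size p <= k.+1)%N -> (size p^`() <= k)%N.
Proof.
move=> sp; have [->|p0] := eqVneq p 0; first by rewrite deriv0 size_poly0.
by rewrite -ltnS (leq_trans (lt_size_deriv p0)).
Qed.

Section Regular.
Context (n : nat) (t : F).
Hypothesis rec : forall J, (J.+1 + n)%:R * m J.+1 - n%:R * m J.+2 + n%:R * t * m J = 0.

(** The Pearson equation of the weight, extended from powers by linearity. *)
Lemma Lam_ibp p : Lmom ('X * p^`()) + n.+1%:R * Lmom p - n%:R * Lmom ('X * p)
  + n%:R * t * Lam p = 0.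
Proof.
move: p; apply: linear_vanish.
- by move=> p q; rewrite derivD !mulrDr !LmomD LamD; ring.
- by move=> c p; rewrite derivZ -!scalerAr !LmomZ LamZ; ring.
- move=> i; rewrite derivXn mulrnAr; have -> : 'X * 'X^(i.-1) *+ i = i%:R *: 'X^i :> {poly F}.
    by case: i => [|i]; rewrite ?mulr0n ?scale0r // -exprS -scaler_nat.
  rewrite LmomZ -exprS !LmomXn LamXn -[RHS](rec i) !natrD -!natr1; ring.
Qed.

Lemma Lmom_X_sq k p p1 : orth k p -> orth k.+1 p1 ->
  Lmom ('X * (p * p)) = (('X * p)`_k - p1`_k) * opnorm k p.
Proof.
move=> po p1o; have [_ sp _] := po; have [_ sp1 _] := p1o.
have -> : 'X * (p * p) = p * ('X * p - p1) + p1 * p by ring.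
rewrite LmomD (orth_mul0 p1o) ?sp // addr0 (orth_mul po) ?coefB //.
apply/leq_sizeP => j; rewrite leq_eqVlt => /predU1P[<-|kj].
  by rewrite coefB coefXM /= (orth_lead po) (orth_lead p1o) subrr.
rewrite coefB coefXM; case: j kj => // j kj /=.
by rewrite !nth_default ?sp ?sp1 ?subrr.
Qed.

(** [Lam_ibp] for the square of the orthogonal polynomial. *)
Lemma alpha_identity k p p1 : orth k p -> orth k.+1 p1 ->
  (2 * k + 1 + n)%:R * opnorm k p
  - n%:R * ((('X * p)`_k - p1`_k) * opnorm k p) + n%:R * t * (p`_0 * Lam p) = 0.
Proof.
move=> po p1o; have [_ sp _] := po.
have := Lam_ibp (p * p); rewrite (Lmom_X_sq po p1o) (Lam_orth_mul0 po) ?sp //.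
have -> : Lmom (p * p) = opnorm k p by rewrite (orth_mul po) ?sp // (orth_lead po) mul1r.
have -> : 'X * (p * p)^`() = p * (2%:R *: ('X * p^`())).
  by rewrite derivM -scalerAr scaler_nat mulr2n; ring.
rewrite (orth_mul po); last first.
  apply: leq_trans (size_scale_leq _ _) _; apply: leq_trans (size_polyMleq _ _) _.
  by rewrite size_polyX /= ltnS size_deriv_le ?sp.
rewrite coefZ coefXM; have -> : (if k == 0%N then 0 else p^`()`_k.-1) = k%:R.
  by case: k po {sp p1o} => // k po; rewrite coef_deriv (orth_lead po) /=.
move=> H; rewrite -[RHS]H 2!natrD natrM -natr1; ring.
Qed.

Section Consecutive.
Context (k : nat) (p q : {poly F}).
Hypothesis po : orth k.+1 p.
Hypothesis qo : orth k q.
Let h := opnorm k.+1 p.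
Let g := opnorm k q.
Let sp : size p = k.+2. Proof. by case: po. Qed.
Let sq : size q = k.+1. Proof. by case: qo. Qed.
Let pl : p`_k.+1 = 1. Proof. exact: orth_lead po. Qed.
Let ql : q`_k = 1. Proof. exact: orth_lead qo. Qed.

Let Lmom_pp : Lmom (p * p) = h.
Proof. by rewrite (orth_mul po) ?sp // pl mul1r. Qed.

Let Lmom_qq : Lmom (q * q) = g.
Proof. by rewrite (orth_mul qo) ?sq // ql mul1r. Qed.

Let Lmom_pq : Lmom (p * q) = 0.
Proof. by rewrite (orth_mul0 po) ?sq. Qed.

Let size_Xderiv f N : (size f <= N)%N -> (size ('X * f^`())%R <= N)%N.
Proof.
move=> fN; case: N fN => [|N] fN.
  by move: fN; rewrite leqn0 size_poly_eq0 => /eqP ->; rewrite deriv0 mulr0 size_poly0.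
apply: leq_trans (size_polyMleq _ _) _.
by rewrite size_polyX /= ltnS size_deriv_le.
Qed.

Lemma Lam_pq : Lam (p * q) = q`_0 * Lam p.
Proof. by rewrite (Lam_orth_mul0 po) ?sq. Qed.

Lemma Lam_pq_sym : q`_0 * Lam p = p`_0 * Lam q + g.
Proof. by rewrite -Lam_pq mulrC (Lam_orth_mul qo) ?sp // pl mul1r. Qed.

Lemma Lmom_Xdp_q : Lmom ('X * (p^`() * q)) = - p`_k * g.
Proof.
have -> : 'X * (p^`() * q) = k.+1%:R *: (p * q) + q * ('X * p^`() - k.+1%:R *: p).
  by rewrite mulrBr -!scalerAr; rewrite [q * p]mulrC; ring.
rewrite LmomD LmomZ Lmom_pq mulr0 add0r (orth_mul qo); last first.
  apply/leq_sizeP => j; rewrite leq_eqVlt => /predU1P[<-|kj].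
    by rewrite coefB coefXM coefZ /= coef_deriv pl mulr1 subrr.
  rewrite coefB coefXM coefZ; case: j kj => // j kj /=.
  by rewrite coef_deriv !nth_default ?sp // mul0rn mulr0 subrr.
congr (_ * _); rewrite coefB coefXM coefZ; case: (k) => [|j] /=; first by ring.
by rewrite coef_deriv -mulr_natl -[j.+2%:R]natr1; ring.
Qed.

Lemma Lmom_Xpq : Lmom ('X * (p * q)) = h.
Proof.
rewrite mulrCA (orth_mul po); last first.
  by apply: leq_trans (size_polyMleq _ _) _; rewrite size_polyX /= sq.
by rewrite coefXM /= ql mul1r.
Qed.

(** [Lam_ibp] for the product of two consecutive orthogonal polynomials. *)
Lemma subleading_identity :
  - p`_k * g - n%:R * h + n%:R * t * (q`_0 * Lam p) = 0.
Proof.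
have := Lam_ibp (p * q); rewrite Lam_pq Lmom_Xpq Lmom_pq mulr0 addr0.
have -> : 'X * (p * q)^`() = 'X * (p^`() * q) + p * ('X * q^`()).
  by rewrite derivM; ring.
by rewrite LmomD Lmom_Xdp_q (orth_mul0 po) ?addr0 // size_Xderiv ?sq.
Qed.

(** The Christoffel-Darboux numerator with one argument at 0, divided by [X].  It is
   the polynomial whose products with [p] and [q] give the two equations that
   [product_identity] combines. *)
Definition cd0 : {poly F} := \poly_(i < k.+1) (q`_0 * p`_i.+1 - p`_0 * q`_i.+1).

Lemma cd0E : 'X * cd0 = q`_0 *: p - p`_0 *: q.
Proof.
apply/polyP => i; rewrite coefXM coefB !coefZ; case: i => [|i] /=.
  by rewrite mulrC subrr.
rewrite coef_poly; case: ltnP => // ki.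
have -> : p`_i.+1 = 0 by apply: nth_default; rewrite sp.
have -> : q`_i.+1 = 0 by apply: nth_default; rewrite sq ltnW.
by rewrite !mulr0 subrr.
Qed.

Let size_cd0 : (size cd0 <= k.+1)%N. Proof. exact: size_poly. Qed.

Let cd0_lead : cd0`_k = q`_0.
Proof. by rewrite coef_poly ltnSn pl (nth_default _ (_ : (size q <= k.+1)%N)) ?sq //; ring. Qed.

Let eqA : - (k.+1%:R * p`_0 * g) - n%:R * (q`_0 * h)
  + n%:R * t * (cd0`_0 * Lam p) = 0.
Proof.
have := Lam_ibp (p * cd0); rewrite (Lam_orth_mul0 po) ?(leq_trans size_cd0) //.
rewrite (orth_mul0 po size_cd0) mulr0 addr0.
have -> : 'X * (p * cd0) = q`_0 *: (p * p) - p`_0 *: (p * q).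
  by rewrite mulrCA cd0E mulrBr -!scalerAr.
have -> : 'X * (p * cd0)^`() = p * ('X * cd0^`()) +
    (q`_0 *: (p * p^`()) - p`_0 *: (q * p^`())).
  have -> : 'X * (p * cd0)^`() = p * ('X * cd0^`()) + ('X * cd0) * p^`().
    by rewrite derivM; ring.
  by rewrite cd0E mulrBl -!scalerAl.
rewrite LmomB !LmomZ Lmom_pp Lmom_pq LmomD LmomB !LmomZ.
rewrite (orth_mul0 po) ?size_Xderiv // (orth_mul0 po) ?size_deriv_le ?sp //.
rewrite (orth_mul qo) ?size_deriv_le ?sp // coef_deriv pl => H.
rewrite -[RHS]H /g; ring.
Qed.

Let eqB : (k.+1 + n)%:R * q`_0 * g + n%:R * (p`_0 * g)
  + n%:R * t * (cd0`_0 * Lam q) = 0.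
Proof.
have := Lam_ibp (q * cd0); rewrite (Lam_orth_mul0 qo) //.
rewrite (orth_mul qo size_cd0) cd0_lead.
have -> : 'X * (q * cd0) = q`_0 *: (p * q) - p`_0 *: (q * q).
  by rewrite mulrCA cd0E mulrBr -!scalerAr [q * p]mulrC.
have -> : 'X * (q * cd0)^`() = q * ('X * cd0^`()) +
    (q`_0 *: (p * q^`()) - p`_0 *: (q * q^`())).
  have -> : 'X * (q * cd0)^`() = q * ('X * cd0^`()) + ('X * cd0) * q^`().
    by rewrite derivM; ring.
  by rewrite cd0E mulrBl -!scalerAl.
rewrite LmomB !LmomZ Lmom_qq Lmom_pq LmomD LmomB !LmomZ.
rewrite (orth_mul qo) ?size_Xderiv // (orth_mul0 po); last by rewrite ltnW // ltnS size_deriv_le ?sq.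
rewrite (orth_mul0 qo) ?size_deriv_le ?sq //.
have -> : ('X * cd0^`())`_k = k%:R * q`_0.
  rewrite coefXM -cd0_lead; case: (k) => [|j] /=; first by rewrite mul0r.
  by rewrite coef_deriv mulr_natl.
move=> H; rewrite -[RHS]H natrD -!natr1 /g; ring.
Qed.

(** The identities [eqA] and [eqB] both contain the value of [cd0] at 0, which
   nothing else determines; it is eliminated between them. *)
Lemma product_identity : k.+1%:R * (p`_0 * Lam q) * g + n%:R * h * (q`_0 * Lam q)
  + (k.+1 + n)%:R * (q`_0 * Lam p) * g + n%:R * (p`_0 * Lam p) * g = 0.
Proof.
have -> : k.+1%:R * (p`_0 * Lam q) * g + n%:R * h * (q`_0 * Lam q)
  + (k.+1 + n)%:R * (q`_0 * Lam p) * g + n%:R * (p`_0 * Lam p) * g =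
  Lam p * ((k.+1 + n)%:R * q`_0 * g + n%:R * (p`_0 * g) + n%:R * t * (cd0`_0 * Lam q))
  - Lam q * (- (k.+1%:R * p`_0 * g) - n%:R * (q`_0 * h) + n%:R * t * (cd0`_0 * Lam p)) by ring.
by rewrite eqA eqB !mulr0 subrr.
Qed.

(** [Lam_ibp] for the Wronskian of [p] and [q]. *)
Lemma trace_identity : n%:R * t * (p`_1 * Lam q - q`_1 * Lam p) =
  - (n%:R * p`_k + k.+1%:R * (k.+1 + n)%:R) * g.
Proof.
have := Lam_ibp (q * p^`() - p * q^`()).
have sp' : (size p^`() <= k.+1)%N by rewrite size_deriv_le ?sp.
have sq' : (size q^`() <= k)%N by rewrite size_deriv_le ?sq.
rewrite LamB (Lam_orth_mul0 qo) // (Lam_orth_mul0 po) ?(leq_trans sq') //; last by rewrite (leq_trans (leqnSn k)).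
rewrite !coef_deriv !mulr1n LmomB (orth_mul0 po) ?(leq_trans sq') // subr0.
rewrite (orth_mul qo) // coef_deriv pl.
have -> : 'X * (q * p^`() - p * q^`()) = 'X * (p^`() * q) - p * ('X * q^`()) by ring.
rewrite LmomB Lmom_Xdp_q (orth_mul0 po) ?size_Xderiv ?sq // subr0.
have -> : 'X * (q * p^`() - p * q^`())^`() = q * ('X * p^`()^`()) - p * ('X * q^`()^`()).
  by rewrite derivB !derivM; ring.
rewrite LmomB (orth_mul qo) ?size_Xderiv // (orth_mul0 po) ?size_Xderiv // ?(leq_trans sq') // subr0.
have -> : ('X * p^`()^`())`_k = (k * k.+1)%:R.
  rewrite coefXM; case: (k) pl => [|j] pl' //=.
  by rewrite !coef_deriv pl' -mulrnA mulnC.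
move=> H; apply/eqP; rewrite -subr_eq0; apply/eqP; rewrite -[RHS]H natrM natrD -!natr1 /g; ring.
Qed.

Lemma Lam_cd0 : Lam cd0 = p`_1 * Lam q - q`_1 * Lam p.
Proof.
pose A : {poly F} := \poly_(i < k.+1) p`_i.+1.
pose B : {poly F} := \poly_(i < k) q`_i.+1.
have EA : p = p`_0 *: 1 + 'X * A by rewrite {1}(polydivX p) sp.
have EB : q = q`_0 *: 1 + 'X * B by rewrite {1}(polydivX q) sq.
have E : cd0 = q * A - p * B.
  have X0 : 'X != 0 :> {poly F} by rewrite polyX_eq0.
  apply: (mulfI X0); rewrite cd0E mulrBr.
  have -> : 'X * (q * A) = q * ('X * A) by ring.
  have -> : 'X * (p * B) = p * ('X * B) by ring.
  have -> : 'X * A = p - p`_0 *: 1 by apply/eqP; rewrite eq_sym subr_eq addrC; apply/eqP.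
  have -> : 'X * B = q - q`_0 *: 1 by apply/eqP; rewrite eq_sym subr_eq addrC; apply/eqP.
  by rewrite !mulrBr -!scalerAr !mulr1; ring.
rewrite E LamB (Lam_orth_mul0 qo) ?size_poly // (Lam_orth_mul0 po); last first.
  by apply: leq_trans (size_poly _ _) _; rewrite (leq_trans (leqnSn k)).
have -> : A`_0 = p`_1 by rewrite coef_poly.
have -> // : B`_0 = q`_1; rewrite coef_poly; case: ltnP => // k0.
by rewrite [RHS]nth_default // sq.
Qed.

(** The three-term recurrence turns the cross term at the next level into
   quantities of the present one. *)
Lemma Lam_next p1 : \det (hankmx m k) != 0 -> g != 0 -> orth k.+2 p1 ->
  g * Lam (p1 * p) = g * h - g * (p`_k - p1`_k.+1) * (p`_0 * Lam p)
    - h * (q`_0 * Lam p).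
Proof.
move=> D0 g0 p1o; have [b Eb] := three_term D0 qo po p1o.
have [_ sp1 _] := p1o.
have bg : b * g = h.
  have := Lmom_Xpq; have -> : 'X * (p * q) = p1 * q + (p`_k - p1`_k.+1) *: (p * q) + b *: (q * q).
    by rewrite mulrA Eb !mulrDl -!scalerAl.
  by rewrite !LmomD !LmomZ Lmom_pq Lmom_qq (orth_mul0 p1o) ?sq ?leqnSn // mulr0 !add0r.
have -> : p1 * p = 'X * (p * p) - (p`_k - p1`_k.+1) *: (p * p) - b *: (p * q).
  have E1 : p1 = 'X * p - (p`_k - p1`_k.+1) *: p - b *: q by rewrite Eb; ring.
  move: (p`_k - p1`_k.+1) E1 => a ->.
  by rewrite !mulrBl -!scalerAl [q * p]mulrC mulrA.
rewrite !LamB !LamZ -/(Lmom _) Lmom_pp Lam_pq (Lam_orth_mul0 po) ?sp // -bg.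
ring.
Qed.

End Consecutive.

Lemma Lam_next0 p p1 : orth 0 p -> orth 1 p1 ->
  Lam (p1 * p) = opnorm 0 p - (- p1`_0) * (p`_0 * Lam p).
Proof.
move=> po p1o; have [pm sp _] := po; have [p1m sp1 _] := p1o.
have p1' : p = 1.
  have /size_poly1P[c _ E] : size p == 1%N by rewrite sp.
  by move: pm; rewrite E monicE lead_coefC => /eqP ->.
have E1 : p1 = 'X + p1`_0 *: 1.
  apply/polyP => i; rewrite coefD coefX coefZ coef1.
  case: i => [|[|i]] /=; rewrite ?mulr1 ?mulr0 ?add0r ?addr0 //.
    exact: orth_lead p1o.
  by rewrite nth_default // sp1.
rewrite p1' mulr1 coef1 mul1r {1}E1 LamD LamZ /opnorm mulr1 /Lmom mulr1; ring.
Qed.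

End Regular.

Section AtZero.
Context (n : nat).
Hypothesis rec0 : forall J, (J + n)%:R * m J = n%:R * m J.+1.

(** At [t = 0] the Pearson equation has one factor [X] less, which gives access to
   moments that the equation for [t < 0] multiplies by [t]. *)
Lemma Lam_ibp0 p : Lmom p^`() + n%:R * Lam p - n%:R * Lmom p = 0.
Proof.
move: p; apply: linear_vanish.
- by move=> p q; rewrite derivD !LmomD LamD; ring.
- by move=> c p; rewrite derivZ !LmomZ LamZ; ring.
- move=> i; rewrite derivXn -scaler_nat LmomZ LamXn (LmomXn _ i) -rec0 natrD.
  by case: i => [|i] /=; rewrite ?LmomXn; ring.
Qed.

Lemma at0_sq k p : orth k p -> n%:R * (p`_0 * Lam p) = n%:R * opnorm k p.
Proof.
move=> po; have [_ sp _] := po; have := Lam_ibp0 (p * p).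
rewrite (Lam_orth_mul0 po) ?sp // (orth_mul po) ?sp // (orth_lead po) mul1r.
have -> : (p * p)^`() = 2%:R *: (p * p^`()) by rewrite derivM scaler_nat mulr2n; ring.
rewrite LmomZ (orth_mul0 po) ?size_deriv_le ?sp // mulr0 add0r.
by move/eqP; rewrite subr_eq0 => /eqP.
Qed.

Lemma at0_cross k p q : orth k.+1 p -> orth k q ->
  n%:R * (q`_0 * Lam p) = - k.+1%:R * opnorm k q.
Proof.
move=> po qo; have [_ sp _] := po; have [_ sq _] := qo.
have := Lam_ibp0 (p * q); rewrite (Lam_orth_mul0 po) ?sq // (orth_mul0 po) ?sq //.
rewrite derivM LmomD [p^`() * q]mulrC (orth_mul qo) ?size_deriv_le ?sp //.
rewrite (orth_mul0 po); last by rewrite ltnW // ltnS size_deriv_le ?sq.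
rewrite coef_deriv (orth_lead po) => /eqP; rewrite mulr0 subr0 addr0 addrC addr_eq0 => /eqP ->.
by rewrite mulNr.
Qed.

End AtZero.

End SemiClassical.

(** * Determinants *)

Section Laguerre.
Context {F : numFieldType} (c : F) (n : nat).
Hypothesis c0 : c != 0.

(** The Chu-Vandermonde identity factors the matrix into triangular ones. *)
Lemma laguerre_det_neq0 k :
  \det (\matrix_(i < k, j < k) ((i + j + n)`!%:R / c ^+ (i + j + n).+1)) != 0.
Proof.
set A := \matrix_(i, j) _.
pose d1 : 'rV[F]_k := \row_i ((i + n)`!%:R / c ^+ i).
pose d2 : 'rV[F]_k := \row_j (j`!%:R / c ^+ (j + n).+1).
pose Lo : 'M[F]_k := \matrix_(i, j) 'C(i, j)%:R.
pose Up : 'M[F]_k := \matrix_(i, j) if (i <= j)%N then 'C(n + j, j - i)%:R else 0.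
have E : A = diag_mx d1 *m (Lo *m Up) *m diag_mx d2.
  apply/matrixP => i j; rewrite mul_mx_diag mul_diag_mx !mxE.
  have -> : \sum_l Lo i l * Up l j = 'C(i + n + j, j)%:R.
    rewrite -addnA -binomial.Vandermonde natr_sum.
    rewrite (big_ord_widen k (fun l => ('C(i, l) * 'C(n + j, j - l))%N%:R)) // [RHS]big_mkcond /=.
    apply: eq_bigr => l _; rewrite !mxE ltnS; case: ifP => _; last by rewrite mulr0.
    by rewrite natrM.
  have fz : (j`!%:R : F) != 0 by rewrite pnatr_eq0 -lt0n fact_gt0.
  have -> : ((i + j + n)`!%:R : F) = 'C(i + n + j, j)%:R * (j`!%:R * (i + n)`!%:R).
    rewrite -!natrM addnAC; congr (_%:R).
    by rewrite -(@bin_fact (i + n + j) j) ?leq_addl // addnK.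
  have -> : c ^+ (i + j + n).+1 = c ^+ i * c ^+ (j + n).+1.
    by rewrite -exprD addnS addnA.
  by field; rewrite !expf_neq0.
have dL : \det Lo = 1.
  rewrite det_trig; last first.
    by apply/is_trig_mxP => i j ij; rewrite mxE bin_small.
  by rewrite big1 // => i _; rewrite mxE binn.
have dU : \det Up = 1.
  rewrite -det_tr det_trig; last first.
    by apply/is_trig_mxP => i j ij; rewrite !mxE leqNgt ij.
  by rewrite big1 // => i _; rewrite !mxE leqnn subnn bin0.
rewrite E !det_mulmx dL dU !det_diag !mulr1 mulf_neq0 //; apply/prodf_neq0 => i _;
  by rewrite mxE mulf_neq0 ?invr_eq0 ?expf_neq0 // pnatr_eq0 -lt0n fact_gt0.
Qed.

End Laguerre.

(** Whatever class of functions is closed under ring operations is closed under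
   determinants; this serves for derivability, limits and analyticity alike. *)
Section Closure.
Context {K : comNzRingType} {T : Type} (P : (T -> K) -> Prop).
Hypothesis Pcst : forall c, P (fun=> c).
Hypothesis PD : forall f g, P f -> P g -> P (fun x => f x + g x).
Hypothesis PM : forall f g, P f -> P g -> P (fun x => f x * g x).

Lemma closure_sum (I : Type) (r : seq I) (Q : pred I) (f : I -> T -> K) :
  (forall i, P (f i)) -> P (fun x => \sum_(i <- r | Q i) f i x).
Proof.
move=> H; elim: r => [|i r IH].
  by under eq_fun do rewrite big_nil; exact: Pcst.
under eq_fun do rewrite big_cons.
by case: (Q i) => //; apply: PD.
Qed.

Lemma closure_prod (I : Type) (r : seq I) (Q : pred I) (f : I -> T -> K) :
  (forall i, P (f i)) -> P (fun x => \prod_(i <- r | Q i) f i x).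
Proof.
move=> H; elim: r => [|i r IH].
  by under eq_fun do rewrite big_nil; exact: Pcst.
under eq_fun do rewrite big_cons.
by case: (Q i) => //; apply: PM.
Qed.

Lemma closure_det k (A : T -> 'M[K]_k) : (forall i j, P (fun x => A x i j)) ->
  P (fun x => \det (A x)).
Proof.
by move=> H; apply: closure_sum => s; apply: PM; [exact: Pcst|exact: closure_prod].
Qed.

Lemma closure_adj k (A : T -> 'M[K]_k) : (forall i j, P (fun x => A x i j)) ->
  forall i j, P (fun x => (\adj (A x)) i j).
Proof.
move=> H i j; under eq_fun do rewrite mxE /cofactor.
apply: PM; first exact: Pcst.
by apply: closure_det => i' j'; under eq_fun do rewrite !mxE.
Qed.

End Closure.

Section Jacobi.
Context {R : realType}.

Lemma is_derC_prod (I : finType) (f : I -> R -> R[i]) (df : I -> R[i]) (x : R) :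
  (forall i, is_derC (f i) x (df i)) ->
  is_derC (fun u => \prod_i f i u) x (\sum_i df i * \prod_(j | j != i) f j x).
Proof.
move=> H.
have key (r : seq I) : uniq r -> is_derC (fun u => \prod_(i <- r) f i u) x
    (\sum_(i <- r) df i * \prod_(j <- r | j != i) f j x).
  elim: r => [|a r IH] /=.
    by move=> _; rewrite big_nil; under eq_fun do rewrite big_nil; exact: is_derC_cst.
  move=> /andP[ar ur]; under eq_fun do rewrite big_cons.
  apply: (is_derC_eq (is_derC_M (H a) (IH ur))); rewrite big_cons big_cons eqxx /=.
  congr (_ * _ + _).
    rewrite big_seq [RHS]big_seq_cond; apply: eq_bigl => i.
    by case: (boolP (i \in r)) => //= ir; apply/esym; apply: contraNneq ar => <-.
  rewrite mulr_sumr; apply: eq_big_seq => i ir.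
  rewrite big_cons ifT; first ring.
  by apply: contraNneq ar => ->.
have := key (index_enum I) (index_enum_uniq I).
by [].
Qed.

(** Jacobi's formula: differentiating one row at a time pairs the rows of [dA] with
   the cofactors of [A x]. *)
Lemma is_derC_det k (A : R -> 'M[R[i]]_k) (dA : 'M[R[i]]_k) (x : R) :
  (forall i j, is_derC (fun u => A u i j) x (dA i j)) ->
  is_derC (fun u => \det (A u)) x (\tr (dA *m \adj (A x))).
Proof.
move=> H; pose B i := \matrix_(i', j) if i' == i then dA i' j else A x i' j.
have detB i : \det (B i) = (dA *m \adj (A x)) i i.
  rewrite (expand_det_row (B i) i) mxE; apply: eq_bigr => j _; rewrite !mxE eqxx.
  congr (_ * (_ * \det _)); apply/matrixP => a b; rewrite !mxE.
  by rewrite eq_sym (negbTE (neq_lift _ _)).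
have -> : \tr (dA *m \adj (A x)) = \sum_(s : {perm 'I_k}) (-1) ^+ s *
    \sum_i dA i (s i) * \prod_(j | j != i) A x j (s j).
  rewrite /mxtrace; under eq_bigr do rewrite -detB /determinant.
  rewrite exchange_big /=; apply: eq_bigr => s _; rewrite mulr_sumr.
  apply: eq_bigr => i _; congr (_ * _); rewrite (bigD1 i) //= mxE eqxx; congr (_ * _).
  by apply: eq_bigr => j ji; rewrite mxE (negbTE ji).
rewrite /determinant; apply: is_derC_sum => s _; apply: is_derC_Z.
exact: (is_derC_prod (fun i => H i (s i))).
Qed.

End Jacobi.

(** * Differentiating the orthogonal polynomials in the parameter *)

Section RationalInMoments.
Context {F : fieldType} {T : Type} (P : (T -> F) -> Prop) (m : T -> nat -> F).
Hypothesis Pcst : forall c, P (fun=> c).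
Hypothesis PD : forall f g, P f -> P g -> P (fun x => f x + g x).
Hypothesis PM : forall f g, P f -> P g -> P (fun x => f x * g x).
Hypothesis Pm : forall J, P (fun x => m x J.+1).

Lemma closure_hankmx k : P (fun x => \det (hankmx (m x) k)).
Proof. by apply: closure_det => // i j; under eq_fun do rewrite mxE; exact: Pm. Qed.

Section Fixed.
Context (k : nat).
Hypothesis PV : P (fun x => (\det (hankmx (m x) k))^-1).

Lemma closure_coef_opoly i : P (fun x => (opoly (m x) k)`_i).
Proof.
have [ki|ik] := leqP k i.
  by under eq_fun do rewrite coef_opoly_ge //; exact: Pcst.
under eq_fun do rewrite (coef_opoly _ (Ordinal ik)) -mulN1r.
apply: PM; first exact: Pcst.
apply: PM => //; apply: closure_sum => // j; apply: PM => //.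
by apply: closure_adj => // a b; under eq_fun do rewrite mxE; exact: Pm.
Qed.

Lemma closure_opnorm : P (fun x => opnorm (m x) k (opoly (m x) k)).
Proof.
under eq_fun do rewrite opnormE ?size_opoly_le //.
by apply: closure_sum => // i; apply: PM => //; exact: closure_coef_opoly.
Qed.

Lemma closure_Lam_opoly : P (fun x => m x 0%N) ->
  P (fun x => Lam (m x) (opoly (m x) k)).
Proof.
move=> P0; under eq_fun do rewrite (Lam_wide _ (size_opoly_le _ k)).
apply: closure_sum => // i; apply: PM; first exact: closure_coef_opoly.
by case: (val i) => [//|J]; exact: Pm.
Qed.

End Fixed.
End RationalInMoments.

Section TimeDerivatives.
Context {R : realType} (n : nat) (m : R -> nat -> R[i]) (t : R).
Hypothesis dm : forall J, is_derC (m^~ J.+1) t (- n%:R * m t J).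
Local Notation L := (Lam (m t)).
Local Notation Lm := (Lmom (m t)).

Let PdD (f g : R -> R[i]) : (exists l, is_derC f t l) -> (exists l, is_derC g t l) ->
  exists l, is_derC (fun x => f x + g x) t l.
Proof. by move=> [l Hl] [l' Hl']; eexists; exact: is_derC_D Hl Hl'. Qed.
Let PdM (f g : R -> R[i]) : (exists l, is_derC f t l) -> (exists l, is_derC g t l) ->
  exists l, is_derC (fun x => f x * g x) t l.
Proof. by move=> [l Hl] [l' Hl']; eexists; exact: is_derC_M Hl Hl'. Qed.
Let Pdc c : exists l, is_derC (fun=> c) t l.
Proof. by exists 0; exact: is_derC_cst. Qed.
Let Pdm J : exists l, is_derC (m^~ J.+1) t l.
Proof. by eexists; exact: dm. Qed.

Lemma is_derC_hankel k : exists l, is_derC (fun u => \det (hankmx (m u) k)) t l.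
Proof. exact: (closure_hankmx (P := fun f => exists l, is_derC f t l)). Qed.

Lemma near_hankel k : \det (hankmx (m t) k) != 0 ->
  \forall u \near t, \det (hankmx (m u) k) != 0.
Proof.
by have [l /is_derC_cvg H] := is_derC_hankel k => D0; exact: (cvgC_neq0 H D0).
Qed.

Lemma opoly_derivative k : \det (hankmx (m t) k) != 0 ->
  exists2 dp : {poly R[i]}, (size dp <= k)%N &
    forall i, is_derC (fun u => (opoly (m u) k)`_i) t dp`_i.
Proof.
move=> D0; have H i : exists l, is_derC (fun u => (opoly (m u) k)`_i) t l.
  apply: (closure_coef_opoly (P := fun f => exists l, is_derC f t l)) => //.
  by have [l Hl] := is_derC_hankel k; eexists; exact: is_derC_V D0 Hl.
have [d Hd] := choice H; exists (\poly_(i < k) d i); first exact: size_poly.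
move=> i; rewrite coef_poly; case: ltnP => // ki.
by under eq_fun do rewrite coef_opoly_ge //; exact: is_derC_cst.
Qed.

Section Fixed.
Context (k : nat) (dp : {poly R[i]}).
Hypothesis D0 : \det (hankmx (m t) k) != 0.
Hypothesis sdp : (size dp <= k)%N.
Hypothesis dpE : forall i, is_derC (fun u => (opoly (m u) k)`_i) t dp`_i.
Local Notation p := (opoly (m t) k).
Let po : orth (m t) k p. Proof. exact: opoly_orth. Qed.
Let sp : size p = k.+1. Proof. by case: po. Qed.

Lemma is_derC_Lmom_opoly j : is_derC (fun u => Lmom (m u) (opoly (m u) k * 'X^j)) t
  (Lm (dp * 'X^j) - n%:R * L (p * 'X^j)).
Proof.
have E (M : nat -> R[i]) (q : {poly R[i]}) : (size q <= k.+1)%N ->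
    Lmom M (q * 'X^j) = \sum_(i < k.+1) q`_i * M (i + j).+1 /\
    Lam M (q * 'X^j) = \sum_(i < k.+1) q`_i * M (i + j)%N.
  move=> sq; have {1 3}-> : q = \sum_(i < k.+1) q`_i *: 'X^i.
    rewrite -[LHS](coefK q) poly_def (big_ord_widen k.+1 (fun i => q`_i *: 'X^i)) // big_mkcond.
    apply: eq_bigr => i _; case: ifP => // /negbT; rewrite -leqNgt => Hi.
    by rewrite nth_default // scale0r.
  rewrite mulr_suml /Lmom mulr_sumr !Lam_sum; split; apply: eq_bigr => i _.
    by rewrite -scalerAl -exprD -scalerAr LamZ -exprS LamXn.
  by rewrite -scalerAl -exprD LamZ LamXn.
under eq_fun do rewrite (E _ _ (size_opoly_le _ k)).1.
have sdp' := leqW sdp; have sp' := size_opoly_le (m t) k.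
have [-> _] := E (m t) _ sdp'; have [_ ->] := E (m t) _ sp'.
rewrite mulr_sumr -sumrB; apply: is_derC_sum => i _.
apply: (is_derC_eq (is_derC_M (dpE i) (dm (i + j)))).
by move: (m t _) (m t _) => a b; ring.
Qed.

(** The derivative of the orthogonality relations, which hold near [t]. *)
Lemma Lmom_dp (u : {poly R[i]}) : (size u <= k)%N -> Lm (dp * u) = n%:R * L (p * u).
Proof.
move=> su; rewrite -(coefK u) poly_def [dp * _]mulr_sumr [p * _]mulr_sumr Lmom_sum Lam_sum mulr_sumr.
apply: eq_bigr => i _; rewrite -!scalerAr LmomZ LamZ mulrCA; congr (_ * _).
have ik : (i < k)%N by apply: leq_trans su.
have H0 : is_derC (fun u => Lmom (m u) (opoly (m u) k * 'X^i)) t 0.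
  apply: (near_is_derC _ (is_derC_cst t 0)).
  have := near_hankel D0; apply: filterS => x Dx.
  by have [_ _ ->] := opoly_orth Dx.
have := is_derC_unique (is_derC_Lmom_opoly i) H0.
by move/eqP; rewrite subr_eq0 => /eqP.
Qed.

(** The derivative of the polynomial has lower degree, so only the derivative of
   the weight contributes. *)
Lemma is_derC_opnorm : is_derC (fun u => opnorm (m u) k (opoly (m u) k)) t
  (- n%:R * (p`_0 * L p)).
Proof.
apply: (is_derC_eq (is_derC_Lmom_opoly k)).
have pm : p \is monic by case: po.
have E : 'X^k = p + ('X^k - p) by rewrite addrC subrK.
have su : (size ('X^k - p)%R <= k)%N.
  apply/leq_sizeP => j kj; rewrite coefB coefXn coef_opoly_ge //; exact: subrr.
rewrite -(Lam_orth_mul0 po) ?sp // E.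
move: ('X^k - p) su => u su; rewrite (mulrDr dp) (mulrDr p) LmomD (Lmom_dp su) LamD.
rewrite [dp * p]mulrC (orth_mul0 po) //; ring.
Qed.

End Fixed.

(** Pairing the derivative of [p] with [q] isolates its leading coefficient. *)
Lemma is_derC_subleading k : \det (hankmx (m t) k.+1) != 0 ->
  \det (hankmx (m t) k) != 0 ->
  let p := opoly (m t) k.+1 in let q := opoly (m t) k in
  exists2 ds, is_derC (fun u => (opoly (m u) k.+1)`_k) t ds &
    ds * opnorm (m t) k q = n%:R * (q`_0 * L p).
Proof.
move=> D1 D0 p q; have [dp sdp dpE] := opoly_derivative D1.
exists dp`_k => //; have qo := opoly_orth D0; have po := opoly_orth D1.
have [_ sq _] := qo.
by rewrite -(orth_mul qo) // mulrC (Lmom_dp D1 sdp dpE) ?sq // (Lam_orth_mul0 po) ?sq.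
Qed.

End TimeDerivatives.

(** * The first order system behind Painlevé III *)

Section Painleve.
Context {R : realType} (n k : nat) (m : R -> nat -> R[i]).
Hypothesis n0 : (0 < n)%N.
Hypothesis rec : forall (t : R) J,
  (J.+1 + n)%:R * m t J.+1 - n%:R * m t J.+2 + n%:R * t%:C * m t J = 0.
Hypothesis dm : forall t : R, t < 0 -> forall J,
  is_derC (m^~ J.+1) t (- n%:R * m t J).

Let nC : (n%:R : R[i]) != 0. Proof. by rewrite pnatr_eq0 -lt0n. Qed.
Let negC (t : R) : t < 0 -> t%:C != 0 :> R[i].
Proof. by move=> t0; rewrite eq_complex /= negb_and lt_eqF. Qed.

Definition hankD (t : R) K := \det (hankmx (m t) K).
Definition hnorm (t : R) K := opnorm (m t) K (opoly (m t) K).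
(** The factor [X] gives the value 0 in degree 0, where there is no subleading
   coefficient. *)
Definition subcoef (t : R) K := ('X * opoly (m t) K)`_K.
(** The parameters at which the polynomials of degree [k - 1], [k] and [k + 1] exist. *)
Definition good (t : R) : Prop := [/\ t < 0,
  (if k is k'.+1 then hankD t k' != 0 else True), hankD t k != 0 &
  hankD t k.+1 != 0].

(** [afun] is the Painlevé function, equal to [t * Lam (p * p) / h_k] by [afunE];
   [rfun] is the companion variable [t * Lam (p * q) / h_(k - 1)] of [rfunE],
   written without the moment of order [-1] so as to be visibly derivable. *)
Definition afun (t : R) : R[i] :=
  subcoef t k - subcoef t k.+1 - (2 * k + 1 + n)%:R / n%:R.
Definition rfun (t : R) : R[i] :=
  if k is k'.+1 then subcoef t k / n%:R + hnorm t k / hnorm t k' else 0.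

Lemma hnorm_neq0 t K : hankD t K != 0 -> hankD t K.+1 != 0 -> hnorm t K != 0.
Proof. by move=> D0 D1; apply: opnorm_neq0 => //; exact: opoly_orth. Qed.

Lemma near_good t : good t -> \forall u \near t, good u.
Proof.
move=> [t0 D0 D1 D2].
have H0 : \forall u \near t, u < 0 by exact: lt_nbhsl.
have H1 : \forall u \near t, hankD u k != 0 by exact: (near_hankel (dm t0)) D1.
have H2 : \forall u \near t, hankD u k.+1 != 0 by exact: (near_hankel (dm t0)) D2.
have H3 : \forall u \near t, if k is k'.+1 then hankD u k' != 0 else True.
  rewrite /hankD; case: (k) D0 => [|k'] D0; first exact: filterE.
  exact: (near_hankel (dm t0)) D0.
near=> u; split; near: u; assumption.
Unshelve. all: by end_near. Qed.

Lemma afunE t : good t -> let p := opoly (m t) k in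
  afun t * hnorm t k = t%:C * (p`_0 * Lam (m t) p).
Proof.
move=> [t0 D0 D1 D2] p; apply: (mulfI nC).
have := alpha_identity (rec t) (opoly_orth D1) (opoly_orth D2).
rewrite -/p -/(hnorm t k) /afun {1}/subcoef -/p => H.
have -> : subcoef t k.+1 = (opoly (m t) k.+1)`_k by rewrite /subcoef coefXM.
apply/eqP; rewrite -subr_eq0 -oppr_eq0; apply/eqP; rewrite -[RHS]H.
move: (opoly (m t) k.+1)`_k (p`_0 * Lam (m t) p) (hnorm t k) ('X * p)`_k => a b h c.
by move: (2 * k + 1 + n)%N => N; field.
Qed.

Section Succ.
Context (k' : nat) (t : R).
Hypothesis kE : k = k'.+1.
Hypothesis gt : good t.
Let p := opoly (m t) k.
Let q := opoly (m t) k'.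

Lemma rfunE : rfun t * hnorm t k' = t%:C * (q`_0 * Lam (m t) p).
Proof.
rewrite /q /p; move: gt; rewrite /good /rfun kE => -[t0 D0 D1 D2].
have g0 := hnorm_neq0 D0 D1.
have := subleading_identity (rec t) (opoly_orth D1) (opoly_orth D0).
rewrite -/(hnorm t k') -/(hnorm t k'.+1).
have -> : subcoef t k'.+1 = (opoly (m t) k'.+1)`_k' by rewrite /subcoef coefXM.
move: g0; move: (opoly _ _)`_k' (_ * Lam _ _) (hnorm t k') (hnorm t k'.+1) => a b g h g0 H.
apply: (mulfI nC); apply/eqP; rewrite -subr_eq0 -oppr_eq0; apply/eqP; rewrite -[RHS]H.
by field; rewrite g0.
Qed.

End Succ.

Lemma subcoefS t K : subcoef t K.+1 = (opoly (m t) K.+1)`_K.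
Proof. by rewrite /subcoef coefXM. Qed.

Lemma subcoef0 t : subcoef t 0 = 0.
Proof. by rewrite /subcoef coefXM. Qed.

Lemma subcoef_der t : good t ->
  exists2 ds, is_derC (subcoef^~ k) t ds & t%:C * ds = n%:R * rfun t.
Proof.
move=> gt; have H := @rfunE; rewrite /rfun; case E : k => [|k'].
  exists 0; last by rewrite !mulr0.
  by under eq_fun do rewrite subcoef0; exact: is_derC_cst.
have [t0] := gt; rewrite E => D0 D1 D2; have [ds Hds dsE] := is_derC_subleading (dm t0) D1 D0.
exists ds; first by under eq_fun do rewrite subcoefS.
apply: (mulIf (hnorm_neq0 D0 D1)); have := H k' t E gt; rewrite /rfun E => H'.
rewrite -mulrA -[RHS]mulrA [in LHS]dsE H'; ring.
Qed.

(** The cross term at the next level is rewritten by [Lam_next], so that the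
   system closes on [afun] and [rfun]. *)
Lemma subcoef_der_next t : good t -> exists2 ds, is_derC (subcoef^~ k.+1) t ds &
  t%:C * ds = n%:R * (t%:C - (afun t + (2 * k + 1 + n)%:R / n%:R) * afun t - rfun t).
Proof.
move=> gt; have aE := afunE gt; have [t0 D0 D1 D2] := gt.
have rE := @rfunE; have h0 := hnorm_neq0 D1 D2.
have [ds Hds dsE] := is_derC_subleading (dm t0) D2 D1.
exists ds; first by under eq_fun do rewrite subcoefS.
have po := opoly_orth D1; have p1o := opoly_orth D2.
apply: (mulIf h0); rewrite -mulrA dsE.
have -> : afun t + (2 * k + 1 + n)%:R / n%:R = subcoef t k - subcoef t k.+1 by rewrite /afun subrK.
have aE' := aE.
have [_ sp _] := po.
rewrite -(Lam_pq p1o po); move: aE' D0 D1 D2 po p1o h0 {Hds dsE aE sp}; rewrite /rfun.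
case E : k => [|k'] aE' D0 D1 D2 po p1o h0.
  rewrite (Lam_next0 po p1o) subcoef0 subcoefS -/(hnorm t 0).
  rewrite subr0 mulrCA mulrBr mulrCA -aE'; ring.
have qo := opoly_orth D0; have g0 := hnorm_neq0 D0 D1.
have H := Lam_next po qo D0 g0 p1o.
have rE' := rE k' t E gt; rewrite /rfun E in rE'; rewrite !subcoefS in rE' *.
apply: (mulIf g0); rewrite -!mulrA [_ * hnorm t k']mulrC H.
rewrite -/(hnorm t k') -/(hnorm t k'.+1).
move: rE' aE'.
move: ((opoly (m t) k'.+1)`_0 * _) ((opoly (m t) k')`_0 * _) (opoly _ _)`_k' (opoly _ _)`_k'.+1.
move: (afun t) (hnorm t k') (hnorm t k'.+1) => a g h X W x1 x2 rE' aE'.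
have -> : n%:R * ((t%:C - (x1 - x2) * a - (x1 / n%:R + h / g)) * (h * g)) =
  n%:R * (t%:C * (h * g) - (x1 - x2) * (a * h) * g - ((x1 / n%:R + h / g) * g) * h) by ring.
rewrite rE' aE'; ring.
Qed.

Lemma afun_der t : good t -> is_derC afun t
  ((n%:R * (2 * rfun t - t%:C) + n%:R * afun t ^+ 2 + (2 * k + 1 + n)%:R * afun t) / t%:C).
Proof.
move=> gt; have [t0 _ _ _] := gt; have tC := negC t0.
have [d1 H1 E1] := subcoef_der gt; have [d2 H2 E2] := subcoef_der_next gt.
apply: (is_derC_eq (is_derC_B (is_derC_B H1 H2) (is_derC_cst t _))).
apply: (mulIf tC); rewrite divfK // subr0 mulrC mulrBr E1 E2.
by move: (2 * k + 1 + n)%N (afun t) (rfun t) => c a r; field.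
Qed.

(** [rfun] is [s / n + beta] with [beta = h_k / h_(k - 1)]; differentiating [beta]
   brings in [afun] at level [k - 1], which [product_identity] removes. *)
Lemma rfun_der t : good t -> exists2 dr, is_derC rfun t dr &
  t%:C * afun t * dr = (2 * k + 1 + n)%:R * rfun t * afun t - k%:R * t%:C * afun t
    + 2 * n%:R * rfun t * (rfun t - t%:C).
Proof.
move=> gt; have [t0 _ _ _] := gt; have tC := negC t0.
have [d1 H1 E1] := subcoef_der gt; move: H1 E1; have aE := afunE gt.
have rE := @rfunE.
have aE' := aE.
case E : k => [|k'].
  move=> _ _; exists 0; last by rewrite /rfun E; ring.
  by rewrite (_ : rfun = fun=> 0) ?(funext,E) //; [exact: is_derC_cst|apply/funext => u; rewrite /rfun E].
move=> H1 E1; have [_] := gt; rewrite E => D0 D1 D2.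
have qo := opoly_orth D0; have po := opoly_orth D1.
have g0 := hnorm_neq0 D0 D1.
have [dp sdp dpE] := opoly_derivative (dm t0) D1.
have dh := is_derC_opnorm (dm t0) D1 sdp dpE.
have [dq sdq dqE] := opoly_derivative (dm t0) D0.
have dg := is_derC_opnorm (dm t0) D0 sdq dqE.
eexists.
  rewrite (_ : rfun = fun u => subcoef u k'.+1 / n%:R + hnorm u k'.+1 / hnorm u k'); last first.
    by apply/funext => u; rewrite /rfun E.
  apply: is_derC_D; first exact: (is_derC_M H1 (is_derC_cst t _)).
  apply: (is_derC_M dh); exact: is_derC_V g0 dg.
have rE' := rE k' t E gt; have PI := product_identity (rec t) po qo.
have SY := Lam_pq_sym po qo; move: aE' rE' PI SY E1; rewrite /rfun E.
rewrite -/(hnorm t k') -/(hnorm t k'.+1).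
move: (opoly (m t) k')`_0 (opoly (m t) k'.+1)`_0 (Lam (m t) (opoly _ k')) (Lam (m t) (opoly _ k'.+1)).
move: (afun t) (hnorm t k') (hnorm t k'.+1) (subcoef t k'.+1) g0 => a g h s g0 W X Q P.
move=> aE1 rE1 PI SY E1; pose r := s / n%:R + h / g; rewrite -!/r in rE1 E1 *.
pose b := t%:C * (W * Q) / g; pose be := h / g.
have aXP : a * be = t%:C * (X * P) / g by rewrite -aE1 mulrA.
have rWP : r = t%:C * (W * P) / g by rewrite -rE1 mulfK.
have XQr : r - t%:C = t%:C * (X * Q) / g by rewrite rWP SY; field.
have prod : a * be * b = r * (r - t%:C) by rewrite aXP XQr rWP /b; field.
have lin : k'.+1%:R * (r - t%:C) + n%:R * be * b + (k'.+1 + n)%:R * r + n%:R * (a * be) = 0.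
  rewrite aXP XQr rWP /b /be -[RHS](mulr0 (t%:C / g ^+ 2)) -PI.
  by move: (k'.+1 + n)%N k'.+1 => N K; field.
transitivity (a * (t%:C * d1 / n%:R) - a * (n%:R * (a * be)) + n%:R * (a * be * b)).
  by rewrite {1}aXP /b /be; field; rewrite g0.
rewrite E1 prod [n%:R * r]mulrC mulfK //.
have -> : n%:R * (a * be) = - (k'.+1%:R * (r - t%:C) + n%:R * be * b + (k'.+1 + n)%:R * r).
  by apply/eqP; rewrite -addr_eq0 addrC lin.
have -> : a * - (k'.+1%:R * (r - t%:C) + n%:R * be * b + (k'.+1 + n)%:R * r) =
  - (a * k'.+1%:R * (r - t%:C) + n%:R * (a * be * b) + a * (k'.+1 + n)%:R * r) by ring.
by rewrite prod !natrD natrM; ring.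
Qed.

End Painleve.

(** [r] and its derivative are eliminated from the first order system. *)
Lemma PIII_elimination (F : fieldType) (n c k t a a1 a2 r r1 : F) :
  n != 0 -> t != 0 -> a != 0 -> 2%:R != 0 :> F -> c = 2 * k + 1 + n ->
  t * a1 = n * (2 * r - t) + n * a ^+ 2 + c * a ->
  t * a * r1 = c * r * a - k * t * a + 2 * n * r * (r - t) ->
  t * a2 + a1 = n * (2 * r1 - 1) + 2 * n * a * a1 + c * a1 ->
  a2 = a1 ^+ 2 / a - a1 / t + n * c * (a ^+ 2 / t ^+ 2) + n ^+ 2 * a ^+ 3 / t ^+ 2
    + n ^+ 2 / t - n ^+ 2 / a.
Proof.
move=> n0 t0 a0 two0 cE H1 H2 H3.
have E1 : a1 = (n * (2 * r - t) + n * a ^+ 2 + c * a) / t.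
  by rewrite -H1 mulrC mulKf.
have E2 : r1 = (c * r * a - k * t * a + 2 * n * r * (r - t)) / (t * a).
  by rewrite -H2 mulrC mulKf // mulf_neq0.
have E3 : a2 = (n * (2 * r1 - 1) + 2 * n * a * a1 + c * a1 - a1) / t.
  by rewrite -H3 addrK mulrC mulKf.
by rewrite E3 E2 E1 cE; field; rewrite a0.
Qed.

(** * The Painlevé III equation and its initial conditions *)

Section PainleveProperty.
Context {R : realType} (n k : nat) (m : R -> nat -> R[i]).
Hypothesis n0 : (0 < n)%N.
Hypothesis rec : forall (t : R) J,
  (J.+1 + n)%:R * m t J.+1 - n%:R * m t J.+2 + n%:R * t%:C * m t J = 0.
Hypothesis dm : forall t : R, t < 0 -> forall J,
  is_derC (m^~ J.+1) t (- n%:R * m t J).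
Local Notation good := (good k m).
Local Notation afun := (afun n k m).
Local Notation rfun := (rfun n k m).
Context (a : R -> R[i]).
Hypothesis aE : forall t, good t -> a t = afun t.
Let c : R[i] := (2 * k + 1 + n)%:R.
Let adot t := (n%:R * (2 * rfun t - t%:C) + n%:R * afun t ^+ 2 + c * afun t) / t%:C.

Let nC : (n%:R : R[i]) != 0. Proof. by rewrite pnatr_eq0 -lt0n. Qed.
Let negC (t : R) : t < 0 -> t%:C != 0 :> R[i].
Proof. by move=> t0; rewrite eq_complex /= negb_and lt_eqF. Qed.

Let der_a t : good t -> is_derC a t (adot t).
Proof.
move=> gt; apply: near_is_derC (afun_der n0 rec dm gt).
by apply: filterS (near_good dm gt) => u; exact: aE.
Qed.

Lemma PIII_holds t : good t ->
  [/\ \forall u \near t, derivableC a u, derivableC (deriveC a) t &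
    a t != 0 -> deriveC (deriveC a) t = deriveC a t ^+ 2 / a t - deriveC a t / t%:C
      + n%:R * c * (a t ^+ 2 / t%:C ^+ 2) + n%:R ^+ 2 * a t ^+ 3 / t%:C ^+ 2
      + n%:R ^+ 2 / t%:C - n%:R ^+ 2 / a t].
Proof.
move=> gt; have [t0 _ _ _] := gt; have tC := negC t0.
have G := near_good dm gt.
have E1 : deriveC a t = adot t by have /is_derCP[] := der_a gt.
have [dr Hr rE] := rfun_der n0 rec dm gt.
have Ha := der_a gt.
have dd : is_derC (deriveC a) t
    ((n%:R * (2 * dr - 1) + n%:R * (adot t * a t + a t * adot t) + c * adot t - adot t) / t%:C).
  apply: (@near_is_derC _ _ (fun u => (n%:R * (2 * rfun u - u%:C) + n%:R * (a u * a u)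
      + c * a u) / u%:C)).
    apply: filterS G => u gu; have /is_derCP[_ ->] := der_a gu.
    by rewrite /adot -(aE gu) expr2.
  apply: (is_derC_eq (is_derC_M (is_derC_D (is_derC_D (is_derC_Z _ (is_derC_B
    (is_derC_Z _ Hr) (is_derC_id t))) (is_derC_Z _ (is_derC_M Ha Ha)))
    (is_derC_Z _ Ha)) (is_derC_V tC (is_derC_id t)))).
  have E : n%:R * (2 * rfun t - t%:C) + n%:R * (a t * a t) + c * a t = t%:C * adot t.
    by rewrite /adot [RHS]mulrC divfK // (aE gt) expr2.
  rewrite E; move: (a t) (adot t) c => A a1 C; by field.
split.
- by apply: filterS G => u gu; have /is_derCP[] := der_a gu.
- by have /is_derCP[] := dd.
move=> a0; have /is_derCP[_ ->] := dd; rewrite E1.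
apply: (PIII_elimination (k := k%:R) (r := rfun t) (r1 := dr)) => //.
- by rewrite /c 2!natrD natrM.
- by rewrite (aE gt) /adot mulrC divfK.
- by rewrite (aE gt).
- by move: (adot t) (a t) => A1 A; rewrite mulrC divfK //; ring.
Qed.

Section Limit.
Context (m0 : nat -> R[i]).
Hypothesis mcvg : forall J, cvgC 0^'- (m^~ J) (m0 J).
Hypothesis rec0 : forall J, (J + n)%:R * m0 J = n%:R * m0 J.+1.
Hypothesis D0 : forall K, \det (hankmx m0 K) != 0.

(** Adjoining the end point [t = 0] to the parameter range, as [None], lets closure
   under ring operations transport rational expressions in the moments to the
   limit. *)
Let mo (x : option R) := if x is Some t then m t else m0.
Let P (f : option R -> R[i]) := cvgC 0^'- (f \o Some) (f None).

Let Pcst z : P (fun=> z). Proof. exact: cvgC_cst. Qed.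
Let PD f g : P f -> P g -> P (fun x => f x + g x). Proof. exact: cvgC_D. Qed.
Let PM f g : P f -> P g -> P (fun x => f x * g x). Proof. exact: cvgC_M. Qed.
Let PV f : f None != 0 -> P f -> P (fun x => (f x)^-1).
Proof. by move=> f0; exact: cvgC_V. Qed.
Let Pmo J : P (fun x => mo x J). Proof. exact: mcvg. Qed.
Let Phank K : P (fun x => \det (hankmx (mo x) K)).
Proof. exact: closure_hankmx. Qed.
Let PhankV K : P (fun x => (\det (hankmx (mo x) K))^-1).
Proof. by apply: PV. Qed.

Lemma near_good_at0 : \forall u \near 0^'-, good u.
Proof.
have near_hank K : \forall u \near 0^'-, \det (hankmx (m u) K) != 0.
  exact: (cvgC_neq0 (Phank K) (D0 K)).
have near_pred : \forall u \near 0^'-, if k is k'.+1 then hankD m u k' != 0 else True.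
  by case: (k) => [|k']; [exact: filterE|exact: near_hank].
near=> u; split.
- by near: u; exact: nbhs_left_lt.
- by near: u; exact: near_pred.
- by near: u; exact: near_hank.
- by near: u; exact: near_hank.
Unshelve. all: by end_near. Qed.

Let p0 := opoly m0 k.
Let p0o : orth m0 k p0. Proof. exact: opoly_orth. Qed.

Let eps u := ((opoly (m u) k)`_0 * Lam (m u) (opoly (m u) k)) / hnorm m u k.

Let aE' : \forall u \near 0^'-, a u = u%:C * eps u.
Proof.
apply: filterS near_good_at0 => u gu; rewrite aE //.
have [_ _ D1 D2] := gu; have h0 := hnorm_neq0 D1 D2.
by apply: (mulIf h0); rewrite /eps -[RHS]mulrA divfK // (afunE n0 rec gu).
Qed.

Let eps_cvg : cvgC 0^'- eps 1.
Proof.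
have H : P (fun x => ((opoly (mo x) k)`_0 * Lam (mo x) (opoly (mo x) k)) /
    opnorm (mo x) k (opoly (mo x) k)).
  apply: PM; first apply: PM.
  - exact: (closure_coef_opoly (P := P)).
  - exact: (closure_Lam_opoly (P := P)).
  - by apply: PV; [exact: opnorm_neq0|exact: (closure_opnorm (P := P))].
have h0 := opnorm_neq0 (D0 k.+1) p0o.
have E : ((opoly m0 k)`_0 * Lam m0 (opoly m0 k)) / opnorm m0 k (opoly m0 k) = 1.
  apply: (mulIf h0); rewrite divfK // mul1r; apply: (mulfI nC).
  exact: (at0_sq rec0 p0o).
rewrite -E; exact: H.
Qed.

Let id_cvg : cvgC (0 : R)^'- (real_complex R) 0.
Proof.
have := is_derC_cvg (is_derC_id (0 : R)) => -[H1 H2]; split.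
- by apply: cvg_at_left_filter; exact: H1.
- by apply: cvg_at_left_filter; exact: H2.
Qed.

Lemma PIII_initial : cvgC 0^'- a 0.
Proof.
apply: near_cvgC aE' _; rewrite -[0 in X in cvgC _ _ X](mul0r 1).
by apply: cvgC_M; [exact: id_cvg|exact: eps_cvg].
Qed.

(** Both [afun] and [rfun] vanish like [t]; the slope of [afun] follows from the
   differential equation and the ratio [rfun / t]. *)
Let rt_cvg : exists2 e : R -> R[i], (\forall u \near 0^'-, rfun u = u%:C * e u) &
  cvgC 0^'- e (- k%:R / n%:R).
Proof.
have H := @rfunE R n k m n0 rec; case E : k => [|k'].
  exists (fun=> 0); last by rewrite oppr0 mul0r; exact: cvgC_cst.
  by apply: filterE => u; rewrite mulr0.
pose e (x : option R) := ((opoly (mo x) k')`_0 * Lam (mo x) (opoly (mo x) k'.+1)) /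
    opnorm (mo x) k' (opoly (mo x) k').
have He : P e.
  apply: PM; first apply: PM.
  - exact: (closure_coef_opoly (P := P)).
  - exact: (closure_Lam_opoly (P := P)).
  - by apply: PV; [apply: opnorm_neq0 => //; exact: opoly_orth|exact: (closure_opnorm (P := P))].
exists (e \o Some).
  apply: filterS near_good_at0 => u gu; have := H k' u E gu; rewrite E.
  have [_ ] := gu; rewrite E => D1 D2 _ H'; have g0 := hnorm_neq0 D1 D2.
  by apply: (mulIf g0); rewrite H' /e /= -[RHS]mulrA divfK.
have -> // : - k'.+1%:R / n%:R = e None.
have qo := opoly_orth (D0 k'); have po := opoly_orth (D0 k'.+1).
have g0 := opnorm_neq0 (D0 k'.+1) qo.
apply: (mulIf g0); rewrite /e /= divfK //; apply: (mulfI nC).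
by rewrite (at0_cross rec0 po qo); field.
Qed.

Lemma PIII_initial_slope : cvgC 0^'- (deriveC a) 1.
Proof.
have [e eE ecvg] := rt_cvg.
have H : \forall u \near 0^'-, deriveC a u =
    n%:R * (2 * e u - 1) + n%:R * (u%:C * (eps u * eps u)) + c * eps u.
  near=> u.
  have gu : good u by near: u; exact: near_good_at0.
  have u0 : u%:C != 0 :> R[i] by apply: negC; case: gu.
  have Er : rfun u = u%:C * e u by near: u.
  have Ea : a u = u%:C * eps u by near: u.
  have /is_derCP[_ ->] := der_a gu; rewrite /adot -(aE gu) Er Ea.
  by move: (eps u) (e u) c => x y C; field.
apply: near_cvgC H _.
rewrite [X in cvgC _ _ X](_ : 1 = n%:R * (2 * (- k%:R / n%:R) - 1) + n%:R * (0 * (1 * 1)) + c * 1); last first.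
  by rewrite /c 2!natrD natrM; field.
have cst z : cvgC (0 : R)^'- (fun=> z : R[i]) z by exact: cvgC_cst.
exact: (cvgC_D (cvgC_D (cvgC_M (cst _) (cvgC_B (cvgC_M (cst 2) ecvg) (cst 1)))
  (cvgC_M (cst _) (cvgC_M id_cvg (cvgC_M eps_cvg eps_cvg)))) (cvgC_M (cst _) eps_cvg)).
Unshelve. all: by end_near. Qed.

End Limit.
End PainleveProperty.

(** * The recurrence coefficients of the contour weight *)

Section Bridge.
Context {R : realType} (delta : R) (n : nat) (alpha : R[i]).
Hypothesis delta0 : 0 < delta.
Hypothesis n0 : (0 < n)%N.
Local Notation I := (intGamma delta n alpha).
Local Notation mut := (mu delta n alpha).

Lemma intGamma_horner (t : R) (p : {poly R[i]}) :
  I t (fun z => p.[z]) = Lmom (mut t) p.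
Proof.
rewrite (@Lmom_wide _ _ (size p)) //.
have -> : I t (fun z => p.[z]) = I t (fun z => \sum_(i < size p) p`_i * z ^+ i).
  by congr (intGamma _ _ _ _ _); apply/funext => z; rewrite horner_coef.
have ad i := admissible_Z p`_i (pow_adm delta0 n0 i).
rewrite intGamma_sum //; apply: eq_bigr => i _.
rewrite intGamma_Z //; last exact: pow_adm.
by rewrite -momentE.
Qed.

Lemma orthopolyE (t : R) k p : orthopoly delta n alpha t k p <-> orth (mut t) k p.
Proof.
have E j : I t (fun z => p.[z] * z ^+ j) = Lmom (mut t) (p * 'X^j).
  rewrite -intGamma_horner; congr (intGamma _ _ _ _ _); apply/funext => z.
  by rewrite hornerM hornerXn.
by split=> -[pm sp H]; split=> // j jk; have := H j jk; rewrite E.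
Qed.

Lemma is_piE (t : R) k p : is_pi delta n alpha t k p <-> unique (orth (mut t) k) p.
Proof.
by split=> -[/orthopolyE po pu]; split=> // q /orthopolyE; exact: pu.
Qed.

Lemma hankelE (t : R) k : hankel delta n alpha t k = hankD mut t k.
Proof.
by congr (\det _); apply/matrixP => i j; rewrite !mxE momentE.
Qed.

Lemma is_pi_det (t : R) k p : is_pi delta n alpha t k p ->
  hankD mut t k != 0 /\ p = opoly (mut t) k.
Proof.
move=> /is_piE H; have D0 : hankD mut t k != 0 by apply/orth_unique_det; exists p.
split=> //; have [_ pu] := H; apply: pu; exact: opoly_orth.
Qed.

Lemma opoly_is_pi (t : R) k : hankD mut t k != 0 ->
  is_pi delta n alpha t k (opoly (mut t) k).
Proof.
move=> D0; apply/is_piE; split; first exact: opoly_orth.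
by move=> q qo; apply: (orth_uniq D0) => //; exact: opoly_orth.
Qed.

Lemma is_alpha_good (t : R) k x : t < 0 -> is_alpha delta n alpha t k x ->
  good k mut t.
Proof.
move=> t0 [p0 [p [p1 [b [H0 /is_pi_det[D1 _] /is_pi_det[D2 _] _]]]]].
by split=> //; case: k H0 D1 D2 => // k' /is_pi_det[].
Qed.

Lemma good_is_alpha (t : R) k : good k mut t ->
  is_alpha delta n alpha t k (subcoef mut t k - subcoef mut t k.+1).
Proof.
case: k => [|k] [t0 D0 D1 D2].
  exists 0, (opoly (mut t) 0), (opoly (mut t) 1), 0; split=> //; try exact: opoly_is_pi.
  rewrite subcoef0 subcoefS sub0r scaler0 addr0.
  have [p1m sp1 _] := opoly_orth D2.
  apply/polyP => i; rewrite coefXM coefD coefZ.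
  have E j : (opoly (mut t) 0)`_j = (j == 0%N)%:R by rewrite coef_opoly_ge.
  rewrite !E; case: i => [|[|i]] /=; rewrite ?mulr1 ?subrr ?mulr0 ?addr0 //.
    exact/esym/(orth_lead (opoly_orth D2)).
  by rewrite coef_opoly_ge.
have [b Eb] := three_term D0 (opoly_orth D0) (opoly_orth D1) (opoly_orth D2).
exists (opoly (mut t) k), (opoly (mut t) k.+1), (opoly (mut t) k.+2), b.
by split; rewrite ?subcoefS //; exact: opoly_is_pi.
Qed.

Lemma mut_der (t : R) : t < 0 -> forall J, is_derC (mut^~ J.+1) t (- n%:R * mut t J).
Proof. by move=> t0 J; apply: is_derC_mu => //; rewrite lt_eqF. Qed.

Lemma mut_det0 K : \det (hankmx (mut 0) K) != 0.
Proof.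
have nC : (n%:R : R[i]) != 0 by rewrite pnatr_eq0 -lt0n.
rewrite (_ : hankmx _ _ = \matrix_(i, j) ((i + j + n)`!%:R / n%:R ^+ (i + j + n).+1)).
  exact: laguerre_det_neq0.
by apply/matrixP => i j; rewrite !mxE mu_at0 // addSnnS prednK // addSn.
Qed.

Lemma mut_rec0 J : (J + n)%:R * mut 0 J = n%:R * mut 0 J.+1.
Proof.
have nC : (n%:R : R[i]) != 0 by rewrite pnatr_eq0 -lt0n.
have E : (J + n.-1).+1 = (J + n)%N by rewrite -addnS prednK.
rewrite !mu_at0 // !addSn factS natrM E exprS.
have z0 := expf_neq0 (J + n) nC; rewrite invfM mulrA [n%:R * (_ * _)]mulrC.
by rewrite -[RHS]mulrA; congr (_ * _); rewrite mulrAC mulVf // mul1r.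
Qed.

Theorem painleve_III k (a : R -> R[i]) :
  (forall (t : R) (x : R[i]), t < 0 -> is_alpha delta n alpha t k x ->
      a t = x - (2 * k + 1 + n)%:R / n%:R) ->
  [/\ forall t : R, t < 0 -> (exists x, is_alpha delta n alpha t k x) ->
          [/\ (\forall u \near t, derivableC a u),
              derivableC (deriveC a) t &
              a t != 0 ->
              deriveC (deriveC a) t =
                deriveC a t ^+ 2 / a t - deriveC a t / t%:C
                + n%:R * (2 * k + 1 + n)%:R * (a t ^+ 2 / t%:C ^+ 2)
                + n%:R ^+ 2 * a t ^+ 3 / t%:C ^+ 2
                + n%:R ^+ 2 / t%:C - n%:R ^+ 2 / a t],
        cvgC 0^'- a 0 &
        cvgC 0^'- (deriveC a) 1].
Proof.
move=> aH; have aE t : good k mut t -> a t = afun n k mut t.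
  by move=> gt; apply: aH; [case: gt|exact: good_is_alpha].
have rec := mu_rec alpha delta0 n0.
have H1 := PIII_holds n0 rec mut_der aE.
split.
- by move=> t t0 [x /(is_alpha_good t0)/H1].
- exact: (PIII_initial n0 rec aE (mu_cvg0 alpha delta0 n0) mut_rec0 mut_det0).
- exact: (PIII_initial_slope n0 rec mut_der aE (mu_cvg0 alpha delta0 n0) mut_rec0 mut_det0).
Qed.

End Bridge.

(** * Asymptotic expansions *)

Section Asymptotics.
Context {R : realType}.

Lemma expC_taylor (w : R[i]) N :
  absC (expC w - \sum_(i < N) w ^+ i / i`!%:R) <= 2 ^+ N * expR (absC w) * absC w ^+ N.
Proof.
pose v m (u : R) := w ^+ m * expC (w * u%:C).
have dv m (u : R) : `|u - 0| <= 1 -> is_derC (v m) u (v m.+1 u).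
  move=> _; apply: (is_derC_eq (is_derC_Z _ (is_derC_expC (is_derC_Z w (is_derC_id u))))).
  by rewrite /v exprSr mulr1 -mulrA [w * _]mulrC.
have bv m (u : R) : `|u - 0| <= 1 ->
    absC (v m u) <= expR (absC w) * m`!%:R * absC w ^+ m.
  rewrite subr0 => u1; rewrite /v absCM absCX absC_expC [leLHS]mulrC.
  rewrite ler_wpM2r ?exprn_ge0 ?absC_ge0 //.
  rewrite -[leLHS]mulr1 ler_pM ?expR_ge0 ?ler1n ?fact_gt0 // ler_expR.
  rewrite mulrC Re_realM (le_trans (ler_norm _)) // normrM -[leRHS]mul1r ler_pM //.
  exact: ler_ReC.
have := taylor_bound (expR_ge0 _) (absC_ge0 w) dv bv N 0 (t := 1).
rewrite subr0 normr1 add0n => /(_ (lexx _)); rewrite expr1n mulr1 /v expr0 mul1r mulr1.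
have -> : 2 ^+ N * expR (absC w) * N`!%:R * absC w ^+ N / N`!%:R =
    2 ^+ N * expR (absC w) * absC w ^+ N.
  by field; rewrite pnatr_eq0 -lt0n fact_gt0.
congr (absC (_ - _) <= _); apply: eq_bigr => i _.
by rewrite mulr0 expC0 mulr1 expr1n mulr1.
Qed.

Context (u : R[i] -> R[i]) (sct : R -> R[i] -> Prop).
Implicit Types (f g : R[i] -> R[i]) (a b : nat -> R[i]).

(** Asymptotic expansions of [f] in powers of the gauge [u], as [u] tends to 0
   within each of the sectors [sct c].  The remainder of order [M] is bounded
   for each sector separately. *)
Definition asymN (M : nat) f a : Prop :=
  forall c : R, exists K r : R, [/\ 0 <= K, 0 < r & forall l : R[i],
    0 < absC (u l) <= r -> sct c l ->
    absC (f l - \sum_(m < M) a m * u l ^+ m) <= K * absC (u l) ^+ M].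

Definition asym f a : Prop := forall M, asymN M f a.

Lemma eq_asymN M f g a b : (forall l, u l != 0 -> f l = g l) ->
  (forall m, (m < M)%N -> a m = b m) -> asymN M f a -> asymN M g b.
Proof.
move=> fg ab fa c; have [K [r [K0 r0 H]]] := fa c; exists K, r; split=> // l /andP[u0 ur] sl.
rewrite -fg -?absC_gt0 //; have -> : \sum_(m < M) b m * u l ^+ m = \sum_(m < M) a m * u l ^+ m.
  by apply: eq_bigr => m _; rewrite ab.
by apply: H; rewrite ?u0.
Qed.

Definition near_sct (P : R[i] -> Prop) : Prop := forall c : R, exists2 r : R, 0 < r &
  forall l, 0 < absC (u l) <= r -> sct c l -> P l.

Lemma near_asymN M f g a : near_sct (fun l => f l = g l) -> asymN M f a -> asymN M g a.
Proof.
move=> fg fa c; have [K [r [K0 r0 H]]] := fa c; have [r' r0' H'] := fg c.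
exists K, (Num.min r r'); split; rewrite ?lt_min ?r0 // => l.
rewrite le_min => /and3P[u0 ur ur'] sl; have ul : 0 < absC (u l) <= r' by rewrite u0.
by rewrite -(H' l ul sl); apply: H => //; rewrite u0.
Qed.

Lemma eq_asym f g a b : (forall l, u l != 0 -> f l = g l) -> a =1 b ->
  asym f a -> asym g b.
Proof. by move=> fg ab fa M; exact: eq_asymN (fa M). Qed.

Lemma asymN_cst M z : asymN M (fun=> z) (fun m => if m is 0 then z else 0).
Proof.
move=> c; exists (absC z), 1; split; rewrite ?absC_ge0 // => l _ _.
case: M => [|M]; first by rewrite big_ord0 subr0 mulr1.
rewrite big_ord_recl big1 ?addr0 ?mulr1 ?subrr ?absC0 ?mulr_ge0 ?exprn_ge0 ?absC_ge0 //.
by move=> i _; rewrite mul0r.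
Qed.

Lemma asymN_D M f g a b : asymN M f a -> asymN M g b ->
  asymN M (fun l => f l + g l) (fun m => a m + b m).
Proof.
move=> fa gb c; have [K [r [K0 r0 H]]] := fa c; have [K' [r' [K0' r0' H']]] := gb c.
exists (K + K'), (Num.min r r'); split; rewrite ?addr_ge0 ?lt_min ?r0 // => l.
rewrite le_min => /and3P[u0 ur ur'] sl.
have -> : f l + g l - \sum_(m < M) (a m + b m) * u l ^+ m =
  (f l - \sum_(m < M) a m * u l ^+ m) + (g l - \sum_(m < M) b m * u l ^+ m).
  under eq_bigr do rewrite mulrDl; rewrite big_split /=; ring.
rewrite mulrDl (le_trans (ler_absCD _ _)) // lerD //; [apply: H|apply: H'] => //;
  exact/andP.
Qed.

Lemma asymN_Z M f a z : asymN M f a -> asymN M (fun l => z * f l) (fun m => z * a m).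
Proof.
move=> fa c; have [K [r [K0 r0 H]]] := fa c; exists (absC z * K), r.
split; rewrite ?mulr_ge0 ?absC_ge0 // => l ur sl.
under eq_bigr do rewrite -mulrA; rewrite -mulr_sumr -mulrBr absCM -mulrA.
by rewrite ler_wpM2l ?absC_ge0 ?H.
Qed.

Lemma asymN_cons M f a z : asymN M f a ->
  asymN M.+1 (fun l => z + u l * f l) (fun m => if m is m'.+1 then a m' else z).
Proof.
move=> fa c; have [K [r [K0 r0 H]]] := fa c; exists K, r; split=> // l ur sl.
rewrite big_ord_recl mulr1; have -> : z + u l * f l - (z + \sum_(i < M)
    (if (lift ord0 i : nat) is m'.+1 then a m' else z) * u l ^+ lift ord0 i) =
    u l * (f l - \sum_(m < M) a m * u l ^+ m).
  under eq_bigr do rewrite /= exprS mulrCA.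
  by rewrite -mulr_sumr; ring.
by rewrite absCM exprS mulrCA ler_wpM2l ?absC_ge0 ?H.
Qed.

Lemma asymN_behead M f a : asymN M.+1 f a ->
  asymN M (fun l => (f l - a 0%N) / u l) (fun m => a m.+1).
Proof.
move=> fa c; have [K [r [K0 r0 H]]] := fa c; exists K, r; split=> // l ur sl.
have /andP[u0 _] := ur; have := H l ur sl; rewrite big_ord_recl mulr1.
have un : u l != 0 by rewrite -absC_gt0.
have -> : f l - (a 0%N + \sum_(i < M) a (lift ord0 i) * u l ^+ lift ord0 i) =
    u l * ((f l - a 0%N) / u l - \sum_(m < M) a m.+1 * u l ^+ m).
  under eq_bigr do rewrite /= exprS mulrCA.
  by rewrite -mulr_sumr; field.
by rewrite absCM exprS mulrCA ler_pM2l.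
Qed.

Lemma asymNW M f a : asymN M.+1 f a -> asymN M f a.
Proof.
move=> fa c; have [K [r [K0 r0 H]]] := fa c; exists (K * r + absC (a M)), r.
split=> //; first by rewrite addr_ge0 ?mulr_ge0 ?absC_ge0 // ltW.
move=> l ur sl; have := H l ur sl; rewrite big_ord_recr /= => H1; have /andP[_ ur'] := ur.
have -> : f l - \sum_(m < M) a m * u l ^+ m =
  (f l - (\sum_(m < M) a m * u l ^+ m + a M * u l ^+ M)) + a M * u l ^+ M by ring.
apply: le_trans (ler_absCD _ _) _; rewrite mulrDl lerD //; last by rewrite absCM absCX.
apply: le_trans H1 _; rewrite exprS mulrA ler_wpM2r ?exprn_ge0 ?absC_ge0 //.
by rewrite ler_wpM2l.
Qed.

Lemma asymN_le M N f a : (M <= N)%N -> asymN N f a -> asymN M f a.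
Proof.
move=> /subnK <-; elim: (N - M)%N => [//|d IH]; rewrite addSn => /asymNW; exact: IH.
Qed.

Definition conv a b (m : nat) : R[i] := \sum_(i < m.+1) a i * b (m - i)%N.

(** By induction on the order, splitting off the constant term of one factor. *)
Lemma asymN_M M f g a b : asymN M f a -> asymN M g b ->
  asymN M (fun l => f l * g l) (conv a b).
Proof.
elim: M f g a b => [|M IH] f g a b fa gb.
  move=> c; have [K [r [K0 r0 H]]] := fa c; have [K' [r' [K0' r0' H']]] := gb c.
  exists (K * K'), (Num.min r r'); split; rewrite ?mulr_ge0 ?lt_min ?r0 // => l.
  rewrite le_min => /and3P[u0 ur ur'] sl; rewrite big_ord0 subr0 mulr1 absCM.
  have ul : 0 < absC (u l) <= r by rewrite u0.
  have ul' : 0 < absC (u l) <= r' by rewrite u0.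
  have := H l ul sl; have := H' l ul' sl.
  by rewrite !big_ord0 !subr0 !mulr1 => h1 h2; rewrite ler_pM ?absC_ge0.
have h1 := IH _ _ _ _ (asymN_behead fa) (asymNW gb).
have h2 := asymN_D (asymN_Z (a 0%N) gb) (asymN_cons 0 h1).
apply: eq_asymN h2 => [l ul|[|m] _ /=].
- by field.
- by rewrite /conv big_ord_recr big_ord0 /= add0r addr0.
- by rewrite [in RHS]/conv big_ord_recl /= subn0.
Qed.

Lemma near_asym f g a : near_sct (fun l => f l = g l) -> asym f a -> asym g a.
Proof. by move=> fg fa M; exact: near_asymN (fa M). Qed.

Lemma asym_cst z : asym (fun=> z) (fun m => if m is 0 then z else 0).
Proof. by move=> M; exact: asymN_cst. Qed.

Lemma asym_D f g a b : asym f a -> asym g b ->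
  asym (fun l => f l + g l) (fun m => a m + b m).
Proof. by move=> fa gb M; exact: asymN_D. Qed.

Lemma asym_Z f a z : asym f a -> asym (fun l => z * f l) (fun m => z * a m).
Proof. by move=> fa M; exact: asymN_Z. Qed.

Lemma asym_M f g a b : asym f a -> asym g b -> asym (fun l => f l * g l) (conv a b).
Proof. by move=> fa gb M; exact: asymN_M. Qed.

Lemma asym_sum (I : Type) (s : seq I) (f : I -> R[i] -> R[i]) (a : I -> nat -> R[i]) :
  (forall i, asym (f i) (a i)) ->
  asym (fun l => \sum_(i <- s) f i l) (fun m => \sum_(i <- s) a i m).
Proof.
move=> H; elim: s => [|i s IH].
  by apply: eq_asym (asym_cst 0) => [l _|[|m]]; rewrite big_nil.
by apply: eq_asym (asym_D (H i) IH) => [l _|m]; rewrite big_cons.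
Qed.

Lemma asym_cons f a z : asym f a ->
  asym (fun l => z + u l * f l) (fun m => if m is m'.+1 then a m' else z).
Proof. by move=> fa M; apply: asymNW; exact: asymN_cons. Qed.

Lemma asym_behead f a : asym f a ->
  asym (fun l => (f l - a 0%N) / u l) (fun m => a m.+1).
Proof. by move=> fa M; exact: asymN_behead. Qed.

Lemma asym_drop f a k : asym f a -> (forall m, (m < k)%N -> a m = 0) ->
  asym (fun l => f l / u l ^+ k) (fun m => a (m + k)%N).
Proof.
move=> fa; elim: k => [|k IH] az.
  by apply: eq_asym fa => [l _|m]; rewrite ?addn0 // divr1.
have H : asym (fun l => f l / u l ^+ k) (fun m => a (m + k)%N).
  by apply: IH => m mk; rewrite az // (leqW mk).
apply: eq_asym (asym_behead H) => [l ul|m]; last by rewrite addSnnS.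
by rewrite add0n az // subr0 exprSr invfM mulrA mulrAC.
Qed.

Lemma asym_poly (p : {poly R[i]}) : asym (fun l => p.[u l]) (fun m => p`_m).
Proof.
elim/poly_ind: p => [|p c IH].
  by apply: eq_asym (asym_cst 0) => [l _|[|m]]; rewrite ?horner0 ?coef0.
apply: eq_asym (asym_cons c IH) => [l _|m].
  by rewrite hornerMXaddC; ring.
by rewrite coefD coefMX coefC; case: m => [|m] /=; rewrite ?add0r ?addr0.
Qed.

Lemma asym_exp z : asym (fun l => expC (z * u l)) (fun m => z ^+ m / m`!%:R).
Proof.
move=> M c; exists (2 ^+ M * expR (absC z) * absC z ^+ M), 1; split=> //.
  by rewrite !mulr_ge0 ?expR_ge0 ?exprn_ge0 ?absC_ge0.
move=> l /andP[_ ul] _; have := expC_taylor (z * u l) M.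
have -> : \sum_(i < M) (z * u l) ^+ i / i`!%:R = \sum_(i < M) z ^+ i / i`!%:R * u l ^+ i.
  by apply: eq_bigr => i _; rewrite exprMn mulrAC.
move/le_trans; apply; rewrite absCM exprMn !mulrA ler_wpM2r ?exprn_ge0 ?absC_ge0 //.
rewrite ler_wpM2r ?exprn_ge0 ?absC_ge0 // ler_wpM2l ?exprn_ge0 // ler_expR.
by rewrite -[leRHS]mulr1 ler_wpM2l ?absC_ge0.
Qed.

Lemma asym_scale f a (phi : R[i] -> R[i]) kap : kap != 0 ->
  (forall l, u (phi l) = kap * u l) -> (forall c l, sct c l -> sct c (phi l)) ->
  asym f a -> asym (fun l => f (phi l)) (fun m => a m * kap ^+ m).
Proof.
move=> k0 uphi sphi fa M c; have [K [r [K0 r0 H]]] := fa M c.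
have kp : 0 < absC kap by rewrite absC_gt0.
exists (K * absC kap ^+ M), (r / absC kap).
split; rewrite ?divr_gt0 ?mulr_ge0 ?exprn_ge0 // ?ltW // => l /andP[ul ur] sl.
have h : 0 < absC (u (phi l)) <= r.
  by rewrite uphi absCM mulr_gt0 //= mulrC -ler_pdivlMr.
have := H _ h (sphi _ _ sl); rewrite uphi absCM exprMn mulrA.
congr (absC (_ - _) <= _); apply: eq_bigr => m _.
by rewrite exprMn mulrA.
Qed.

Section Uniqueness.
Hypothesis acc : exists c, forall r : R, 0 < r ->
  exists2 l, 0 < absC (u l) <= r & sct c l.

(** Expansions are unique as soon as some sector accumulates at 0. *)
Lemma asymN_unique M f a b : asymN M f a -> asymN M f b ->
  forall m, (m < M)%N -> a m = b m.
Proof.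
have [c acc'] := acc; move=> fa fb; elim/ltn_ind => m IH mM.
have [K [r [K0 r0 H]]] := asymN_le mM fa c.
have [K' [r' [K0' r0' H']]] := asymN_le mM fb c.
apply/eqP; rewrite -subr_eq0 -absC_eq0 eq_le absC_ge0 andbT; apply/ler_addgt0Pr => e e0.
rewrite add0r; pose q := Num.min (Num.min r r') (e / (K + K' + 1)).
have KK : 0 < K + K' + 1 by rewrite ltr_wpDl // addr_ge0.
have q0 : 0 < q by rewrite !lt_min r0 r0' divr_gt0.
have [l /andP[u0 uq] sl] := acc' q q0; move: uq; rewrite !le_min => /andP[/andP[ur ur'] ue].
have h : 0 < absC (u l) <= r by rewrite u0.
have h' : 0 < absC (u l) <= r' by rewrite u0.
have := H l h sl; have := H' l h' sl; rewrite !big_ord_recr /=.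
have -> : \sum_(i < m) b i * u l ^+ i = \sum_(i < m) a i * u l ^+ i.
  by apply: eq_bigr => i _; rewrite IH // (ltn_trans (ltn_ord i)).
set A := \sum_(i < m) _; move=> h1 h2.
have um : 0 < absC (u l) ^+ m by rewrite exprn_gt0.
rewrite -(ler_pM2r um) -absCX -absCM.
have -> : (a m - b m) * u l ^+ m =
  (f l - (A + b m * u l ^+ m)) - (f l - (A + a m * u l ^+ m)) by ring.
apply: le_trans (_ : K' * absC (u l) ^+ m.+1 + K * absC (u l) ^+ m.+1 <= _).
  by apply: le_trans (ler_absCD _ _) _; rewrite absCN lerD.
rewrite absCX exprS -!mulrDl mulrA ler_pM2r //.
apply: le_trans (_ : (K + K' + 1) * absC (u l) <= _).
  by rewrite ler_pM2r // [K' + K]addrC lerDl.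
by rewrite mulrC -ler_pdivlMr.
Qed.

Lemma asym_unique f a b : asym f a -> asym f b -> a =1 b.
Proof. by move=> fa fb m; exact: (asymN_unique (fa m.+1) (fb m.+1)). Qed.

(** Expansions to every finite order agree on their common part by uniqueness. *)
Lemma asym_of_asymN f : (forall M, exists a, asymN M f a) -> exists a, asym f a.
Proof.
move=> /choice[A fA]; exists (fun m => A m.+1 m) => M.
apply: eq_asymN (fA M) => // m mM.
by apply: (asymN_unique (asymN_le mM (fA M)) (fA m.+1)).
Qed.

End Uniqueness.

End Asymptotics.

Lemma ord2P (P : 'I_2 -> Prop) : P 0 -> P 1 -> forall i, P i.
Proof.
move=> P0 P1 i; case: (unliftP 0 i) => [j ->|-> //]; rewrite (ord1 j).
by rewrite (_ : lift 0 0 = 1) //; exact: val_inj.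
Qed.

Section MatrixAsymptotics.
Context {R : realType} (u : R[i] -> R[i]) (sct : R -> R[i] -> Prop).
Local Notation asym := (asym u sct).
Implicit Types (F G : R[i] -> 'M[R[i]]_2) (A B : nat -> 'M[R[i]]_2) (C : 'M[R[i]]_2).

Definition asymM F A : Prop :=
  forall i j, asym (fun l => F l i j) (fun m => A m i j).

Lemma eq_asymM F G A B : (forall l, u l != 0 -> F l = G l) -> A =1 B ->
  asymM F A -> asymM G B.
Proof.
move=> FG AB FA i j; apply: eq_asym (FA i j) => [l ul|m]; first by rewrite FG.
by rewrite AB.
Qed.

Lemma asymM_mulL C F A : asymM F A -> asymM (fun l => C *m F l) (fun m => C *m A m).
Proof.
move=> FA i j; apply: eq_asym (asym_sum _ (fun k => asym_Z (C i k) (FA k j))).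
- by move=> l _; rewrite mxE.
- by move=> m; rewrite mxE.
Qed.

Lemma asymM_mulR C F A : asymM F A -> asymM (fun l => F l *m C) (fun m => A m *m C).
Proof.
move=> FA i j; apply: eq_asym (asym_sum _ (fun k => asym_Z (C k j) (FA i k))).
- by move=> l _; rewrite mxE; apply: eq_bigr => k _; rewrite mulrC.
- by move=> m; rewrite mxE; apply: eq_bigr => k _; rewrite mulrC.
Qed.

Lemma asymM_mul F G A B : asymM F A -> asymM G B ->
  asymM (fun l => F l *m G l) (fps_mul A B).
Proof.
move=> FA GB i j; apply: eq_asym (asym_sum _ (fun k => asym_M (FA i k) (GB k j))).
- by move=> l _; rewrite mxE.
- move=> m; rewrite /fps_mul summxE exchange_big /=; apply: eq_bigr => d _.
  by rewrite mxE.
Qed.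

Lemma asymM_scale F A (phi : R[i] -> R[i]) kap : kap != 0 ->
  (forall l, u (phi l) = kap * u l) -> (forall c l, sct c l -> sct c (phi l)) ->
  asymM F A -> asymM (fun l => F (phi l)) (fun m => kap ^+ m *: A m).
Proof.
move=> k0 uphi sphi FA i j; apply: eq_asym (asym_scale k0 uphi sphi (FA i j)) => // m.
by rewrite mxE mulrC.
Qed.

Lemma asymM_exp c : asymM (fun l => xsigma3 (expC (c * u l)))
  (fun m => mx2 (c ^+ m / m`!%:R) 0 0 ((- c) ^+ m / m`!%:R)).
Proof.
have cst0 : asym (fun=> 0) (fun=> 0) by apply: eq_asym (asym_cst _ _ 0) => // -[].
apply: ord2P; apply: ord2P.
- by apply: eq_asym (asym_exp u sct c) => [l _|m]; rewrite !mxE.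
- by apply: eq_asym cst0 => [l _|m]; rewrite !mxE.
- by apply: eq_asym cst0 => [l _|m]; rewrite !mxE.
- by apply: eq_asym (asym_exp u sct (- c)) => [l _|m]; rewrite !mxE //= -expCN mulNr.
Qed.

Lemma asymM_unique F A B : (exists c, forall r : R, 0 < r ->
    exists2 l, 0 < absC (u l) <= r & sct c l) ->
  asymM F A -> asymM F B -> A =1 B.
Proof.
by move=> acc FA FB m; apply/matrixP => i j; exact: (asym_unique acc (FA i j) (FB i j)).
Qed.

End MatrixAsymptotics.

Lemma fps_mul0 (R : realType) (A B : nat -> 'M[R[i]]_2) : fps_mul A B 0 = A 0%N *m B 0%N.
Proof. by rewrite /fps_mul big_ord_recr big_ord0 /= add0r. Qed.

Lemma fps_mul1 (R : realType) (A B : nat -> 'M[R[i]]_2) :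
  fps_mul A B 1 = A 0%N *m B 1%N + A 1%N *m B 0%N.
Proof. by rewrite /fps_mul !big_ord_recr big_ord0 /= add0r. Qed.

(** * Expansions of the Cauchy integrals *)

Section CauchyExpansions.
Context {R : realType} (delta : R) (n : nat) (alpha : R[i]) (t : R).
Hypothesis delta0 : 0 < delta.
Hypothesis n0 : (0 < n)%N.
Local Notation on_G := (on_Gamma delta).
Local Notation S := (cauchy_mu delta n alpha t).
Local Notation mut := (mu delta n alpha t).

Definition sct_oo (c : R) (z : R[i]) : Prop := c < 1 /\ complex.Re z <= c * absC z.
Definition sct_0 (c : R) (z : R[i]) : Prop := 0 < c /\ c * absC z <= `|complex.Re z|.

Lemma sct_oo_acc : exists c : R, forall r : R, 0 < r ->
  exists2 l : R[i], 0 < absC l^-1 <= r & sct_oo c l.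
Proof.
exists 0 => r r0; exists (- r^-1)%:C.
  have ri : 0 <= r^-1 by rewrite invr_ge0 ltW.
  by rewrite absCV absCR normrN (ger0_norm ri) invrK lexx r0.
by split=> //=; rewrite mul0r oppr_le0 invr_ge0 ltW.
Qed.

Lemma sct_0_acc : exists c : R, forall r : R, 0 < r ->
  exists2 l : R[i], 0 < absC l <= r & sct_0 c l.
Proof.
exists 1 => r r0; exists r%:C; first by rewrite absCR (ger0_norm (ltW r0)) lexx r0.
by split=> //=; rewrite mul1r absCR.
Qed.

Lemma on_Gamma_real_or_small z : on_G z ->
  (exists2 x : R, 0 < x & z = x%:C) \/ absC z <= 2 * delta.
Proof.
case=> [[x xd ->]|[th _ [_ ->]]]; [left|right; exact: absC_circ_le].
by exists x => //; apply: lt_trans xd; rewrite mulr_gt0.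
Qed.

(** Off a sector around the positive axis the distance to the half-line is
   proportional to [|z|]; the circle is negligible once [|z| >= 4 delta]. *)
Lemma away_oo c : c < 1 -> exists2 e : R, 0 < e & exists2 r : R, 0 < r &
  forall z, 0 < absC z^-1 <= r -> complex.Re z <= c * absC z -> away delta z (e * absC z).
Proof.
move=> c1; pose c' := Num.max c 0; have c'0 : 0 <= c' by rewrite le_max lexx orbT.
have c'1 : c' < 1 by rewrite gt_max c1 ltr01.
(* The half-line allows the constant [1 - c'], the circle, where [|x| <= |z|/2],
   the constant [1/2]. *)
pose e := (1 - c') / 2; have e0 : 0 < e by rewrite divr_gt0 // subr_gt0.
exists e => //; exists (4 * delta)^-1; first by rewrite invr_gt0 mulr_gt0.
move=> z /andP[z0 zr] zc.
have zp : 0 < absC z by rewrite -invr_gt0 -absCV.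
have z4 : 4 * delta <= absC z by move: zr; rewrite absCV lef_pV2 // posrE mulr_gt0.
split=> [|x Gx]; first by rewrite mulr_gt0.
have [[y y0 ->]|xs] := on_Gamma_real_or_small Gx; last first.
  have H : absC z - absC x <= absC (x - z) by rewrite -(absCN (x - z)) opprB ler_absCB.
  have : e * absC z <= absC z / 2.
    by rewrite [leLHS]mulrC ler_pM2l // ler_pdivrMr // mulrC mulfV // gerBl.
  lra.
have zc' : complex.Re z <= c' * absC z.
  by apply: le_trans zc _; rewrite ler_pM2r // le_max lexx.
have ez : 0 <= e * absC z by rewrite mulr_ge0 ?absC_ge0 // ltW.
rewrite -(ler_pXn2r (n := 2)) ?nnegrE ?absC_ge0 //.
have sq (w : R[i]) : absC w ^+ 2 = complex.Re w ^+ 2 + complex.Im w ^+ 2.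
  by rewrite absCE sqr_sqrtr // addr_ge0 ?sqr_ge0.
have E : absC (y%:C - z) ^+ 2 = y ^+ 2 - 2 * y * complex.Re z + absC z ^+ 2.
  by rewrite !sq !ReImE /=; ring.
rewrite E; move: zc' zp; set Z := absC z; set X := complex.Re z => zc' zp.
apply: le_trans (_ : (1 - c') * Z ^+ 2 <= _).
  have e1 : e <= 1 by rewrite /e; lra.
  have e2 : e <= 1 - c' by rewrite /e; lra.
  by rewrite exprMn ler_wpM2r ?sqr_ge0 // expr2 -[leRHS]mulr1 ler_pM // ltW.
have h : 0 <= y * (c' * Z - X) by rewrite mulr_ge0 ?subr_ge0 // ltW.
have h2 : 0 <= (1 - c') * y ^+ 2 by rewrite mulr_ge0 ?sqr_ge0 // subr_ge0 ltW.
have h3 : 0 <= c' * (y - Z) ^+ 2 by rewrite mulr_ge0 ?sqr_ge0.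
have -> : y ^+ 2 - 2 * y * X + Z ^+ 2 = (1 - c') * Z ^+ 2 + (1 - c') * y ^+ 2
  + c' * (y - Z) ^+ 2 + 2 * (y * (c' * Z - X)) by ring.
lra.
Qed.

(** Inversion turns the contour into a set with bounded nonnegative real parts,
   and a small point of the double sector into one with a large real part. *)
Lemma away_0 c : 0 < c -> exists2 r : R, 0 < r &
  forall z, 0 < absC z <= r -> c * absC z <= `|complex.Re z| ->
  (forall x, on_G x -> c / 2 * absC x <= absC (x - z)) /\ exists d, away delta z d.
Proof.
(* For [|z| <= c delta] the real part of [1/z] is at least twice the bound
   [1/(2 delta)] valid on the contour. *)
move=> c0; exists (c * delta); first by rewrite mulr_gt0.
move=> z /andP[z0 zr] zc.
have zn : z != 0 by rewrite -absC_gt0.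
have key x : on_G x -> c / 2 * absC x <= absC (x - z).
  move=> Gx; have xn := on_Gamma_neq0 delta0 Gx; have /andP[h1 h2] := on_Gamma_inv delta0 n0 Gx.
  have -> : x - z = x * (z * (z^-1 - x^-1)) by field; rewrite zn xn.
  rewrite absCM mulrC ler_wpM2l ?absC_ge0 // absCM.
  have A : c / absC z <= `|complex.Re z^-1|.
    have -> : complex.Re z^-1 = complex.Re z / absC z ^+ 2.
      by rewrite ReV absCE sqr_sqrtr // addr_ge0 ?sqr_ge0.
    rewrite normrM normfV [`|absC z ^+ 2|]ger0_norm ?sqr_ge0 //.
    rewrite ler_pdivlMr ?exprn_gt0 // expr2 mulrA divfK ?gt_eqF //.
  have B : (2 * delta)^-1 <= c / absC z / 2.
    rewrite ler_pdivlMr // mulrC invfM mulrA mulfV // mul1r.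
    by rewrite -[leLHS]div1r ler_pdivrMr // mulrAC ler_pdivlMr // mul1r.
  have C : c / absC z / 2 <= absC (z^-1 - x^-1).
    apply: le_trans (ler_ReC _); rewrite ReD ReN.
    apply: le_trans (lerB_dist _ _); rewrite [`|complex.Re x^-1|]ger0_norm //; lra.
  apply: le_trans (ler_wpM2l (absC_ge0 z) C).
  by rewrite mulrA mulrA [absC z * c]mulrC mulfK ?gt_eqF.
split=> //; exists (c / 4 * absC z); split=> [|x Gx]; first by rewrite mulr_gt0 ?divr_gt0.
have c1 : c <= 1.
  by rewrite -(ler_pM2r z0) mul1r (le_trans zc) // ler_ReC.
have := key x Gx; have H0 : absC z - absC x <= absC (x - z) by rewrite -(absCN (x - z)) opprB ler_absCB.
move: H0.
have [h|h] := leP (absC z / 2) (absC x).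
  move=> _ /(le_trans _); apply.
  have := ler_wpM2l (ltW c0) h; rewrite -!mulrA; lra.
move=> H _; have : c * absC z <= absC z by rewrite -[leRHS]mul1r ler_pM2r.
have := H; lra.
Qed.

Lemma near_away_oo (P : R[i] -> Prop) :
  (forall z d, z != 0 -> away delta z d -> P z) -> near_sct GRing.inv sct_oo P.
Proof.
move=> H c; have [c1|c1] := ltP c 1; last by exists 1 => // l _ []; rewrite ltNge c1.
have [e e0 [r r0 Hr]] := away_oo c1; exists r => // z zr [_ zc].
apply: H (Hr z zr zc); by case/andP: zr => + _; rewrite absC_gt0 invr_eq0.
Qed.

Lemma near_away_0 (P : R[i] -> Prop) : (forall z d, away delta z d -> P z) ->
  near_sct id sct_0 P.
Proof.
move=> H c; have [c0|c0] := ltP 0 c; last by exists 1 => // l _ []; rewrite ltNge c0.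
by have [r r0 Hr] := away_0 c0; exists r => // z zr [_ zc]; have [_ [d /H]] := Hr z zr zc.
Qed.

(** [z ^ (j + 1) = z ^ j * ((z - z0) + z0)], the step of the geometric series in both
   directions. *)
Lemma cauchy_mu_shift z d j i : away delta z d -> S z j.+1 i.+1 = S z j i + z * S z j i.+1.
Proof.
move=> aw; have a1 := cauchy_mono_adm delta0 n0 j i aw.
have a2 := cauchy_mono_adm delta0 n0 j i.+1 aw.
rewrite /cauchy_mu -intGamma_Z // -intGamma_D //; last exact: admissible_Z.
apply: eq_intGamma => x Gx; rewrite /cauchy_mono.
have xz : x - z != 0 by apply: (away_neq aw); left.
have := expf_neq0 i xz; rewrite 2!exprS; move: (x ^+ j) (_ ^+ i) => X Y Y0.
by field; rewrite xz Y0.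
Qed.

Lemma cauchy_mu0 z j : S z j 0 = mut j.+1.
Proof.
rewrite -(momentE _ _ delta0) /cauchy_mu /moment; apply: eq_intGamma => x _.
by rewrite /cauchy_mono expr0 divr1.
Qed.

(** The geometric series in [1/z], whose remainder is again a Cauchy integral. *)
Lemma cauchy_mu_asym_oo j :
  asym GRing.inv sct_oo (fun z => z * S z j 1) (fun m => - mut (j + m).+1).
Proof.
move=> M; elim: M j => [|M IH] j.
  move=> c; have [c1|c1] := ltP c 1; last first.
    by exists 0, 1; split=> // l _ []; rewrite ltNge c1.
  have [e e0 [r r0 H]] := away_oo c1.
  have [C C0 HC] := intGamma_bound alpha delta0 n0 t (j + n).
  exists (C / e), r; split=> [|//|z zr [_ zc]]; first by rewrite divr_ge0 // ltW.
  have aw := H z zr zc; rewrite big_ord0 subr0 mulr1 absCM.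
  have zp : 0 < absC z by case/andP: zr => + _; rewrite absCV invr_gt0.
  apply: le_trans (ler_wpM2l (ltW zp) (HC _ _ (cauchy_mono_tame delta0 n0 j 1 aw))) _.
  by rewrite expr1 le_eqVlt; apply/orP; left; apply/eqP; field; rewrite !gt_eqF.
apply: (@near_asymN _ _ _ _ (fun z => - mut j.+1 + z^-1 * (z * S z j.+1 1))).
  apply: near_away_oo => z d zn aw; rewrite (cauchy_mu_shift j 0 aw) cauchy_mu0.
  by move: (mut j.+1) (S z j 1) => x y; field.
apply: eq_asymN (asymN_cons _ (IH j.+1)) => // -[|m] _; first by rewrite addn0.
by rewrite addnS addSn.
Qed.

Local Notation asymN0 := (asymN id sct_0).

(** The proportional lower bound on [|x - z|] absorbs as many poles as there are
   powers of [x]. *)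
Let cauchy_mu_bounded j i : (i <= j)%N -> asymN0 0 (fun z => S z j i) (fun=> 0).
Proof.
move=> ij c; have [c0|c0] := ltP 0 c; last first.
  by exists 0, 1; split=> // l _ []; rewrite ltNge c0.
have [r r0 H] := away_0 c0.
have [C C0 HC] := intGamma_bound alpha delta0 n0 t (j - i + n).
have c2 : 0 < c / 2 by rewrite divr_gt0.
exists (C * (c / 2)^-1 ^+ i), r; split=> //.
  by rewrite mulr_ge0 // exprn_ge0 // invr_ge0 ltW.
move=> z zr [_ zc]; have [low [d aw]] := H z zr zc.
rewrite big_ord0 subr0 mulr1; apply: HC.
apply: (tameG_intro delta0 n0).
  by apply: cauchy_mono_diff => x Gx; apply: (away_neq aw); left.
move=> x Gx; have xp : 0 < absC x by rewrite absC_gt0 (on_Gamma_neq0 delta0 Gx).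
rewrite /cauchy_mono absCM absCV !absCX.
apply: le_trans (_ : absC x ^+ j / (c / 2 * absC x) ^+ i * absC x ^+ n <= _).
  rewrite ler_pM2r ?exprn_gt0 // ler_pM2l ?exprn_gt0 // lef_pV2 ?posrE ?exprn_gt0 ?mulr_gt0 //.
    by rewrite lerXn2r ?nnegrE ?absC_ge0 ?mulr_ge0 ?low // ltW.
  by apply: lt_le_trans (low x Gx); rewrite mulr_gt0.
have -> : absC x ^+ j / (c / 2 * absC x) ^+ i * absC x ^+ n =
    (c / 2)^-1 ^+ i * absC x ^+ (j - i + n).
  rewrite exprMn invfM exprVn -{1}(subnK ij) !exprD.
  by field; rewrite !expf_neq0 ?gt_eqF.
by rewrite ler_wpM2l ?exprn_ge0 ?invr_ge0 ?(ltW c2) // lerDr.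
Qed.

(** Each step of the geometric series costs one power, so that order [M] is reached
   directly when the degree exceeds the number of poles by [M]. *)
Let cauchy_mu_asymN_high M i j : (i + M <= j)%N ->
  exists a, asymN0 M (fun z => S z j i) a.
Proof.
elim: M i j => [|M IHM] i j ij.
  by exists (fun=> 0); apply: cauchy_mu_bounded; rewrite addn0 in ij.
elim: i j ij => [|i IHi] [|j] ij; rewrite ?addn0 ?addnS //.
- exists (fun m => if m is 0 then mut j.+2 else 0).
  by apply: eq_asymN (asymN_cst _ _ _ (mut j.+2)) => // z _; rewrite cauchy_mu0.
have [a Ha] := IHi j ij.
have [|b Hb] := IHM i.+1 j; first by rewrite addSn; move: ij; rewrite addSn addnS ltnS.
exists (fun m => a m + if m is m'.+1 then b m' else 0).
apply: near_asymN (asymN_D Ha (asymN_cons 0 Hb)).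
by apply: near_away_0 => z d aw; rewrite (cauchy_mu_shift j i aw) add0r.
Qed.

Hypothesis t0 : t != 0.
Let ntC : n%:R * t%:C != 0 :> R[i].
Proof.
by rewrite mulf_neq0 ?pnatr_eq0 -?lt0n // eq_complex /= negb_and t0.
Qed.

(** The Pearson equation trades a Cauchy integral for others of higher degree; the
   excess of poles and order over the degree decreases each time. *)
Let cauchy_mu_asymN M i j : exists a, asymN0 M (fun z => S z j i) a.
Proof.
have [d] := ubnP (i + M - j); elim: d i j => [|d IH] i j; first by rewrite ltn0.
rewrite ltnS => Hd; have [|ji] := leqP (i + M) j; first exact: cauchy_mu_asymN_high.
have lt1 : (i + M - j.+1 < d)%N by rewrite (leq_trans _ Hd) // ltn_sub2l.
have [|a Ha] := IH i j.+2; first by rewrite (leq_ltn_trans _ lt1) // leq_sub2l.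
have [|b Hb] := IH i.+1 j.+2; first by rewrite addSn subSS.
have [|e He] := IH i j.+1; first exact: lt1.
exists (fun m => (n%:R * t%:C)^-1 * (n%:R * a m + i%:R * b m + (- (j.+2 + n)%:R) * e m)).
apply: near_asymN (asymN_Z (n%:R * t%:C)^-1 (asymN_D (asymN_D (asymN_Z n%:R Ha)
  (asymN_Z i%:R Hb)) (asymN_Z (- (j.+2 + n)%:R) He))).
apply: near_away_0 => z dd aw; have E := cauchy_mu_rec alpha delta0 n0 t j i aw.
apply: (mulfI ntC); rewrite E mulrA mulfV // mul1r.
by move: (S z _ _) (S z _ _) (S z _ _) (j.+2 + n)%N => x y w N; ring.
Qed.

(** Once expansions are known to exist, the geometric step and the Pearson equation
   identify their first coefficients with the moments. *)
Lemma cauchy_mu_asym_0 : exists a : nat -> nat -> R[i],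
  [/\ forall j, asym id sct_0 (fun z => S z j 1) (a j),
      forall j, a j 0%N = mut j & forall j m, a j.+1 m.+1 = a j m].
Proof.
have acc := sct_0_acc.
have ex i j : exists a, asym id sct_0 (fun z => S z j i) a.
  by apply: asym_of_asymN => // M; exact: cauchy_mu_asymN.
have shift i j a a' : asym id sct_0 (fun z => S z j i) a ->
    asym id sct_0 (fun z => S z j i.+1) a' ->
    asym id sct_0 (fun z => S z j.+1 i.+1) (fun m => a m + if m is m'.+1 then a' m' else 0).
  move=> Ha Ha' M; apply: near_asymN (asymN_D (Ha M) (asym_cons 0 Ha' M)).
  by apply: near_away_0 => z d aw; rewrite (cauchy_mu_shift j i aw) add0r.
have [a Ha] := choice (ex 1%N); have [b Hb] := choice (ex 2%N).
have cst j : asym id sct_0 (fun z => S z j 0) (fun m => if m is 0 then mut j.+1 else 0).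
  by apply: eq_asym (asym_cst _ _ (mut j.+1)) => // z _; rewrite cauchy_mu0.
have aS j : a j.+1 =1 (fun m => (if m is 0 then mut j.+1 else 0) + if m is m'.+1 then a j m' else 0).
  by apply: (asym_unique acc (Ha j.+1)); exact: shift.
have bS j : b j.+1 =1 (fun m => a j m + if m is m'.+1 then b j m' else 0).
  by apply: (asym_unique acc (Hb j.+1)); exact: shift.
exists a; split=> // [[|j]|j m]; last by rewrite aS add0r.
  have H := asym_D (asym_D (asym_Z n%:R (Ha 2%N)) (Hb 2%N)) (asym_Z (- (2 + n)%:R) (Ha 1%N)).
  have E : asym id sct_0 (fun z => n%:R * t%:C * S z 0 1)
      (fun m => n%:R * a 2%N m + b 2%N m + - (2 + n)%:R * a 1%N m).
    move=> M; apply: near_asymN (H M); apply: near_away_0 => z d aw.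
    rewrite (cauchy_mu_rec alpha delta0 n0 t 0 1 aw).
    by move: (S z _ _) (S z _ _) (S z _ _) (2 + n)%N => x y w N; ring.
  have := asym_unique acc (asym_Z (n%:R * t%:C) (Ha 0%N)) E 0%N.
  have a20 : a 2%N 0%N = mut 2 := etrans (aS 1%N 0%N) (addr0 _).
  have a10 : a 1%N 0%N = mut 1 := etrans (aS 0%N 0%N) (addr0 _).
  have b20 : b 2%N 0%N = mut 1 := etrans (etrans (bS 1%N 0%N) (addr0 _)) a10.
  have := mu_rec alpha delta0 n0 t 0; rewrite a20 a10 b20.
  move: (mut 0) (mut 1) (mut 2) (a 0%N 0%N) => x y z w R0 H0; apply: (mulfI ntC); rewrite H0.
  apply/eqP; rewrite -subr_eq0 -oppr_eq0; apply/eqP; rewrite -[RHS]R0.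
  by rewrite !natrD; ring.
by rewrite aS addr0.
Qed.

End CauchyExpansions.

(** * Expansions of the Riemann-Hilbert matrix *)

Section RiemannHilbert.
Context {R : realType} (delta : R) (n : nat) (alpha : R[i]) (t : R).
Hypothesis delta0 : 0 < delta.
Hypothesis n0 : (0 < n)%N.
Hypothesis t0 : t < 0.
Local Notation S := (cauchy_mu delta n alpha t).
Local Notation mut := (mu delta n alpha t).
Local Notation Cauchy := (Defs.cauchy delta n alpha t).

Lemma cauchyE z d (p : {poly R[i]}) : away delta z d -> Cauchy p z = \sum_(i < size p) p`_i * S z i 1.
Proof.
move=> aw; have adm i := admissible_Z p`_i (cauchy_mono_adm delta0 n0 i 1 aw).
transitivity (intGamma delta n alpha t
    (fun x => \sum_(i < size p) p`_i * cauchy_mono z i 1 x)).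
  apply: eq_intGamma => x Gx; rewrite horner_coef mulr_suml.
  by apply: eq_bigr => i _; rewrite /cauchy_mono expr1 mulrA.
rewrite intGamma_sum //; apply: eq_bigr => i _; rewrite intGamma_Z //.
exact: (cauchy_mono_adm delta0 n0 i 1 aw).
Qed.

Lemma Lmom_mulXn (m : nat -> R[i]) (p : {poly R[i]}) j :
  Lmom m (p * 'X^j) = \sum_(i < size p) p`_i * m (i + j).+1.
Proof.
rewrite -{1}(coefK p) poly_def mulr_suml Lmom_sum; apply: eq_bigr => i _.
by rewrite -scalerAl -exprD LmomZ LmomXn.
Qed.

Lemma cauchy_asym_oo (p : {poly R[i]}) :
  asym GRing.inv sct_oo (fun z => z * Cauchy p z) (fun m => - Lmom mut (p * 'X^m)).
Proof.
have H := asym_sum (index_enum 'I_(size p)) (fun i : 'I_(size p) =>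
  asym_Z p`_i (cauchy_mu_asym_oo alpha t delta0 n0 i)).
have E : asym GRing.inv sct_oo
    (fun z => \sum_(i < size p) p`_i * (z * S z i 1)) (fun m => - Lmom mut (p * 'X^m)).
  apply: eq_asym H => // m; rewrite Lmom_mulXn -sumrN; apply: eq_bigr => i _.
  by rewrite mulrN.
apply: near_asym E; apply: (near_away_oo delta0) => z d _ aw.
by rewrite (cauchyE p aw) mulr_sumr; apply: eq_bigr => i _; rewrite mulrCA.
Qed.

Lemma cauchy_asym_0 : exists a : nat -> nat -> R[i],
  [/\ forall p, asym id sct_0 (Cauchy p) (fun m => Lam (a^~ m) p),
    forall j, a j 0%N = mut j & forall j, a j.+1 1%N = mut j].
Proof.
have [|a [Ha a0 aS]] := @cauchy_mu_asym_0 R delta n alpha t delta0 n0 _.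
  by rewrite lt_eqF.
exists a; split=> // [p|j]; last by rewrite aS a0.
have H := asym_sum (index_enum 'I_(size p)) (fun i : 'I_(size p) => asym_Z p`_i (Ha i)).
apply: near_asym H; apply: (near_away_0 delta0 n0) => z d aw.
by rewrite (cauchyE p aw).
Qed.

Lemma poly_asym_oo (p : {poly R[i]}) k : (size p <= k.+1)%N ->
  asym GRing.inv sct_oo (fun z => p.[z] / z ^+ k)
    (fun m => if (m <= k)%N then p`_(k - m) else 0).
Proof.
move=> sp; pose P := \poly_(i < k.+1) p`_(k - i).
apply: eq_asym (asym_poly GRing.inv sct_oo P) => [z zV|m]; last by rewrite coef_poly ltnS.
have z0 : z != 0 by rewrite -invr_eq0.
rewrite horner_poly (horner_coef_wide _ sp) mulr_suml (reindex_inj rev_ord_inj) /=.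
apply: eq_bigr => i _; rewrite subSS subKn -1?ltnS // -mulrA; congr (_ * _).
have ik : (i <= k)%N by rewrite -ltnS.
have -> : z ^+ k = z ^+ (k - i) * z ^+ i by rewrite -exprD subnK.
by rewrite exprVn invfM [RHS]mulrC mulfVK ?expf_neq0.
Qed.

(** Orthogonality cancels the first [k] terms. *)
Lemma cauchy_orth_asym_oo k p : orth mut k p ->
  asym GRing.inv sct_oo (fun z => z ^+ k.+1 * Cauchy p z)
    (fun m => - Lmom mut (p * 'X^(m + k))).
Proof.
move=> [_ _ po]; have H := asym_drop (cauchy_asym_oo p) (k := k).
apply: eq_asym (H _) => // [z zV|m mk]; last by rewrite po // oppr0.
by rewrite exprVn invrK exprSr; move: (Cauchy p z) => x; ring.
Qed.

Section Degree.
Context (k : nat) (p q : {poly R[i]}).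
Hypothesis pP : is_pi delta n alpha t k p.
Hypothesis qP : is_pi_pred delta n alpha t k q.
Local Notation Y := (Ymx delta n alpha t k p q).

Let po : orth mut k p. Proof. by have [/(orthopolyE alpha delta0 n0)] := pP. Qed.

Let ipi2 : R[i] := 2 * pi%:C * iC R.
Let ipi2_neq0 : ipi2 != 0.
Proof.
rewrite !mulf_neq0 ?pnatr_eq0 // eq_complex /= ?eqxx ?andbT ?gt_eqF ?pi_gt0 ?ltr01 //.
Qed.

Definition subl : R[i] := ('X * p)`_k.

Let norm_neq0 k' : k = k'.+1 -> orth mut k' q /\ opnorm mut k' q != 0.
Proof.
move=> E; move: pP qP; rewrite E => H1 H2.
have [D1 _] := is_pi_det delta0 n0 H1; have [D0 qE] := is_pi_det delta0 n0 H2.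
have qo : orth mut k' q by rewrite qE; exact: opoly_orth.
by split=> //; exact: opnorm_neq0 D1 qo.
Qed.

Let gammaE k' : gamma_sq delta n alpha t k' q = (opnorm mut k' q)^-1.
Proof.
rewrite /gamma_sq /opnorm -(intGamma_horner alpha delta0 n0); congr (intGamma _ _ _ _ _)^-1.
by apply/funext => z; rewrite hornerM hornerXn.
Qed.

(** The second diagonal entry is governed by [int q z ^ k w], which equals minus the
   subleading coefficient of [p] times the norm of [q] since [p] and [q] are
   orthogonal. *)
Lemma Y_asym_oo : exists B : nat -> 'M[R[i]]_2,
  [/\ asymM GRing.inv sct_oo (fun z => Y z *m xsigma3 (z ^+ k)^-1) B,
      B 0%N = 1%:M, B 1%N 0 0 = subl & B 1%N 1 1 = - subl].
Proof.
have [_ sp _] := po.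
have h00 := poly_asym_oo (p := p) (k := k); rewrite sp in h00.
have h01 := asym_cons 0 (asym_Z ipi2^-1 (cauchy_orth_asym_oo po)).
have e00 z : (Y z *m xsigma3 (z ^+ k)^-1) 0 0 = p.[z] / z ^+ k.
  by rewrite /Ymx; case: (k) => [|k']; rewrite !mxE !big_ord_recr big_ord0 /= !mxE /=; ring.
have e01 z : (Y z *m xsigma3 (z ^+ k)^-1) 0 1 = z ^+ k * (Cauchy p z / ipi2).
  by rewrite /Ymx; case: (k) => [|k']; rewrite !mxE !big_ord_recr big_ord0 /= !mxE /= invrK -/ipi2;
    move: (Cauchy p z / ipi2) => y; ring.
have a01 : asym GRing.inv sct_oo (fun z => (Y z *m xsigma3 (z ^+ k)^-1) 0 1)
    (fun m => if m is m'.+1 then ipi2^-1 * (- Lmom mut (p * 'X^(m' + k))) else 0).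
  apply: eq_asym h01 => // z zV; rewrite e01; have z0 : z != 0 by rewrite -invr_eq0.
  by rewrite add0r exprS; move: (Cauchy p z) ipi2_neq0 => y; move: ipi2 => w w0; field; rewrite z0 w0.
have cst (z : R[i]) : asym GRing.inv sct_oo (fun=> z) (fun m => if m is 0 then z else 0).
  exact: asym_cst.
have [E|[k' E]] : k = 0%N \/ exists k', k = k'.+1 by case: (k) => [|k']; [left|right; exists k'].
  exists (fun m => mx2 (if (m <= k)%N then p`_(k - m) else 0)
    (if m is m'.+1 then ipi2^-1 * (- Lmom mut (p * 'X^(m' + k))) else 0) 0 (if m is 0 then 1 else 0)).
  split.
  - apply: ord2P; apply: ord2P.
    + apply: eq_asym (h00 _) => [z _|m|]; rewrite ?e00 ?mxE //.
    + by apply: eq_asym a01 => // m; rewrite mxE.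
    + apply: (eq_asym _ _ (cst 0)) => [z _|[|m]]; rewrite ?mxE // E /Ymx.
      by rewrite !big_ord_recr big_ord0 /= !mxE /=; ring.
    + apply: (eq_asym _ _ (cst 1)) => [z _|[|m]]; rewrite ?mxE // E /Ymx.
      by rewrite !big_ord_recr big_ord0 /= !mxE /= expr0 invrK; ring.
  - apply/matrixP; apply: ord2P; apply: ord2P; rewrite !mxE //=.
    by rewrite subn0 (orth_lead po).
  - by rewrite !mxE /subl E /= coefXM.
  - by rewrite !mxE /subl E /= coefXM oppr0.
have [qo g0] := norm_neq0 E; have [_ sq _] := qo.
set g := opnorm mut k' q in g0.
have h10 := asym_cons 0 (asym_Z (- ipi2 / g) (poly_asym_oo (p := q) (k := k') _)).
rewrite sq in h10; have {h10}h10 := h10 (leqnn _).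
have h11 := asym_Z (- g^-1) (cauchy_orth_asym_oo qo).
exists (fun m => mx2 (if (m <= k)%N then p`_(k - m) else 0)
    (if m is m'.+1 then ipi2^-1 * (- Lmom mut (p * 'X^(m' + k))) else 0)
    (if m is m'.+1 then (- ipi2 / g) * (if (m' <= k')%N then q`_(k' - m') else 0) else 0)
    ((- g^-1) * (- Lmom mut (q * 'X^(m + k'))))).
split.
- apply: ord2P; apply: ord2P.
  + apply: eq_asym (h00 _) => [z _|m|]; rewrite ?e00 ?mxE //.
  + by apply: eq_asym a01 => // m; rewrite mxE.
  + apply: eq_asym h10 => [z zV|m]; last by rewrite mxE.
    have z0 : z != 0 by rewrite -invr_eq0.
    rewrite E /Ymx !mxE !big_ord_recr big_ord0 /= !mxE /= -/ipi2 gammaE -/g.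
    by have := expf_neq0 k' z0; rewrite exprS; move: (z ^+ k') => y y0; field; rewrite y0 z0 g0.
  + apply: eq_asym h11 => [z zV|m]; last by rewrite mxE.
    rewrite E /Ymx !mxE !big_ord_recr big_ord0 /= !mxE /= gammaE -/g invrK.
    by move: (Cauchy q z) => y; ring.
- apply/matrixP; apply: ord2P; apply: ord2P; rewrite !mxE //=.
    by rewrite subn0 (orth_lead po).
  by rewrite mulrNN add0n -/(opnorm mut k' q) -/g mulVf.
- by rewrite !mxE /subl E /= subSS subn0 coefXM.
- rewrite !mxE /= mulrNN /subl E coefXM /= add1n.
  have pq : Lmom mut (p * q) = 0.
    by apply: (orth_mul0 po); rewrite sq E.
  have su : (size (p - 'X^(k'.+1))%R <= k'.+1)%N.
    apply/leq_sizeP => j; rewrite leq_eqVlt => /predU1P[<-|kj]; rewrite coefB coefXn.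
      by rewrite eqxx -E (orth_lead po) subrr.
    by rewrite gtn_eqF // subr0 nth_default // sp E.
  have : Lmom mut (q * ('X^(k'.+1) + (p - 'X^(k'.+1)))) = 0.
    by rewrite addrC subrK mulrC.
  rewrite mulrDr LmomD (orth_mul qo su) coefB coefXn ltn_eqF // subr0 -/g => /eqP.
  by rewrite addr_eq0 => /eqP ->; field.
Qed.

Lemma mx2_inv (a b c d : R[i]) : a * d - b * c = 1 ->
  mx2 a b c d \in unitmx /\ invmx (mx2 a b c d) = mx2 d (- b) (- c) a.
Proof.
move=> H; have E : mx2 a b c d *m mx2 d (- b) (- c) a = 1%:M.
  apply/matrixP; apply: ord2P; apply: ord2P; rewrite !mxE !big_ord_recr big_ord0 /= !mxE /=.
  - by rewrite mulr1n -H; ring.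
  - by rewrite mulr0n; ring.
  - by rewrite mulr0n; ring.
  - by rewrite mulr1n -H; ring.
have [U _] := mulmx1_unit E; split=> //.
by rewrite -[LHS]mulmx1 -E mulmxA mulVmx // mul1mx.
Qed.

(** The logarithmic derivative of the matrix at 0 is traceless, which removes the
   second moments [int p w / z ^ 2]; [trace_identity] evaluates the rest. *)
Lemma Y_asym_0 : exists B : nat -> 'M[R[i]]_2,
  [/\ asymM id sct_0 Y B, B 0%N \in unitmx &
      n%:R * t%:C * ((invmx (B 0%N) *m B 1%N) 0 0 - (invmx (B 0%N) *m B 1%N) 1 1) =
      2 * (n%:R * subl + (k * (k + n))%:R)].
Proof.
have [a [Ha a0 a1]] := cauchy_asym_0.
have L0 f : Lam (a^~ 0%N) f = Lam mut f by apply: eq_bigr => i _; rewrite a0.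
have L1 f : Lam (a^~ 1%N) ('X * f) = Lam mut f.
  rewrite -/(Lmom _ _) (Lmom_wide _ (leqnn (size f))) /Lam.
  by apply: eq_bigr => i _; rewrite a1.
have hp := asym_poly id sct_0 p; have hq := asym_poly id sct_0 q.
have hcp := asym_Z ipi2^-1 (Ha p).
have cst (z : R[i]) : asym id sct_0 (fun=> z) (fun m => if m is 0 then z else 0).
  exact: asym_cst.
have [E|[k' E]] : k = 0%N \/ exists k', k = k'.+1 by case: (k) => [|k']; [left|right; exists k'].
  exists (fun m => mx2 p`_m (ipi2^-1 * Lam (a^~ m) p) 0 (if m is 0 then 1 else 0)).
  have [_ sp _] := po; have p0 : p`_0 = 1 by have := orth_lead po; rewrite E.
  have p1 : p`_1 = 0 by rewrite nth_default // sp E.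
  have [|U V] := @mx2_inv p`_0 (ipi2^-1 * Lam (a^~ 0%N) p) 0 1.
    by rewrite p0 mulr0 mulr1 subr0.
  split=> //.
  - apply: ord2P; apply: ord2P.
    + by apply: eq_asym hp => [z _|m]; rewrite ?E /Ymx !mxE.
    + by apply: eq_asym hcp => [z _|m]; rewrite ?E /Ymx !mxE // mulrC.
    + by apply: (eq_asym _ _ (cst 0)) => [z _|[|m]]; rewrite ?E /Ymx !mxE.
    + by apply: (eq_asym _ _ (cst 1)) => [z _|[|m]]; rewrite ?E /Ymx !mxE.
  - rewrite V !mxE !big_ord_recr !big_ord0 /= !mxE /= p1 /subl !E coefXM /= mul0n.
    by move: (ipi2^-1 * _) => x; ring.
have [qo g0] := norm_neq0 E; have po' := po; rewrite E in po'.
set g := opnorm mut k' q in g0.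
have hcq := asym_Z (- g^-1) (Ha q); have hq' := asym_Z (- ipi2 / g) hq.
exists (fun m => mx2 p`_m (ipi2^-1 * Lam (a^~ m) p) (- ipi2 / g * q`_m)
  (- g^-1 * Lam (a^~ m) q)).
have SY := Lam_pq_sym po' qo; rewrite -/g in SY.
have [|U V] := @mx2_inv p`_0 (ipi2^-1 * Lam (a^~ 0%N) p) (- ipi2 / g * q`_0)
  (- g^-1 * Lam (a^~ 0%N) q).
  rewrite !L0; transitivity ((q`_0 * Lam mut p - p`_0 * Lam mut q) / g).
    by move: (Lam mut p) (Lam mut q) => x y; field; rewrite g0 ipi2_neq0.
  by rewrite SY addrAC subrr add0r mulfV.
split=> //.
- apply: ord2P; apply: ord2P.
  + by apply: eq_asym hp => [z _|m]; rewrite ?E /Ymx !mxE.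
  + by apply: eq_asym hcp => [z _|m]; rewrite ?E /Ymx !mxE // mulrC.
  + apply: eq_asym hq' => [z _|m]; rewrite ?E /Ymx !mxE //= gammaE -/g -/ipi2.
    by rewrite mulNr.
  + by apply: eq_asym hcq => [z _|m]; rewrite ?E /Ymx !mxE //= gammaE.
have C2 : q`_0 * Lam (a^~ 1%N) p - p`_0 * Lam (a^~ 1%N) q =
    p`_1 * Lam mut q - q`_1 * Lam mut p.
  by rewrite -(Lam_cd0 po' qo) -L1 (cd0E po' qo) LamB !LamZ.
have TI := trace_identity (mu_rec alpha delta0 n0 t) po' qo; rewrite -/g in TI.
rewrite V !mxE !big_ord_recr !big_ord0 /= !mxE /= !L0 /subl E coefXM /=.
have -> : (k'.+1 * (k'.+1 + n))%:R = k'.+1%:R * (k'.+1 + n)%:R :> R[i] by rewrite natrM.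
have -> : 2 * (n%:R * p`_k' + k'.+1%:R * (k'.+1 + n)%:R) =
    - 2 / g * (- (n%:R * p`_k' + k'.+1%:R * (k'.+1 + n)%:R) * g).
  by move: (k'.+1 + n)%N => N; field.
rewrite -TI; move: C2; move: (Lam mut p) (Lam mut q) (Lam _ p) (Lam _ q) => P Q P2 Q2 C2.
transitivity (n%:R * t%:C * (2 * (q`_1 * P - p`_1 * Q) / g
   - (q`_0 * P2 - p`_0 * Q2 - (p`_1 * Q - q`_1 * P)) / g)).
  by field; rewrite g0 ipi2_neq0.
by rewrite C2 subrr mul0r subr0; ring.
Qed.

End Degree.
End RiemannHilbert.

(** * The isomonodromic expansions and the residues *)

Section Expansions.
Context {R : realType}.
Implicit Types (F : R[i] -> 'M[R[i]]_2) (A : nat -> 'M[R[i]]_2).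

Let remE F A M u l i j : (F l - \sum_(m < M) u ^+ m *: A m) i j =
  F l i j - \sum_(m < M) A m i j * u ^+ m.
Proof.
rewrite !mxE summxE; congr (_ - _); apply: eq_bigr => m _.
by rewrite mxE mulrC.
Qed.

Lemma expansion_ooP F A : expansion_oo F A <-> asymM GRing.inv sct_oo F A.
Proof.
split=> H.
  move=> i j M c; have [c1|c1] := ltP c 1; last by exists 0, 1; split=> // l _ []; rewrite ltNge c1.
  have [K [rho Hr]] := H c M c1; pose r := Num.max rho 1.
  have r0 : 0 < r by rewrite lt_max ltr01 orbT.
  exists `|K|, r^-1; split; rewrite ?invr_gt0 // => l /andP[l0 lr] [_ lc].
  have lp : 0 < absC l by rewrite -invr_gt0 -absCV.
  have rl : rho <= absC l.
    by move: lr; rewrite absCV lef_pV2 ?posrE // ge_max => /andP[].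
  rewrite -remE absCV; apply: le_trans (Hr l rl lc i j) _.
  by rewrite ler_wpM2r ?ler_norm // exprn_ge0 // invr_ge0 ltW.
move=> c M c1.
have /choice[f Hf] (x : 'I_2 * 'I_2) : exists y : R * R, [/\ 0 <= y.1, 0 < y.2 &
    forall l, 0 < absC l^-1 <= y.2 -> sct_oo c l ->
    absC (F l x.1 x.2 - \sum_(m < M) A m x.1 x.2 * l^-1 ^+ m) <= y.1 * absC l^-1 ^+ M].
  by have [K [r Hr]] := H x.1 x.2 M c; exists (K, r).
exists (\sum_x (f x).1), (\sum_x ((f x).2)^-1) => l ll lc i j.
have [K0 r0 Hl] := Hf (i, j).
have rpos x : 0 <= ((f x).2)^-1 by have [_ /ltW] := Hf x; rewrite invr_ge0.
have r1 : ((f (i, j)).2)^-1 <= absC l.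
  by apply: le_trans ll; rewrite (bigD1 (i, j)) //= lerDl sumr_ge0.
have lp : 0 < absC l by apply: lt_le_trans r1; rewrite invr_gt0.
rewrite remE; apply: le_trans (Hl l _ _) _; rewrite ?absCV //.
  by rewrite invr_gt0 lp -[leRHS]invrK lef_pV2 ?posrE ?invr_gt0.
rewrite ler_wpM2r ?exprn_ge0 ?invr_ge0 ?absC_ge0 // (bigD1 (i, j)) //= lerDl.
by apply: sumr_ge0 => x _; have [] := Hf x.
Qed.

Lemma expansion_0P F A : expansion_0 F A <-> asymM id sct_0 F A.
Proof.
split=> H.
  move=> i j M c; have [c1|c1] := ltP 0 c; last by exists 0, 1; split=> // l _ []; rewrite ltNge c1.
  have [K [r [r0 Hr]]] := H c M c1.
  exists `|K|, r; split=> // l lr [_ lc].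
  rewrite -remE; apply: le_trans (Hr l lr lc i j) _.
  by rewrite ler_wpM2r ?ler_norm // exprn_ge0 // absC_ge0.
move=> c M c1.
have /choice[f Hf] (x : 'I_2 * 'I_2) : exists y : R * R, [/\ 0 <= y.1, 0 < y.2 &
    forall l, 0 < absC l <= y.2 -> sct_0 c l ->
    absC (F l x.1 x.2 - \sum_(m < M) A m x.1 x.2 * l ^+ m) <= y.1 * absC l ^+ M].
  by have [K [r Hr]] := H x.1 x.2 M c; exists (K, r).
have rpos x : 0 < ((f x).2)^-1 by have [_ h _] := Hf x; rewrite invr_gt0.
have spos : 0 < \sum_x ((f x).2)^-1.
  rewrite (bigD1 (ord0, ord0)) //= ltr_pwDl ?rpos // sumr_ge0 // => x _.
  exact: ltW.
exists (\sum_x (f x).1), (\sum_x ((f x).2)^-1)^-1; rewrite invr_gt0; split=> // l.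
move=> /andP[l0 lr] lc i j; have [K0 r0 Hl] := Hf (i, j).
have r1 : absC l <= (f (i, j)).2.
  apply: le_trans lr _; rewrite -[leRHS]invrK lef_pV2 ?posrE // (bigD1 (i, j)) //=.
  by rewrite lerDl sumr_ge0 // => x _; exact: ltW.
rewrite remE; apply: le_trans (Hl l _ _) _; rewrite ?l0 //.
rewrite ler_wpM2r ?exprn_ge0 ?absC_ge0 // (bigD1 (i, j)) //= lerDl.
by apply: sumr_ge0 => x _; have [] := Hf x.
Qed.

Lemma fps_inv0 A : fps_inv A 0 = 1%:M.
Proof. by rewrite /fps_inv big_ord_recr big_ord0 /= add0r. Qed.

Lemma sum_ord2 (V : nmodType) (f : 'I_2 -> V) : \sum_i f i = f 0 + f 1.
Proof.
by rewrite !big_ord_recl big_ord0 addr0; congr (_ + f _); exact: val_inj.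
Qed.

Lemma mulmx2E (M N : 'M[R[i]]_2) i j : (M *m N) i j = M i 0 * N 0 j + M i 1 * N 1 j.
Proof. by rewrite mxE sum_ord2. Qed.

Let tr_sigma3 (M : 'M[R[i]]_2) c : \tr (M *m (c *: sigma3 R)) = c * (M 0 0 - M 1 1).
Proof.
rewrite -scalemxAr mxtraceZ /mxtrace sum_ord2 !mulmx2E !mxE /=.
by move: (M 0 0) (M 0 1) (M 1 0) (M 1 1) => x y z w; ring.
Qed.

Lemma res_0E A : res_0 A = - (iC R / 2) * (A 1%N 0 0 - A 1%N 1 1).
Proof. by rewrite /res_0 tr_sigma3 fps_mul0 fps_inv0 mul1mx /fps_deriv mulr1n. Qed.

Lemma res_ooE A : res_oo A = iC R / 2 * (A 1%N 0 0 - A 1%N 1 1).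
Proof.
rewrite /res_oo tr_sigma3 /fps_mul !big_ord_recr big_ord0 /= fps_inv0.
have -> : fps_deriv_oo A 0 = 0 by rewrite /fps_deriv_oo mulr0n oppr0.
have -> : fps_deriv_oo A 1 = 0 by rewrite /fps_deriv_oo mulr0n oppr0.
by rewrite /fps_deriv_oo mul1mx !mulmx0 !addr0 add0r !mxE mulr1n; ring.
Qed.

Lemma xsigma3M (x y : R[i]) : xsigma3 x *m xsigma3 y = xsigma3 (x * y).
Proof.
by apply/matrixP; apply: ord2P; apply: ord2P; rewrite mulmx2E !mxE /= ?invfM; ring.
Qed.

Lemma xsigma3_1 : xsigma3 (1 : R[i]) = 1%:M.
Proof. by apply/matrixP; apply: ord2P; apply: ord2P; rewrite !mxE //= invr1. Qed.

Lemma xsigma3V (x : R[i]) : x != 0 -> xsigma3 x *m xsigma3 x^-1 = 1%:M.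
Proof. by move=> x0; rewrite xsigma3M mulfV // xsigma3_1. Qed.

Lemma xsigma3K (M : 'M[R[i]]_2) x : x != 0 -> M *m xsigma3 x *m xsigma3 x^-1 = M.
Proof. by move=> x0; rewrite -mulmxA xsigma3V // mulmx1. Qed.

(** Taylor coefficients of [exp (c x sigma_3)]. *)
Definition exp_coef (c : R[i]) (m : nat) : 'M[R[i]]_2 :=
  mx2 (c ^+ m / m`!%:R) 0 0 ((- c) ^+ m / m`!%:R).

Lemma exp_coef0 c : exp_coef c 0 = 1%:M.
Proof. by apply/matrixP; apply: ord2P; apply: ord2P; rewrite !mxE //= !expr0 fact0 divr1. Qed.

Lemma fps_mul_exp0 A c : fps_mul A (exp_coef c) 0 = A 0%N.
Proof. by rewrite fps_mul0 exp_coef0 mulmx1. Qed.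

Lemma fps_mul_exp1 A c : A 0%N = 1%:M ->
  fps_mul A (exp_coef c) 1 0 0 = A 1%N 0 0 + c /\
  fps_mul A (exp_coef c) 1 1 1 = A 1%N 1 1 - c.
Proof.
move=> A0; rewrite fps_mul1 exp_coef0 mulmx1 A0 mul1mx; split;
  by rewrite !mxE /= expr1 -[1`!]/1%N divr1 addrC.
Qed.

Lemma cancel_mid (X B C C' W S : 'M[R[i]]_2) : C *m C' = 1%:M -> B \in unitmx ->
  X *m B *m C *m (C' *m (invmx B *m W) *m C *m S) = X *m W *m (C *m S).
Proof.
move=> CC BU; rewrite !mulmxA -(mulmxA (X *m B) C C') CC mulmx1.
by rewrite -(mulmxA X B) mulmxV // mulmx1.
Qed.

Lemma iC2 : iC R * iC R = -1.
Proof. by apply: complexP; rewrite !ReImE /=; ring. Qed.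

End Expansions.

Section TauFunction.
Context {R : realType} (delta : R) (n : nat) (alpha : R[i]) (t : R).
Hypothesis delta0 : 0 < delta.
Hypothesis n0 : (0 < n)%N.
Hypothesis t0 : t < 0.
Context (k : nat) (p q : {poly R[i]}).
Hypothesis pP : is_pi delta n alpha t k p.
Hypothesis qP : is_pi_pred delta n alpha t k q.
Local Notation Y := (Ymx delta n alpha t k p q).
Local Notation s := (s_of n t).
Local Notation Ph := (Phi delta n alpha t k p q).

Let rho : R := Num.sqrt (- t).
Let rho_gt0 : 0 < rho. Proof. by rewrite sqrtr_gt0 oppr_gt0. Qed.
Let rhoC : rho%:C != 0 :> R[i].
Proof. by rewrite eq_complex /= negb_and gt_eqF. Qed.
Let nC : n%:R != 0 :> R[i]. Proof. by rewrite pnatr_eq0 -lt0n. Qed.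
Let iC_neq0 : iC R != 0.
Proof. by rewrite eq_complex /= negb_and oner_eq0 orbT. Qed.
Let sE : s = n%:R * iC R * rho%:C. Proof. by []. Qed.

Let a := powC (rho^-1)%:C (n%:R / 2 + k%:R).
Let br := powC rho%:C (n%:R / 2).
Let a0 : a != 0. Proof. exact: powC_neq0. Qed.
Let br0 : br != 0. Proof. exact: powC_neq0. Qed.

Let aV : a^-1 = br * rho%:C ^+ k.
Proof. by rewrite /a powCV // invrK powCD powC_nat. Qed.

Let PhiE l : l != 0 -> Ph l = xsigma3 a *m Y (rho%:C * l)
  *m xsigma3 (expC (- (n%:R * rho%:C / 2) * l) * expC (n%:R * rho%:C / 2 * l^-1))
  *m xsigma3 (br * powC l (n%:R / 2)).
Proof.
move=> l0; rewrite /Phi sE.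
have -> : n%:R * iC R / (n%:R * iC R * rho%:C) = (rho^-1)%:C.
  by rewrite fmorphV /=; field; rewrite rhoC iC_neq0 nC.
have -> : n%:R * iC R * rho%:C * l / (n%:R * iC R) = rho%:C * l.
  by field; rewrite iC_neq0 nC.
have -> : iC R / 2 * (n%:R * iC R * rho%:C * l - n%:R * iC R * rho%:C / l) =
    - (n%:R * rho%:C / 2) * l + n%:R * rho%:C / 2 * l^-1.
  transitivity ((iC R * iC R) * (n%:R * rho%:C / 2 * l - n%:R * rho%:C / 2 * l^-1)); last by rewrite iC2; ring.
  by move: (l^-1) => l'; ring.
by rewrite expCD (powCM _ rho_gt0 l0).
Qed.

Let scale_oo (l : R[i]) : (rho%:C * l)^-1 = rho%:C^-1 * l^-1.
Proof. by rewrite invfM. Qed.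

Let sct_scale_oo c l : sct_oo c l -> sct_oo c (rho%:C * l).
Proof.
move=> [c1 lc]; split=> //; rewrite Re_realM absCM absCR (ger0_norm (ltW rho_gt0)).
by rewrite mulrCA ler_pM2l.
Qed.

Let sct_scale_0 c l : sct_0 c l -> sct_0 c (rho%:C * l).
Proof.
move=> [c1 lc]; split=> //; rewrite Re_realM absCM absCR normrM (ger0_norm (ltW rho_gt0)).
by rewrite mulrCA ler_pM2l.
Qed.

Let conj_diag (x : R[i]) (M : 'M[R[i]]_2) i : x != 0 ->
  (xsigma3 x *m M *m xsigma3 x^-1) i i = M i i.
Proof.
move=> x0; move: i; apply: ord2P; rewrite !mulmx2E !mxE /=;
  by move: (M 0 0) (M 0 1) (M 1 0) (M 1 1) => y z w v; field.
Qed.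

(** The constant conjugations by powers of [rho = sqrt (- t)] leave the diagonal of
   the first coefficient alone; the exponential left over by the normalization
   adds [n rho / 2] times [sigma_3]. *)
Lemma Phi_oo_exists : exists2 A, Phi_expansion_oo delta n alpha t k p q A &
  A 1%N 0 0 - A 1%N 1 1 = 2 * subl k p / rho%:C + n%:R * rho%:C.
Proof.
have [B [HB B0 B00 B11]] := Y_asym_oo delta0 n0 pP qP.
have H1 := asymM_scale (invr_neq0 rhoC) scale_oo sct_scale_oo HB.
pose c : R[i] := n%:R * rho%:C / 2.
have H2 := asymM_mul (asymM_mulR (xsigma3 a^-1) (asymM_mulL (xsigma3 a) H1))
  (asymM_exp GRing.inv sct_oo c).
pose M m := xsigma3 a *m (rho%:C^-1 ^+ m *: B m) *m xsigma3 a^-1.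
have M0 : M 0%N = 1%:M by rewrite /M expr0 scale1r B0 mulmx1; exact: xsigma3V.
have [M00 M11] := fps_mul_exp1 c M0.
have D i : M 1%N i i = rho%:C^-1 * B 1%N i i by rewrite /M conj_diag // mxE.
exists (fps_mul M (exp_coef c)).
  split; first by rewrite fps_mul_exp0.
  eexists; first by apply/expansion_ooP; exact: H2.
  move=> l l0; rewrite PhiE // -!mulmxA; congr (_ *m (_ *m _)); rewrite !xsigma3M.
  congr xsigma3; rewrite aV exprMn invfM powCD powC_nat //.
  have -> : iC R * s * l / 2 = - (n%:R * rho%:C / 2) * l.
    transitivity ((iC R * iC R) * (n%:R * rho%:C / 2 * l)); last by rewrite iC2; ring.
    by rewrite sE; ring.
  rewrite -/c; move: (expC _) (expC _) (powC l _) => x y z.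
  by have := expf_neq0 k l0; have := expf_neq0 k rhoC;
    move: (l ^+ k) (rho%:C ^+ k) => u v v0 u0; field; rewrite u0 v0.
by rewrite M00 M11 !D B00 B11 /c; field.
Qed.

(** [G] collects the value of the Riemann-Hilbert matrix at 0, whose inverse then
   normalizes the expansion. *)
Lemma Phi_0_exists : exists2 A, Phi_expansion_0 delta n alpha t k p q A &
  n%:R * t%:C * (A 1%N 0 0 - A 1%N 1 1) =
  rho%:C * (2 * (n%:R * subl k p + (k * (k + n))%:R) - n%:R ^+ 2 * t%:C).
Proof.
have [B [HB B0 BT]] := Y_asym_0 delta0 n0 t0 pP qP.
have H1 := asymM_scale (u := id) rhoC (fun l => erefl) sct_scale_0 HB.
pose c : R[i] := - (n%:R * rho%:C / 2).
have H2 := asymM_mul (asymM_mulR (xsigma3 br) (asymM_mulL (xsigma3 br^-1)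
  (asymM_mulL (invmx (B 0%N)) H1))) (asymM_exp id sct_0 c).
pose M m := xsigma3 br^-1 *m (invmx (B 0%N) *m (rho%:C ^+ m *: B m)) *m xsigma3 br.
have brV : xsigma3 br^-1 *m xsigma3 br = 1%:M.
  by rewrite -{2}[br]invrK xsigma3V // invr_eq0.
have M0 : M 0%N = 1%:M by rewrite /M expr0 scale1r mulVmx // mulmx1.
have [M00 M11] := fps_mul_exp1 c M0.
have D i : M 1%N i i = rho%:C * (invmx (B 0%N) *m B 1%N) i i.
  by rewrite /M -{2}[br]invrK conj_diag ?invr_eq0 // -scalemxAr mxE.
exists (fps_mul M (exp_coef c)).
  split; first by rewrite fps_mul_exp0.
  exists (xsigma3 a *m B 0%N *m xsigma3 br); eexists; split.
  - rewrite !unitmx_mul B0 andbT; apply/andP; split; first by case: (mulmx1_unit (xsigma3V a0)).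
    by case: (mulmx1_unit (xsigma3V br0)).
  - by apply/expansion_0P; exact: H2.
  move=> l l0; rewrite PhiE //.
  have -> : - iC R * s / (2 * l) = n%:R * rho%:C / 2 * l^-1.
    transitivity (- (iC R * iC R) * (n%:R * rho%:C / 2 * l^-1)); last by rewrite iC2; ring.
    by rewrite sE; field.
  rewrite -/c; move: (expC _) (expC _) (powC l _) => x y z.
  have -> : xsigma3 a *m B 0%N *m xsigma3 br *m
      (xsigma3 br^-1 *m (invmx (B 0%N) *m Y (rho%:C * l)) *m xsigma3 br *m xsigma3 y) =
      xsigma3 a *m Y (rho%:C * l) *m (xsigma3 br *m xsigma3 y).
    exact: cancel_mid (xsigma3V br0) B0.
  rewrite -!mulmxA !xsigma3M; congr (_ *m (_ *m xsigma3 _)); ring.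
move: BT; rewrite M00 M11 !D.
move: ((invmx (B 0%N) *m B 1%N) 0 0) ((invmx (B 0%N) *m B 1%N) 1 1) => x y BT.
have -> : n%:R * t%:C * (rho%:C * x + c - (rho%:C * y - c)) =
  rho%:C * (n%:R * t%:C * (x - y)) + n%:R * t%:C * (2 * c) by ring.
by rewrite BT /c; move: (k * (k + n))%N => N; field.
Qed.

Lemma Phi_oo_unique A A' : Phi_expansion_oo delta n alpha t k p q A ->
  Phi_expansion_oo delta n alpha t k p q A' -> A =1 A'.
Proof.
move=> [_ [F /expansion_ooP HF EF]] [_ [F' /expansion_ooP HF' EF']].
apply: (asymM_unique (@sct_oo_acc R) HF); apply: eq_asymM HF' => // l lV.
have l0 : l != 0 by rewrite -invr_eq0.
have := EF l l0; rewrite EF' // => E.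
have x0 : powC l (n%:R / 2 + k%:R) != 0 := powC_neq0 _ _.
have y0 := expC_neq0 (iC R * s * l / 2).
move: E x0 y0; move: (powC _ _) (expC _) => x y E x0 y0.
have : F' l *m xsigma3 x *m xsigma3 y *m xsigma3 y^-1 *m xsigma3 x^-1 =
  F l *m xsigma3 x *m xsigma3 y *m xsigma3 y^-1 *m xsigma3 x^-1 by rewrite E.
by rewrite !(xsigma3K _ y0) !(xsigma3K _ x0).
Qed.

(** [G] itself is the constant term of the product, so that it is determined
   before the coefficients are. *)
Lemma Phi_0_unique A A' : Phi_expansion_0 delta n alpha t k p q A ->
  Phi_expansion_0 delta n alpha t k p q A' -> A =1 A'.
Proof.
move=> [A0 [G [F [GU /expansion_0P HF EF]]]] [A0' [G' [F' [GU' /expansion_0P HF' EF']]]].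
have E l : id l != 0 -> G' *m F' l = G *m F l.
  move=> l0; have := EF l l0; rewrite EF' // => E.
  have x0 : powC l (n%:R / 2) != 0 := powC_neq0 _ _.
  have y0 := expC_neq0 (- iC R * s / (2 * l)).
  move: E x0 y0; move: (powC _ _) (expC _) => x y E x0 y0.
  have : G' *m F' l *m xsigma3 x *m xsigma3 y *m xsigma3 y^-1 *m xsigma3 x^-1 =
    G *m F l *m xsigma3 x *m xsigma3 y *m xsigma3 y^-1 *m xsigma3 x^-1 by rewrite E.
  by rewrite !(xsigma3K _ y0) !(xsigma3K _ x0).
have GA : (fun m => G *m A m) =1 (fun m => G' *m A' m).
  apply: (asymM_unique (@sct_0_acc R) (asymM_mulL G HF)).
  exact: eq_asymM E (fun m => erefl) (asymM_mulL G' HF').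
have GG : G = G' by have := GA 0%N; rewrite A0 A0' !mulmx1.
by move=> m; have := GA m; rewrite -GG => /(congr1 (mulmx (invmx G))); rewrite !mulKmx.
Qed.

Lemma deriveC_s : deriveC (s_of n) t = - (n%:R * iC R / (2 * rho%:C)).
Proof.
have nt : 0 < - t by rewrite oppr_gt0.
have H : is_derive t 1 (fun u => Num.sqrt (- u)) ((2 * rho)^-1 * -1).
  have D1 := is_derive1_sqrt nt.
  have D2 : is_derive t 1 (fun u : R => - u) (-1) by exact: is_deriveN.
  by have := @is_derive1_comp _ _ _ _ _ _ D1 D2.
have /is_derCP[_ ->] := is_derC_Z (n%:R * iC R) (is_derC_real H).
by rewrite rmorphM rmorphN1 fmorphV rmorphM /= rmorph_nat; field.
Qed.

(** Uniqueness of the expansions makes the residues independent of the witnesses,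
   so that the explicit expansions may be used. *)
Lemma log_derivative A0 Aoo : Phi_expansion_oo delta n alpha t k p q Aoo ->
  Phi_expansion_0 delta n alpha t k p q A0 ->
  (- res_0 A0 - res_oo Aoo) * deriveC (s_of n) t =
  (2 * n%:R * subl k p + (k * (k + n))%:R) / (2 * t%:C) - n%:R ^+ 2 / 2.
Proof.
move=> Hoo H0; have [B HB BE] := Phi_oo_exists; have [B' HB' BE'] := Phi_0_exists.
rewrite res_0E res_ooE (Phi_oo_unique Hoo HB) (Phi_0_unique H0 HB') BE deriveC_s.
have tE : t%:C = - (rho%:C * rho%:C) :> R[i].
  by rewrite -rmorphM -rmorphN -expr2 sqr_sqrtr ?oppr_ge0 ?ltW // opprK.
have tC : t%:C != 0 :> R[i] by rewrite tE oppr_eq0 mulf_neq0.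
have -> : B' 1%N 0 0 - B' 1%N 1 1 =
    rho%:C * (2 * (n%:R * subl k p + (k * (k + n))%:R) - n%:R ^+ 2 * t%:C) / (n%:R * t%:C).
  by rewrite -BE' mulrC mulKf // mulf_neq0.
move: (subl k p) (k * (k + n))%N => sk kk.
transitivity (- (iC R * iC R) * ((rho%:C * (2 * (n%:R * sk + kk%:R) - n%:R ^+ 2 * t%:C) /
  (n%:R * t%:C) - (2 * sk / rho%:C + n%:R * rho%:C)) * n%:R / (4 * rho%:C))).
  by field; rewrite rhoC nC tC.
by rewrite iC2 tE; field; rewrite rhoC nC.
Qed.

End TauFunction.

(** * The Hankel determinant as a function of the parameter *)

(** Each product with the adjugate becomes the determinant times a trace. *)
Lemma tr_mul_adj (K : comNzRingType) k (A D C : 'M[K]_k) (x y : K) :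
  \tr ((D *m A + A *m D + x *: A - y *: (C *m A)) *m \adj A) =
  \det A * (\tr D *+ 2 + x * k%:R - y * \tr C).
Proof.
have h1 M : \tr (M *m A *m \adj A) = \det A * \tr M.
  by rewrite -mulmxA mul_mx_adj mul_mx_scalar mxtraceZ.
have h2 : \tr (A *m D *m \adj A) = \det A * \tr D.
  by rewrite mxtrace_mulC mulmxA mul_adj_mx mul_scalar_mx mxtraceZ.
have h3 : \tr (A *m \adj A) = \det A * k%:R by rewrite mul_mx_adj mxtrace_scalar mulr_natr.
rewrite mulmxBl 2!mulmxDl -(scalemxAl x) -(scalemxAl y).
have -> (M N : 'M[K]_k) : \tr (M - N) = \tr M - \tr N by exact: raddfB.
rewrite (mxtraceD (_ + _)) mxtraceD h1 h2 (mxtraceZ x) h3 (mxtraceZ y) h1.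
by move: (\tr D) (\tr C) (\det A) => u v d; ring.
Qed.

Section HankelTrace.
Context {R : realType} (n k : nat) (m : R -> nat -> R[i]).
Hypothesis rec : forall (t : R) J,
  (J.+1 + n)%:R * m t J.+1 - n%:R * m t J.+2 + n%:R * t%:C * m t J = 0.
Hypothesis dm : forall t : R, t < 0 -> forall J,
  is_derC (m^~ J.+1) t (- n%:R * m t J).

Let sum_ord j : (\sum_(i < j) (i : nat)%:R : R[i]) *+ 2 = (j * j.-1)%:R.
Proof.
elim: j => [|j IH]; first by rewrite big_ord0 mul0rn.
rewrite big_ord_recr /= mulrnDl IH -[j%:R *+ 2]mulr_natr -natrM -natrD; congr _%:R.
by case: j {IH} => // j; rewrite -mulnDr addn2 mulnC.
Qed.

(** By the moment recursion the derivative of the Hankel matrix combines the matrix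
   itself, its rows and columns weighted by their index, and the matrix of moments
   shifted by one.  The latter is the companion matrix of [p] times the Hankel
   matrix, and contributes the trace of the companion matrix. *)
Lemma hankel_derivative (t : R) : t < 0 -> hankD m t k != 0 ->
  is_derC (hankD m ^~ k) t (((k * (k + n))%:R + n%:R * subcoef m t k) / t%:C * hankD m t k).
Proof.
move=> t0 D0; have tC : t%:C != 0 :> R[i] by rewrite eq_complex /= negb_and lt_eqF.
pose A := hankmx (m t) k; pose p := opoly (m t) k.
pose dA : 'M[R[i]]_k := \matrix_(i, j) (- n%:R * m t (i + j)).
have H : is_derC (fun u => \det (hankmx (m u) k)) t (\tr (dA *m \adj A)).
  apply: is_derC_det => i j; rewrite mxE; under eq_fun do rewrite mxE; exact: dm.
apply: (is_derC_eq H).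
pose D : 'M[R[i]]_k := diag_mx (\row_i (i : nat)%:R).
pose C : 'M[R[i]]_k := \matrix_(i, j) if i.+1 == k then - p`_j else (j == i.+1 :> nat)%:R.
have CA i j : (C *m A) i j = m t (i + j).+2.
  rewrite mxE; under eq_bigr do rewrite !mxE.
  have [ik|ik] := eqVneq i.+1 k; last first.
    have ik' : (i.+1 < k)%N by rewrite ltn_neqAle ik ltn_ord.
    rewrite (bigD1 (Ordinal ik')) //= eqxx mul1r big1 ?addr0 ?addSn // => l.
    by rewrite -val_eqE /= => /negbTE ->; rewrite mul0r.
  have [_ sp po] := opoly_orth D0; have := po j (ltn_ord j).
  rewrite Lmom_mulXn sp big_ord_recr /= (orth_lead (opoly_orth D0)) mul1r => /eqP.
  rewrite addr_eq0 => /eqP E; rewrite -[RHS]opprK -addSn ik -E -sumrN.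
  by apply: eq_bigr => l _; rewrite mulNr.
have trC : \tr C = - subcoef m t k.
  rewrite /mxtrace /subcoef -/p coefXM.
  have [E|[k' E]] : k = 0%N \/ exists k', k = k'.+1 by case: (k) => [|k']; [left|right; exists k'].
    by rewrite [in RHS]E big1 ?oppr0 // => -[i ik]; exfalso; rewrite E in ik.
  have kk : (k' < k)%N by rewrite E.
  rewrite (bigD1 (Ordinal kk)) //= !mxE /= -E eqxx /= big1 ?addr0 => [|i ik]; first by rewrite E.
  rewrite mxE; have -> : (i.+1 == k) = false.
    by apply/negbTE; apply: contraNneq ik => ik; apply/eqP/val_inj => /=; apply: succn_inj; exact: etrans ik E.
  by rewrite ltn_eqF.
have trD : \tr D *+ 2 = (k * k.-1)%:R.
  rewrite mxtrace_diag -sum_ord; congr (_ *+ 2).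
  by apply: eq_bigr => i _; rewrite mxE.
have E : t%:C *: dA = D *m A + A *m D + n.+1%:R *: A - n%:R *: (C *m A).
  apply/matrixP => i j; rewrite mxE mxE mul_diag_mx mul_mx_diag.
  have := CA i j; rewrite !mxE => ->.
  have := rec t (i + j); move: (m t _) (m t _) (m t _) => x y z R0.
  apply/eqP; rewrite -subr_eq0; apply/eqP; rewrite -[RHS]oppr0 -[in RHS]R0.
  by rewrite addSn -[(i + j + n).+1%:R]natr1 -[n.+1%:R]natr1 2!natrD; ring.
apply: (mulfI tC); rewrite -mxtraceZ scalemxAl E tr_mul_adj trC.
rewrite mulrA mulrCA mulfV // mulr1 -/A.
have -> : (k * (k + n))%:R = \tr D *+ 2 + n.+1%:R * k%:R :> R[i].
  rewrite trD -natrM -natrD; congr _%:R; case: (k) => [|j] //=; ring.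
rewrite -[hankD m t k]/(\det A).
by move: (\tr D) (\det A) (subcoef m t k) => x d y; ring.
Qed.

End HankelTrace.

Section AnalyticODE.
Context {R : realType}.

Let near_ball (t0 : R) (P : R -> Prop) : (\forall u \near t0, P u) ->
  exists2 r : R, 0 < r & forall u, `|u - t0| <= r -> P u.
Proof.
move=> /nbhs_ballP[e /= e0 He]; exists (e / 2); first by rewrite divr_gt0.
move=> u ur; apply: He; rewrite /ball /= distrC (le_lt_trans ur) //.
by rewrite ltr_pdivrMr // mulr2n mulrDr mulr1 ltrDl.
Qed.

Let near_bounded f (t0 : R) l : is_derC f t0 l ->
  \forall u \near t0, absC (f u) <= absC (f t0) + 1.
Proof.
move=> /is_derC_cvg/cvgC_abs H.
have := cvgr_lt _ H (absC (f t0) + 1); rewrite ltrDl ltr01 => /(_ _ isT).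
by apply: filterS => u; exact: ltW.
Qed.

Lemma analytic_exp c (t0 : R) : analytic_at (fun t : R => expC (c * t%:C)) t0.
Proof.
have d (u : R) : is_derC (fun t : R => expC (c * t%:C)) u (c * expC (c * u%:C)).
  apply: (is_derC_eq (is_derC_expC (is_derC_Z c (is_derC_id u)))); by rewrite mulr1.
have [r r0 Hr] := near_ball (near_bounded (d t0)).
pose K := absC (expC (c * t0%:C)) + 1.
have := @analytic_of_deriv_bounds R (fun m u => c ^+ m * expC (c * u%:C)) t0 r K (absC c + 1).
rewrite r0 addr_ge0 ?absC_ge0 // ltr_wpDl ?absC_ge0 // => /(_ isT isT isT) H.
have : analytic_at (fun u : R => c ^+ 0 * expC (c * u%:C)) t0.
  apply: H => m u ur.
    by apply: (is_derC_eq (is_derC_Z _ (d u))); rewrite mulrA -exprSr.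
  rewrite absCM absCX mulrC -mulrA ler_pM ?exprn_ge0 ?absC_ge0 ?Hr //.
  apply: le_trans (_ : (absC c + 1) ^+ m <= _).
    by rewrite lerXn2r ?nnegrE ?addr_ge0 ?absC_ge0 // lerDl.
  by rewrite ler_peMl ?exprn_ge0 ?addr_ge0 ?absC_ge0 // ler1n fact_gt0.
by under eq_fun do rewrite expr0 mul1r.
Qed.

Section SecondOrder.
Context (A B : R[i]) (v v1 : R -> R[i]).
Hypothesis dv : forall t : R, t < 0 -> is_derC v t (v1 t).
Hypothesis dv1 : forall t : R, t < 0 -> is_derC v1 t ((A * v1 t + B * v t) / t%:C).

(** The pairs of consecutive derivatives of a solution of
   [t v'' = A v' + B v]: differentiating [m] times only changes [A] to [A - m]. *)
Fixpoint ode_seq (m : nat) (t : R) : R[i] * R[i] :=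
  if m is m'.+1 then
    let x := ode_seq m' t in (x.2, ((A - m'%:R) * x.2 + B * x.1) / t%:C)
  else (v t, v1 t).
Local Notation w m t := (ode_seq m t).1.

Lemma ode_seqSS m t : w m.+2 t = ((A - m%:R) * w m.+1 t + B * w m t) / t%:C.
Proof. by []. Qed.

Let negC (t : R) : t < 0 -> t%:C != 0 :> R[i].
Proof. by move=> t0; rewrite eq_complex /= negb_and lt_eqF. Qed.

Lemma ode_seq_der m t : t < 0 -> is_derC (fun u => w m u) t (w m.+1 t).
Proof.
move=> t0; have tC := negC t0.
suff [] : is_derC (fun u => w m u) t (w m.+1 t) /\
  is_derC (fun u => w m.+1 u) t (w m.+2 t) by [].
elim: m => [|m [IH1 IH2]].
  split; first exact: dv.
  by apply: (is_derC_eq (dv1 t0)); rewrite ode_seqSS /= subr0.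
split=> //; apply: (is_derC_eq (is_derC_M (is_derC_D (is_derC_Z (A - m%:R) IH2)
  (is_derC_Z B IH1)) (is_derC_V tC (is_derC_id t)))).
rewrite [in RHS]ode_seqSS -natr1.
have E : (A - m%:R) * w m.+1 t + B * w m t = t%:C * w m.+2 t.
  by rewrite ode_seqSS [RHS]mulrC divfK.
rewrite E; move: (w m.+2 t) (w m.+1 t) => x y; field.
exact: tC.
Qed.

(** The induction step for the bounds: [s'] is large enough to absorb both terms of
   the recursion. *)
Let ode_step (M a c b' s' : R) : 0 <= M -> 0 <= a -> 0 <= c -> 1 <= s' -> 0 < s' ->
  0 < b' -> b' * (a + 1) + b' * c + 1 = s' ->
  (a + M) * b' * (M + 1) * s' + c * b' <= (M + 1 + 1) * (M + 1) * s' ^+ 2.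
Proof.
move=> M0 a0 c0 s1 s0 bp sE.
have p1 : 0 <= b' * (a + 1) by rewrite mulr_ge0 ?(ltW bp) // addr_ge0.
have p2 : 0 <= b' * c by rewrite mulr_ge0 ?(ltW bp).
have h1 : (a + M) * b' <= (M + 1) * s'.
  apply: le_trans (_ : (M + 1) * (b' * (a + 1)) <= _); last first.
    by rewrite ler_wpM2l ?addr_ge0 //; lra.
  have : 0 <= b' * (M * a + 1) by rewrite mulr_ge0 ?(ltW bp) // addr_ge0 // mulr_ge0.
  have -> : b' * (M * a + 1) = (M + 1) * (b' * (a + 1)) - (a + M) * b' by ring.
  by rewrite subr_ge0.
have h2 : c * b' <= s' * s'.
  apply: le_trans (_ : s' <= _); first by rewrite mulrC; lra.
  by rewrite ler_peMr // ltW.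
have h3 : (a + M) * b' * (M + 1) * s' <= (M + 1) * s' * (M + 1) * s'.
  by rewrite -!mulrA mulrA [leRHS]mulrA ler_wpM2r // mulr_ge0 ?addr_ge0 // ltW.
have h4 : 0 <= M * (s' * s') by rewrite !mulr_ge0 // ltW.
have -> : (M + 1 + 1) * (M + 1) * s' ^+ 2 =
  (M + 1) * s' * (M + 1) * s' + s' * s' + M * (s' * s') by ring.
lra.
Qed.

(** The recursion for the derivatives has coefficients of linear growth in the
   order, hence factorial bounds. *)
Lemma analytic_ode (t0 : R) : t0 < 0 -> analytic_at v t0 /\ analytic_at v1 t0.
Proof.
move=> t00; have b0 : 0 < - t0 / 2 by rewrite divr_gt0 // oppr_gt0.
have N1 : \forall u \near t0, u < t0 / 2.
  by apply: lt_nbhsl; rewrite ltr_pdivlMr // mulr2n mulrDr mulr1 gtrDl.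
have N2 := near_bounded (dv t00); have N3 := near_bounded (dv1 t00).
have N : \forall u \near t0, [/\ u < t0 / 2, absC (v u) <= absC (v t0) + 1 &
    absC (v1 u) <= absC (v1 t0) + 1].
  by near=> u; split; near: u.
have [r r0 Hr] := near_ball N.
pose K := (absC (v t0) + 1) + (absC (v1 t0) + 1); pose b := (- t0 / 2)^-1.
have K0 : 0 <= K by rewrite !addr_ge0 ?absC_ge0.
have bp : 0 < b by rewrite invr_gt0.
pose s := b * (absC A + 1) + b * absC B + 1.
have s1 : 1 <= s by rewrite lerDr addr_ge0 // mulr_ge0 ?addr_ge0 ?absC_ge0 // ltW.
have s0 : 0 < s := lt_le_trans ltr01 s1.
have neg u : `|u - t0| <= r -> u < 0.
  by move=> /Hr[h _ _]; apply: lt_trans h _; rewrite ltr_pdivrMr // mul0r.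
have der m u : `|u - t0| <= r -> is_derC (fun u => w m u) u (w m.+1 u).
  by move=> /neg; exact: ode_seq_der.
have bd u : `|u - t0| <= r -> forall m, absC (w m u) <= K * m`!%:R * s ^+ m /\
    absC (w m.+1 u) <= K * m.+1`!%:R * s ^+ m.+1.
  move=> ur; have [hu h0 h1] := Hr u ur; have u0 := neg u ur.
  have ub : absC (u%:C)^-1 <= b.
    rewrite absCV absCR ltr0_norm // lef_pV2 ?posrE ?oppr_gt0 //; lra.
  elim=> [|m [IH1 IH2]].
    rewrite fact0 expr0 !mulr1 expr1; split.
      by apply: le_trans h0 _; rewrite lerDl addr_ge0 ?absC_ge0.
    apply: le_trans h1 _; apply: le_trans (_ : K <= _); first by rewrite lerDr addr_ge0 ?absC_ge0.
    by rewrite ler_peMr.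
  split=> //; rewrite ode_seqSS absCM.
  have F : 0 <= K * m`!%:R * s ^+ m by rewrite !mulr_ge0 ?exprn_ge0 // ltW.
  have h : absC ((A - m%:R) * w m.+1 u + B * w m u) <=
      (absC A + m%:R) * (K * m.+1`!%:R * s ^+ m.+1) + absC B * (K * m`!%:R * s ^+ m).
    apply: le_trans (ler_absCD _ _) _; rewrite 2!absCM lerD //; last first.
      by rewrite ler_wpM2l ?absC_ge0.
    apply: ler_pM; rewrite ?absC_ge0 //.
    by apply: le_trans (ler_absCD _ _) _; rewrite absCN absC_nat.
  apply: le_trans (ler_pM (absC_ge0 _) (absC_ge0 _) h ub) _.
  rewrite !factS !natrM !exprS -!natr1.
  set f := K * m`!%:R * s ^+ m in F *.
  have -> : K * ((m%:R + 1 + 1) * ((m%:R + 1) * m`!%:R)) * (s * (s * s ^+ m)) =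
    (m%:R + 1 + 1) * (m%:R + 1) * s ^+ 2 * f by rewrite /f; ring.
  have -> : ((absC A + m%:R) * (K * ((m%:R + 1) * m`!%:R) * (s * s ^+ m)) + absC B * f) * b =
    ((absC A + m%:R) * b * (m%:R + 1) * s + absC B * b) * f by rewrite /f; ring.
  by rewrite ler_wpM2r //; apply: ode_step; rewrite ?absC_ge0.
split.
  apply: (@analytic_of_deriv_bounds _ (fun m u => w m u) t0 r K s) => // m u ur.
  by have [] := bd u ur m.
apply: (@analytic_of_deriv_bounds _ (fun m u => w m.+1 u) t0 r (K * s) (2 * s)) => //.
- by rewrite mulr_ge0 // ltW.
- by rewrite mulr_gt0.
- by move=> m u; exact: der.
move=> m u ur; have [_ h] := bd u ur m; apply: le_trans h _.
rewrite factS natrM exprS exprMn.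
have -> : K * (m.+1%:R * m`!%:R) * (s * s ^+ m) = K * s * m`!%:R * (m.+1%:R * s ^+ m) by ring.
rewrite ler_wpM2l ?mulr_ge0 ?(ltW s0) // ler_wpM2r ?exprn_ge0 ?(ltW s0) //.
by rewrite -natrX ler_nat ltn_expl.
Unshelve. all: by end_near. Qed.

End SecondOrder.

Lemma is_derC_powC (p : R[i]) (t : R) : t < 0 ->
  is_derC (fun u : R => powC u%:C p) t (p * powC t%:C p / t%:C).
Proof.
move=> t0; have nt : 0 < - t by rewrite oppr_gt0.
have E u : u < 0 -> powC u%:C p = powC (-1) p * expC (p * (ln (- u))%:C).
  move=> u0; have -> : u%:C = (- u)%:C * -1 :> R[i] by rewrite rmorphN mulrN1 opprK.
  rewrite powCM ?oppr_gt0 ?oppr_eq0 ?oner_eq0 // mulrC; congr (_ * _).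
  by rewrite /powC logCR // oppr_gt0.
have N : \forall u \near t, powC u%:C p = powC (-1) p * expC (p * (ln (- u))%:C).
  have := lt_nbhsl t0; apply: filterS => u; exact: E.
apply: (near_is_derC N).
have L : is_derive t 1 (fun u : R => ln (- u)) ((- t)^-1 * -1).
  have D1 := is_derive1_ln nt.
  have D2 : is_derive t 1 (fun u : R => - u) (-1) by exact: is_deriveN.
  by have := @is_derive1_comp _ _ _ _ _ _ D1 D2.
apply: (is_derC_eq (is_derC_Z _ (is_derC_expC (is_derC_Z p (is_derC_real L))))).
rewrite (E t t0) rmorphM rmorphN1 fmorphV rmorphN /= invrN mulrNN mulr1.
by move: (powC _ _) (expC _) => x y; ring.
Qed.

Lemma analytic_powC (p : R[i]) (t0 : R) : t0 < 0 -> analytic_at (fun t : R => powC t%:C p) t0.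
Proof.
move=> t00; pose v1 (t : R) := p * powC t%:C p / t%:C.
have dv1 t : t < 0 -> is_derC v1 t (((p - 1) * v1 t + 0 * powC t%:C p) / t%:C).
  move=> tn; have tC : t%:C != 0 :> R[i] by rewrite eq_complex /= negb_and lt_eqF.
  apply: (is_derC_eq (is_derC_M (is_derC_Z p (is_derC_powC p tn)) (is_derC_V tC (is_derC_id t)))).
  by rewrite /v1; move: (powC _ _) => x; field.
by have [] := analytic_ode (fun t tn => is_derC_powC p tn) dv1 t00.
Qed.

End AnalyticODE.

(** * The tau-function *)

Section TauTheorem.
Context {R : realType} (delta : R) (n : nat) (alpha : R[i]) (k : nat).
Hypothesis delta0 : 0 < delta.
Hypothesis n0 : (0 < n)%N.
Local Notation mut := (mu delta n alpha).

Let nC : n%:R != 0 :> R[i]. Proof. by rewrite pnatr_eq0 -lt0n. Qed.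
Let negC (t : R) : t < 0 -> t%:C != 0 :> R[i].
Proof. by move=> t0; rewrite eq_complex /= negb_and lt_eqF. Qed.

(** The moment of order one solves [t v'' = (n + 1) v' + n ^ 2 v], its derivative is
   a multiple of the moment of order zero, and the others follow by recursion. *)
Lemma analytic_mu J (t0 : R) : t0 < 0 -> analytic_at (mut^~ J.+1) t0.
Proof.
move=> t00; have dmu := mut_der alpha delta0 n0.
pose v1 t := - n%:R * mut t 1.
have dv1 t : t < 0 -> is_derC v1 t ((n.+1%:R * v1 t + n%:R ^+ 2 * mut t 2) / t%:C).
  move=> tn; apply: (is_derC_eq (is_derC_Z _ (dmu t tn 0%N))).
  have := mu_rec alpha delta0 n0 t 0; rewrite /v1.
  move: (mut t 0) (mut t 1) (mut t 2) => x y z R0; apply: (mulIf (negC tn)).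
  rewrite divfK ?negC //; apply/eqP; rewrite -subr_eq0; apply/eqP.
  by rewrite -[RHS](mulr0 n%:R) -[in RHS]R0 natrD -natr1; ring.
have [a2 a1] := analytic_ode (fun t tn => dmu t tn 1%N) dv1 t00.
have {}a1 : analytic_at (mut^~ 1) t0.
  have := analytic_M (analytic_cst (- n%:R^-1) t0) a1; congr analytic_at.
  by apply/funext => t; rewrite /v1; move: (mut t 1) => x; field.
have aid : analytic_at (real_complex R) t0.
  have d1 (t : R) : t < 0 -> is_derC (fun=> 1) t ((0 * 1 + 0 * t%:C) / t%:C).
    by move=> _; apply: (is_derC_eq (is_derC_cst t 1)); rewrite !mul0r addr0 mul0r.
  by have [] := analytic_ode (fun t _ => is_derC_id t) d1 t00.
suff H : analytic_at (mut^~ J.+1) t0 /\ analytic_at (mut^~ J.+2) t0 by case: H.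
elim: J => [|J [IH1 IH2]]; first by split; [exact: a1|exact: a2].
split; first exact: IH2.
have := analytic_M (analytic_cst n%:R^-1 t0) (analytic_D (analytic_M (analytic_cst (J.+2 + n)%:R t0) IH2)
  (analytic_M (analytic_M (analytic_cst n%:R t0) aid) IH1)); congr analytic_at.
apply/funext => t; have := mu_rec alpha delta0 n0 t J.+1.
move: (mut t J.+1) (mut t J.+2) (mut t J.+3) (J.+2 + n)%N => x y z N R0.
apply: (mulfI nC); rewrite mulrA mulfV // mul1r; apply/eqP; rewrite -subr_eq0; apply/eqP.
by rewrite -[RHS]R0; ring.
Qed.

Lemma analytic_hankel (t0 : R) : t0 < 0 -> analytic_at (hankD mut ^~ k) t0.
Proof.
move=> t00; apply: (closure_hankmx (P := fun f => analytic_at f t0)).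
- by move=> c; exact: analytic_cst.
- by move=> f g; exact: analytic_D.
- by move=> f g; exact: analytic_M.
- by move=> J; exact: analytic_mu.
Qed.

Definition jmu_power : R[i] := (k * (k + n))%:R / 2.
Definition jmu_factor (t : R) : R[i] :=
  expC (- (n%:R ^+ 2 / 2) * t%:C) * powC t%:C (- jmu_power).
Definition jmu_tau (t : R) : R[i] := hankD mut t k * jmu_factor t.

Lemma jmu_factor_neq0 t : jmu_factor t != 0.
Proof. by rewrite mulf_neq0 ?expC_neq0 ?powC_neq0. Qed.

Lemma jmu_factorV t : (jmu_factor t)^-1 =
  expC (n%:R ^+ 2 * t%:C / 2) * powC t%:C jmu_power.
Proof.
rewrite /jmu_factor invfM; congr (_ * _); first by rewrite -expCN; congr expC; ring.
by rewrite /powC mulNr expCN invrK.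
Qed.

Lemma analytic_jmu_tau (t0 : R) : t0 < 0 -> analytic_at jmu_tau t0.
Proof.
move=> t00; apply: analytic_M; first exact: analytic_hankel.
by apply: analytic_M; [exact: analytic_exp|exact: analytic_powC].
Qed.

Lemma jmu_tau_der (t : R) : t < 0 -> hankD mut t k != 0 ->
  is_derC jmu_tau t (((2 * n%:R * subcoef mut t k + (k * (k + n))%:R) / (2 * t%:C)
    - n%:R ^+ 2 / 2) * jmu_tau t).
Proof.
move=> t0 D0; have tC := negC t0.
have H1 := hankel_derivative (mu_rec alpha delta0 n0) (mut_der alpha delta0 n0) t0 D0.
have H2 := is_derC_expC (is_derC_Z (- (n%:R ^+ 2 / 2)) (is_derC_id t)).
have H3 := is_derC_powC (- jmu_power) t0.
apply: (is_derC_eq (is_derC_M H1 (is_derC_M H2 H3))).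
rewrite /jmu_tau /jmu_factor /jmu_power.
move: (powC t%:C (- ((k * (k + n))%:R / 2))) (expC (- (n%:R ^+ 2 / 2) * t%:C)) (hankD mut t k) (subcoef mut t k) (k * (k + n))%N => w e d s N.
by field.
Qed.

Lemma jmu_tau_log_der (tau : R -> R[i]) (t : R) p q : t < 0 ->
  is_pi delta n alpha t k p -> is_pi_pred delta n alpha t k q ->
  is_tau delta n alpha k tau -> hankD mut t k != 0 ->
  tau t != 0 /\ deriveC tau t =
    ((2 * n%:R * subcoef mut t k + (k * (k + n))%:R) / (2 * t%:C) - n%:R ^+ 2 / 2) * tau t.
Proof.
move=> t0 pP qP [_ /(_ t p q t0 pP qP)[Aoo [A0 [Hoo H0 tau0 E]]]] D0; split=> //.
have [_ pE] := is_pi_det delta0 n0 pP.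
have L := log_derivative delta0 n0 t0 pP qP Hoo H0.
by rewrite -[LHS](divfK tau0) E L /subl pE.
Qed.

Lemma jmu_tau_is_tau : is_tau delta n alpha k jmu_tau.
Proof.
split; first by apply/analyticCP => t; rewrite /= in_itv /=; exact: analytic_jmu_tau.
move=> t p q t0 pP qP; have [D0 pE] := is_pi_det delta0 n0 pP.
have [Aoo Hoo _] := Phi_oo_exists delta0 n0 t0 pP qP.
have [A0 H0 _] := Phi_0_exists delta0 n0 t0 pP qP.
have T0 : jmu_tau t != 0 by rewrite mulf_neq0 ?jmu_factor_neq0.
exists Aoo, A0; split=> //.
rewrite (log_derivative delta0 n0 t0 pP qP Hoo H0) /subl.
by have /is_derCP[_ ->] := jmu_tau_der t0 D0; rewrite mulfK // pE.
Qed.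

(** Near 0 all the determinants involved are nonzero because their limits are, so
   two tau-functions have the same logarithmic derivative there; analyticity carries
   the proportionality over to the whole half-line, zeros included. *)
Lemma tau_proportional (tau : R -> R[i]) : is_tau delta n alpha k tau ->
  exists2 C : R[i], C != 0 & forall t : R, t < 0 -> jmu_tau t = C * tau t.
Proof.
move=> tauP; have [/analyticCP tau_an _] := tauP.
have := near_good_at0 k (mu_cvg0 alpha delta0 n0) (mut_det0 alpha delta0 n0).
rewrite /at_left /within /= => /nbhs_ballP[e /= e0 He].
have gd u : - e < u < 0 -> good k mut u.
  move=> /andP[h1 h2]; apply: He => //; rewrite /ball /= sub0r normrN ltr0_norm //; lra.
have tau_der u : - e < u < 0 -> tau u != 0 /\ is_derC (fun x => jmu_tau x / tau x) u 0.
  move=> ue; have [u0 D0 D1 _] := gd u ue.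
  have pP := opoly_is_pi delta0 n0 D1.
  have [q qP] : exists q, is_pi_pred delta n alpha u k q.
    move: D0; case: (k) => [|k'] D0; first by exists 0.
    by exists (opoly (mut u) k'); exact: (opoly_is_pi delta0 n0).
  have [tn tE] := jmu_tau_log_der u0 pP qP tauP D1; split=> //.
  have [|l Hl] := analytic_is_derC (tau_an u _); first by rewrite /= in_itv /=.
  have /is_derCP[_ lE] := Hl; rewrite tE in lE.
  apply: (is_derC_eq (is_derC_M (jmu_tau_der u0 D1) (is_derC_V tn Hl))).
  rewrite -lE; move: tn; move: (tau u) (jmu_tau u) (_ - n%:R ^+ 2 / 2) => x y z x0.
  by field.
pose a := - e / 2; have ae : - e < a < 0.
  by rewrite /a mulNr oppr_lt0 divr_gt0 // andbT ltrN2 ltr_pdivrMr // mulr2n mulrDr mulr1 ltrDl.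
have Cst u : - e < u < 0 -> jmu_tau u / tau u = jmu_tau a / tau a.
  move=> ue; apply/eqP; rewrite -subr_eq0 -absC_eq0 eq_le absC_ge0 andbT.
  have ua : `|u - a| < e / 2.
    by case/andP: ue => h1 h2; rewrite ltr_norml /a; apply/andP; split; lra.
  have := @derC_pow_bound R (fun x => jmu_tau x / tau x - jmu_tau a / tau a) (fun=> 0) a u 0 0.
  rewrite subrr mulr0 !mul0r; apply=> // v va; last by rewrite absC0 mul0r.
  apply: (is_derC_eq (is_derC_B (tau_der v _).2 (is_derC_cst v _))); last by rewrite subr0.
  have : `|v - a| < e / 2 := le_lt_trans va ua.
  rewrite ltr_norml /a => /andP[h1 h2]; apply/andP; split; lra.
have [ta _] := tau_der a ae.
exists (jmu_tau a / tau a).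
  have [_ _ D1 _] := gd a ae.
  by rewrite mulf_neq0 ?invr_eq0 // mulf_neq0 ?jmu_factor_neq0.
move=> t t0; apply/eqP; rewrite -subr_eq0; apply/eqP.
apply: (@analytic_identity R (fun t => jmu_tau t - jmu_tau a / tau a * tau t) e e0 _ _ t t0).
  move=> u u0; have au : analytic_at tau u by apply: tau_an; rewrite /= in_itv /=.
  have := analytic_D (analytic_jmu_tau u0) (analytic_M (analytic_cst (- (jmu_tau a / tau a)) u) au).
  by congr analytic_at; apply/funext => x; rewrite mulNr.
by move=> u ue; have [tu _] := tau_der u ue; rewrite -(Cst u ue) divfK // subrr.
Qed.

End TauTheorem.

Unset Implicit Arguments.
Theorem theorem1 (R : realType) (delta : R) (n k : nat) (alpha : R[i]) :
  0 < delta -> (0 < n)%N ->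
  (forall a : R -> R[i],
    (forall (t : R) (x : R[i]), t < 0 -> is_alpha delta n alpha t k x ->
      a t = x - (2 * k + 1 + n)%:R / n%:R) ->
    [/\ forall t : R, t < 0 -> (exists x, is_alpha delta n alpha t k x) ->
          [/\ (\forall u \near t, derivableC a u),
              derivableC (deriveC a) t &
              a t != 0 ->
              deriveC (deriveC a) t =
                deriveC a t ^+ 2 / a t - deriveC a t / t%:C
                + n%:R * (2 * k + 1 + n)%:R * (a t ^+ 2 / t%:C ^+ 2)
                + n%:R ^+ 2 * a t ^+ 3 / t%:C ^+ 2
                + n%:R ^+ 2 / t%:C - n%:R ^+ 2 / a t],
        cvgC 0^'- a 0 &
        cvgC 0^'- (deriveC a) 1])
  /\ (exists tau : R -> R[i], is_tau delta n alpha k tau)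
  /\ (forall tau : R -> R[i], is_tau delta n alpha k tau ->
       exists2 C : R[i], C != 0 & forall t : R, t < 0 ->
         hankel delta n alpha t k =
           C * tau t * expC (n%:R ^+ 2 * t%:C / 2)
           * powC t%:C ((k * (k + n))%:R / 2)).
Proof.
move=> delta0 n0; split; first exact: painleve_III.
split; first by exists (jmu_tau delta n alpha k); exact: jmu_tau_is_tau.
move=> tau /(tau_proportional delta0 n0)[C C0 HC]; exists C => // t t0.
rewrite -HC // (hankelE n alpha delta0) -mulrA -/(jmu_power n k) -jmu_factorV.
by rewrite /jmu_tau mulfK ?jmu_factor_neq0.
Qed.
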